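(* Let $n\ge2$, $0<r<R<1$ and $H=\{z\in\mathbb{C}^n:\ z_2=z_3=\cdots=z_n=0\}$. Let $\delta>0$ be such that for each $z\in\partial\mathbb{D}^n_r\cap H$ and $p=\frac{R}{r}z$ we have $B^n(z,\delta)\subset\mathbb{D}^n$ and $\tanh c_{\mathbb{D}^n}(p,w)<R$ for all $w\in B^n(z,\delta)$. Let $z_1,\dots,z_m\in\partial\mathbb{D}^n_r\cap H$ be such that $\partial\mathbb{D}^n_r\cap H\subset\bigcup_{i=1}^mB^n(z_i,\delta)$, and set $p_i=\frac{R}{r}z_i=(p_{i1},\dots,p_{in})$. Let $$H_i=\{w\in\mathbb{C}^n:\ w_1=p_{i1}\},\quad 1\le i\le m,$$ $A=\bigcup_{i=1}^mH_i$ and $D=\mathbb{D}^n\setminus A$. Then neither of the functions $s_D^{\mathbb{D}^n}$ and $\tilde e_D^{\mathbb{D}^n}$ is plurisubharmonic on $D$.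
   Context: $\mathbb{D}^n$ is the unit polydisk in $\mathbb{C}^n$, $\mathbb{D}=\mathbb{D}^1$, $\mathbb{D}^n_r=\{z\in\mathbb{C}^n: |z_i|<r,\ 1\le i\le n\}$, and $B^n(p,\delta)$ is the open Euclidean ball with centre $p$ and radius $\delta$; $O(X,Y)$ is the set of holomorphic maps from $X$ into $Y$. Carathéodory pseudodistance on a domain $D$: $c_D(z,w)=\sup\{\tanh^{-1}|\lambda| : f\in O(D,\mathbb{D}),\ f(z)=0,\ f(w)=\lambda\}$, with balls $B^c_D(z,r)=\{w\in D: c_D(z,w)<r\}$. For a bounded domain $D\subset\mathbb{C}^n$ and $z\in D$: generalized squeezing function $s^{\mathbb{D}^n}_D(z)=\sup\{r>0:\ \{w\in\mathbb{C}^n:\max_i|w_i|<r\}\subset f(D)$ for some injective $f\in O(D,\mathbb{D}^n)$ with $f(z)=0\}$; Fridman invariant $\tilde e^{\mathbb{D}^n}_D(z)=\sup\{\tanh(r):\ B^c_D(z,r)\subset f(\mathbb{D}^n)$ for some injective $f\in O(\mathbb{D}^n,D)\}$. *)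

(* Defs.v *)
From HB Require Import structures.
From mathcomp Require Import all_boot all_order all_algebra.
From mathcomp Require Import complex.
From mathcomp Require Import all_classical all_reals all_analysis.

Set Implicit Arguments.
Unset Strict Implicit.
Unset Printing Implicit Defensive.

Import Order.TTheory GRing.Theory Num.Theory.
Import numFieldNormedType.Exports.

Local Open Scope classical_set_scope.
Local Open Scope ring_scope.
Local Open Scope complex_scope.

(* K[i] gets the topology of its modulus and becomes a normed module over
   itself, so that [differentiable] below is complex (Frechet)
   differentiability. *)
HB.instance Definition _ (K : realType) := NormedModule.copy K[i] K[i]^o.

Section Geometry.
Context {K : realType}.

Definition cabs (x : K[i]) : K := complex.Re `|x|.

Definition unit_disk : set K[i] := [set x | cabs x < 1].

Definition polydisk n (r : K) : set 'rV[K[i]]_n :=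
  [set z | forall i, cabs (z 0 i) < r].

Definition eball n (p : 'rV[K[i]]_n) (delta : K) : set 'rV[K[i]]_n :=
  [set w | Num.sqrt (\sum_i cabs (w 0 i - p 0 i) ^+ 2) < delta].

Definition frontier (T : topologicalType) (A : set T) : set T :=
  closure A `\` A°.

Definition ord_first n (hn : (2 <= n)%N) : 'I_n := Ordinal (ltnW hn).

Definition first_axis n (hn : (2 <= n)%N) : set 'rV[K[i]]_n :=
  [set z | forall i, i != ord_first hn -> z 0 i = 0].

Definition hyperplane n (i : 'I_n) (c : K[i]) : set 'rV[K[i]]_n :=
  [set w | w 0 i = c].

(* Maps are total functions; only their values on the open set X matter. *)
Definition holo (V W : normedModType K[i]) (X : set V) (Y : set W) :
    set (V -> W) :=
  [set f | (forall z, X z -> differentiable f z) /\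
           (forall z, X z -> Y (f z))].

End Geometry.

Section Invariants.
Context {K : realType}.
Implicit Types (x r : K) (e : \bar K).

Definition tanh x : K := (expR x - expR (- x)) / (expR x + expR (- x)).

Definition artanh x : K := 2^-1 * ln ((1 + x) / (1 - x)).

Definition etanh e : K :=
  match e with x%:E => tanh x | +oo%E => 1 | -oo%E => -1 end.

(* The suprema below are taken in \bar K: ereal_sup, unlike the real sup, is
   not sent to 0 on unbounded sets. *)
Variables (n : nat) (D : set 'rV[K[i]]_n).
Implicit Types z w : 'rV[K[i]]_n.

Definition caratheodory z w : \bar K :=
  ereal_sup [set (artanh (cabs lambda))%:E | lambda in
    [set lambda : K[i] | exists f : 'rV[K[i]]_n -> K[i],
      [/\ holo D unit_disk f, f z = 0 & f w = lambda]]].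

Definition caratheodory_ball z r : set 'rV[K[i]]_n :=
  [set w | D w /\ (caratheodory z w < r%:E)%E].

Definition squeezing z : \bar K :=
  ereal_sup [set r%:E | r in
    [set r : K | 0 < r /\ exists f : 'rV[K[i]]_n -> 'rV[K[i]]_n,
      [/\ holo D (polydisk 1) f, {in D &, injective f}, f z = 0 &
          polydisk r `<=` f @` D]]].

Definition fridman z : \bar K :=
  ereal_sup [set (tanh r)%:E | r in
    [set r : K | 0 < r /\ exists f : 'rV[K[i]]_n -> 'rV[K[i]]_n,
      [/\ holo (polydisk 1) D f, {in polydisk 1 &, injective f} &
          caratheodory_ball z r `<=` f @` polydisk 1]]].

End Invariants.

Section Plurisubharmonic.
Context {K : realType}.

Definition usc_on (T : topologicalType) (A : set T) (u : T -> \bar K) :=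
  forall z a, A z -> (u z < a%:E)%E -> \forall w \near z, A w -> (u w < a%:E)%E.

(* An upper semicontinuous g < +oo is bounded above on the circle, so this
   integral is well defined, possibly -oo. *)
Definition circle_mean (g : K[i] -> \bar K) (a : K[i]) (rho : K) : \bar K :=
  ((2 * pi)^-1%:E * \int[lebesgue_measure]_(t in `[0%R, (2 * pi)%R])
     g (a + rho%:C * (cos t +i* sin t))%R)%E.

(* Values in [-oo, +oo[; the constant -oo is allowed. *)
Definition subharmonic (U : set K[i]) (g : K[i] -> \bar K) :=
  [/\ forall x, U x -> (g x < +oo)%E,
      usc_on U g &
      forall a rho, 0 < rho -> [set x | cabs (x - a) <= rho] `<=` U ->
        (g a <= circle_mean g a rho)%E].

Definition plurisubharmonic n (D : set 'rV[K[i]]_n)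
    (u : 'rV[K[i]]_n -> \bar K) :=
  [/\ forall z, D z -> (u z < +oo)%E,
      usc_on D u &
      forall a b, subharmonic [set t : K[i] | D (a + t *: b)]
                              (fun t => u (a + t *: b))].

End Plurisubharmonic.

(* Main.v *)
Require Import Defs.
From HB Require Import structures.
From mathcomp Require Import all_boot all_order all_algebra.
From mathcomp Require Import complex.
From mathcomp Require Import all_classical all_reals all_analysis.
From mathcomp Require Import ring lra.

(** The function [f = id] shows that the squeezing function at the origin is at
    least [R], and [f = (R *: _)] shows the same for the Fridman invariant: the
    domain [D] contains the polydisk of radius [R], whose boundary the removed
    hyperplanes touch. On the circle of radius [r] in the first axis, on the
    other hand, both invariants at a point [x] are at most the modulus of the
    disk automorphism [mobius x] at each puncture [a i] = first coordinate of
    [p i] ([squeezing_le], [fridman_le]). The hypothesis on [delta] says that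
    for every such [x] some puncture gives a value below [R], and by
    compactness of the circle a single [M < R] serves for all [x]
    ([uniform_cover]). So the mean over the circle is at most [M], the value at
    the centre is at least [R], and the sub-mean value inequality fails
    ([not_plurisubharmonic]).

    The upper bounds come from a bounded holomorphic map on the first axis,
    which has removable singularities at the punctures. For the squeezing
    function take a competing embedding [f] of [D] in the polydisk with [f] of
    the base point equal to 0. By Schwarz-Pick ([schwarz_pick], which tolerates
    finitely many punctures) the components of its limit [w] at the puncture are
    bounded by [mobius x (a i)]. If the image of [f] contained a larger
    polydisk, [w] would be a value [f q]; since [f] is open at [q], points near
    [q] and points near the puncture would have the same image, contradicting
    injectivity. For the Fridman invariant, the Caratheodory ball contains a
    punctured disk around the puncture as soon as its radius exceeds the bound;
    the inverse of the competing embedding is bounded and holomorphic there,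
    and its limit, a point of the open polydisk, is mapped to the removed point.

    Two theorems of several complex variables enter: an injective holomorphic
    map between domains of equal dimension is open, and its inverse is
    holomorphic. Both follow from [osgood], injectivity of its differentials,
    together with Newton's iteration ([open_image]). The proof of [osgood] is by
    induction on the dimension. Where the differential is not zero, one
    component serves as a coordinate and the others give an injective map of
    one variable less on its level set ([osgood_step]). Consequently the
    differential vanishes identically on the zero set of the Jacobian
    determinant; if that set is not empty, it contains a Lipschitz curve along
    which the map has zero speed ([transversal_function], [flat_curve]), so that
    the map is constant on it.

    Cauchy's theory is reduced to the maximum principle, which avoids contour
    integrals: Goursat's lemma is proved for Riemann sums over parallelograms
    ([goursat]), and in the logarithmic coordinate it bounds the value at the
    centre of a disk by the values on its boundary ([cabs_center_le]). The
    maximum principle applied to difference quotients yields the Cauchy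
    estimates ([lipschitz_est], [taylor1_est]), hence removable singularities,
    limits of holomorphic functions and Hurwitz's theorem. *)

Set Implicit Arguments.
Unset Strict Implicit.
Unset Printing Implicit Defensive.

Import Order.TTheory GRing.Theory Num.Theory.
Import numFieldNormedType.Exports.

Local Open Scope classical_set_scope.
Local Open Scope ring_scope.
Local Open Scope complex_scope.

Local Notation Re := complex.Re.
Local Notation Im := complex.Im.

(** * Moduli, norms and differentiability estimates *)

Section Modulus.
Context {K : realType}.
Implicit Types (x y : K[i]).

Lemma cabsE (x : K[i]) : (cabs x)%:C = `|x|.
Proof. by rewrite /cabs normc_def. Qed.

Lemma cabs_ge0 x : 0 <= cabs x.
Proof. by rewrite -ler0c cabsE normr_ge0. Qed.

Lemma cabs0 : cabs (0 : K[i]) = 0.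
Proof. by apply: complexI; rewrite cabsE normr0. Qed.

Lemma cabs1 : cabs (1 : K[i]) = 1.
Proof. by apply: complexI; rewrite cabsE normr1. Qed.

Lemma cabs_eq0 x : (cabs x == 0) = (x == 0).
Proof. by rewrite -(inj_eq (@complexI K)) cabsE normr_eq0. Qed.

Lemma cabs_gt0 x : (0 < cabs x) = (x != 0).
Proof. by rewrite lt_def cabs_ge0 andbT cabs_eq0. Qed.

Lemma cabsN x : cabs (- x) = cabs x.
Proof. by rewrite /cabs normrN. Qed.

Lemma cabsM x y : cabs (x * y) = cabs x * cabs y.
Proof. by apply: complexI; rewrite cabsE normrM rmorphM /= !cabsE. Qed.

Lemma cabsX x n : cabs (x ^+ n) = cabs x ^+ n.
Proof. by elim: n => [|n IH]; rewrite ?cabs1 // !exprS cabsM IH. Qed.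

Lemma cabsV x : cabs x^-1 = (cabs x)^-1.
Proof.
have [->|x0] := eqVneq x 0; first by rewrite invr0 cabs0 invr0.
apply: (mulIf (x := cabs x)); first by rewrite cabs_eq0.
by rewrite -cabsM !mulVf ?cabs1 ?cabs_eq0.
Qed.

Lemma cabs_real (a : K) : cabs a%:C = `|a|.
Proof. by rewrite /cabs normc_def /= expr0n addr0 sqrtr_sqr. Qed.

Lemma cabs_pos (a : K) : 0 < a -> cabs a%:C = a.
Proof. by move=> a0; rewrite cabs_real gtr0_norm. Qed.

Lemma cabs_nat n : cabs (n%:R : K[i]) = n%:R.
Proof.
by rewrite -[n%:R in LHS](rmorph_nat (@real_complex_def K (Phant K))) cabs_real normr_nat.
Qed.

Lemma cabsD x y : cabs (x + y) <= cabs x + cabs y.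
Proof. by rewrite -lecR rmorphD /= !cabsE ler_normD. Qed.

Lemma cabsB x y : cabs (x - y) <= cabs x + cabs y.
Proof. by rewrite -(cabsN y) cabsD. Qed.

Lemma cabs_distC x y : cabs (x - y) = cabs (y - x).
Proof. by rewrite -cabsN opprB. Qed.

Lemma cabs_dist x y : cabs x - cabs y <= cabs (x - y).
Proof. by rewrite lerBlDr (le_trans _ (cabsD _ _)) // subrK. Qed.

Lemma cabs_sqr x : cabs x ^+ 2 = Re x ^+ 2 + Im x ^+ 2.
Proof. by rewrite /cabs normc_def /= sqr_sqrtr // addr_ge0 ?sqr_ge0. Qed.

Lemma cabs_Re x : `|Re x| <= cabs x.
Proof. by rewrite -lecR cabsE normc_ge_Re. Qed.

Lemma cabs_Im x : `|Im x| <= cabs x.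
Proof.
rewrite -(ler_pXn2r (n := 2)) ?nnegrE ?cabs_ge0 // cabs_sqr real_normK ?num_real //.
by rewrite lerDr sqr_ge0.
Qed.

Lemma cabs_le x : cabs x <= `|Re x| + `|Im x|.
Proof.
rewrite -(ler_pXn2r (n := 2)) ?nnegrE ?cabs_ge0 ?addr_ge0 // cabs_sqr sqrrD.
by rewrite !real_normK ?num_real // lerD2r lerDl mulrn_wge0 ?mulr_ge0.
Qed.

Lemma cabs_conj x : cabs x^* = cabs x.
Proof. by rewrite /cabs normcJ. Qed.

End Modulus.

Lemma half_lt (K : realType) (x : K) : 0 < x -> x / 2 < x.
Proof. by move=> x0; rewrite ltr_pdivrMr // ltr_pMr // ltr1n. Qed.

Lemma exp2V_gt0 (K : realType) k : 0 < (2 ^+ k : K)^-1.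
Proof. by rewrite invr_gt0 exprn_gt0. Qed.

Lemma exp2VS (K : realType) k : (2 ^+ k.+1 : K)^-1 = (2 ^+ k)^-1 / 2.
Proof. by rewrite exprS invfM mulrC. Qed.

Lemma addrKC (V : zmodType) (x y : V) : x + y - x = y.
Proof. by rewrite addrC addKr. Qed.

(** The norms of complex normed modules take values in [K[i]]; estimates are
    carried out with their real parts. *)
Section RealNorm.
Context {K : realType}.

Definition nrm (V : normedModType K[i]) (x : V) : K := Re `|x|.

Lemma nrmE (V : normedModType K[i]) (x : V) : (nrm x)%:C = `|x|.
Proof. by apply: RRe_real; apply: normr_real. Qed.

Lemma nrm_ge0 (V : normedModType K[i]) (x : V) : 0 <= nrm x.
Proof. by rewrite -ler0c nrmE normr_ge0. Qed.

Lemma nrm0 (V : normedModType K[i]) : nrm (0 : V) = 0.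
Proof. by rewrite /nrm normr0. Qed.

Lemma nrm_eq0 (V : normedModType K[i]) (x : V) : (nrm x == 0) = (x == 0).
Proof. by rewrite -(inj_eq (@complexI K)) nrmE normr_eq0. Qed.

Lemma nrm_gt0 (V : normedModType K[i]) (x : V) : (0 < nrm x) = (x != 0).
Proof. by rewrite lt_def nrm_ge0 andbT nrm_eq0. Qed.

Lemma nrmD (V : normedModType K[i]) (x y : V) : nrm (x + y) <= nrm x + nrm y.
Proof. by rewrite -lecR rmorphD /= !nrmE ler_normD. Qed.

Lemma nrmN (V : normedModType K[i]) (x : V) : nrm (- x) = nrm x.
Proof. by rewrite /nrm normrN. Qed.

Lemma nrmB (V : normedModType K[i]) (x y : V) : nrm (x - y) <= nrm x + nrm y.
Proof. by rewrite -(nrmN y) nrmD. Qed.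

Lemma nrm_distC (V : normedModType K[i]) (x y : V) : nrm (x - y) = nrm (y - x).
Proof. by rewrite -nrmN opprB. Qed.

Lemma nrmZ (V : normedModType K[i]) (a : K[i]) (x : V) :
  nrm (a *: x) = cabs a * nrm x.
Proof. by apply: complexI; rewrite nrmE normrZ rmorphM /= nrmE cabsE. Qed.

Lemma nrm_cabs (x : K[i]) : nrm x = cabs x.
Proof. by []. Qed.

Lemma nrm_nbhs (V : normedModType K[i]) (x : V) (A : set V) :
  nbhs x A <-> exists2 d : K, 0 < d & forall y, nrm (y - x) < d -> A y.
Proof.
split.
  move=> /nbhs_normP[e /= e0 eA].
  have er : e = (Re e)%:C by rewrite RRe_real // gtr0_real.
  exists (Re e); first by rewrite -ltcR -er.
  move=> y yx; apply: eA => /=.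
  by rewrite distrC er -nrmE ltcR.
move=> [d d0 dA]; apply/nbhs_normP; exists d%:C => /=; first by rewrite ltcR.
by move=> y /=; rewrite distrC -nrmE ltcR => /dA.
Qed.


Lemma littleo_est (V W : normedModType K[i]) (g : V -> W) :
  (forall e : K[i], 0 < e -> \forall h \near (0 : V), `|g h| <= e * `|h|) <->
  forall e : K, 0 < e -> exists2 d : K, 0 < d & forall h, nrm h < d ->
    nrm (g h) <= e * nrm h.
Proof.
split=> [go e e0|H e e0].
  have := go e%:C; rewrite ltcR => /(_ e0)/nrm_nbhs[d d0 Hd].
  exists d => // h; rewrite -{1}(subr0 h) => /Hd /=.
  by rewrite -!nrmE -rmorphM /= lecR.
have er : e = (Re e)%:C by rewrite RRe_real // gtr0_real.
have [|d d0 Hd] := H (Re e); first by rewrite -ltcR -er.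
apply/nrm_nbhs; exists d => // h; rewrite subr0 => /Hd /=.
by rewrite er -!nrmE -rmorphM /= lecR.
Qed.

(** The filter definition of differentiability traded for an explicit remainder
    bound; [diff_intro] is the way back. *)
Lemma diff_est (V W : normedModType K[i]) (f : V -> W) (x : V) (e : K) :
  differentiable f x -> 0 < e ->
  exists2 d : K, 0 < d & forall h, nrm h < d ->
    nrm (f (x + h) - f x - 'd f x h) <= e * nrm h.
Proof.
move=> df; have /eqaddoP /littleo_est H := diff_locally df.
move=> e0; have [d d0 Hd] := H _ e0; exists d => // h /Hd /=.
by rewrite !fctE /= [h + x]addrC opprD addrA.
Qed.

Lemma diff_intro (V W : normedModType K[i]) (f : V -> W) (x : V)
    (L : {linear V -> W}) (c : K) :
  (forall h, nrm (L h) <= c * nrm h) ->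
  (forall e : K, 0 < e -> exists2 d : K, 0 < d & forall h, nrm h < d ->
    nrm (f (x + h) - f x - L h) <= e * nrm h) ->
  differentiable f x /\ forall h, 'd f x h = L h.
Proof.
move=> Lc fL.
have cL : continuous L.
  apply: bounded_linear_continuous; apply/linear_boundedP.
  exists `|c|%:C; split; first exact: ger0_real (etrans (ler0c _) (normr_ge0 _)).
  move=> M cM y; apply: (@le_trans _ _ (`|c|%:C * `|y|)); last first.
    by rewrite ler_wpM2r // ltW.
  rewrite -!nrmE -rmorphM /= lecR (le_trans (Lc y)) // ler_wpM2r ?nrm_ge0 //.
  exact: ler_norm.
have E : f \o shift x = cst (f x) + L +o_ 0 id.
  apply/eqaddoP/littleo_est => e /fL[d d0 Hd]; exists d => // h /Hd /=.
  by rewrite !fctE /= [h + x]addrC opprD addrA.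
have dL := diff_unique cL E.
split; first by apply/diff_locallyP; split; rewrite dL.
by move=> h; rewrite dL.
Qed.

Lemma nrm_diff_bound (V W : normedModType K[i]) (f : V -> W) (x : V) :
  differentiable f x ->
  exists2 c : K, 0 < c & forall h, nrm ('d f x h) <= c * nrm h.
Proof.
move=> df; have [k k0 H] := linear_lipschitz (diff_continuous df).
have kr : k = (Re k)%:C by rewrite RRe_real // gtr0_real.
exists (Re k); first by rewrite -ltcR -kr.
by move=> h; rewrite -lecR rmorphM /= -kr !nrmE.
Qed.

Lemma continuous_est (V W : normedModType K[i]) (f : V -> W) (x : V) (e : K) :
  {for x, continuous f} -> 0 < e ->
  exists2 d : K, 0 < d & forall y, nrm (y - x) < d -> nrm (f y - f x) < e.
Proof.
move=> /cvgrPdist_lt/(_ e%:C) H e0.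
have /nrm_nbhs[d d0 Hd] := H (etrans (ltcR _ _) e0).
by exists d => // y /Hd; rewrite distrC -nrmE ltcR.
Qed.

End RealNorm.

(** * Goursat's lemma by midpoint Riemann sums *)

Section RiemannSums.
Context {K : realType}.
Implicit Types (g : K[i] -> K[i]) (w d p q : K[i]).

Definition node (k N : nat) : K := (k%:R + 2^-1) / 2 ^+ N.

Lemma node_itv k N : (k < 2 ^ N)%N -> 0 <= node k N <= 1.
Proof.
move=> kN; have p0 : 0 < 2 ^+ N :> K by rewrite exprn_gt0.
apply/andP; split; first by rewrite /node divr_ge0 ?addr_ge0 ?invr_ge0 ?(ltW p0).
rewrite /node ler_pdivrMr // mul1r -natrX.
have : k%:R + 1 <= (2 ^ N)%:R :> K by rewrite natr1 ler_nat.
by apply: le_trans; rewrite lerD2l invf_le1 ?ler1n.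
Qed.

(** The midpoint rule for the integral of [g] over the segment from [w] to
    [w + d]. *)
Definition segment_sum g w d N : K[i] :=
  d / 2 ^+ N * \sum_(0 <= k < 2 ^ N) g (w + d * (node k N)%:C).

Lemma nodeS k N : node k N.+1 = 2^-1 * node k N.
Proof. by rewrite /node exprS invfM mulrCA. Qed.

Lemma node_addS k N : node (k + 2 ^ N) N.+1 = 2^-1 + 2^-1 * node k N.
Proof.
have p0 : 2 ^+ N != 0 :> K by rewrite expf_neq0 ?pnatr_eq0.
by rewrite /node exprS natrD natrX; field.
Qed.

(** With dyadically many nodes the midpoint rule is exactly additive under
    bisection, so that sums over inner edges cancel without any limit. *)
Lemma segment_sumS g w d N : segment_sum g w d N.+1 =
  segment_sum g w (d / 2) N + segment_sum g (w + d / 2) (d / 2) N.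
Proof.
have C2 : (2^-1 : K)%:C = 2^-1 by rewrite fmorphV rmorph_nat.
rewrite /segment_sum (big_cat_nat (n := 2 ^ N)) //=; last by rewrite leq_exp2l.
rewrite exprS invfM !mulrA mulrDr; congr (_ * _ + _ * _).
  by apply: eq_bigr => k _; rewrite nodeS rmorphM /= C2 mulrA.
rewrite -{1}[(2 ^ N)%N]add0n big_addn expnS mul2n -addnn addnK.
apply: eq_bigr => k _; rewrite node_addS rmorphD rmorphM /= C2.
by rewrite mulrDr mulrA addrA.
Qed.

Lemma sum_cabs_le (F : nat -> K[i]) (M : K) n :
  (forall k, (k < n)%N -> cabs (F k) <= M) ->
  cabs (\sum_(0 <= k < n) F k) <= M *+ n.
Proof.
elim: n => [|n IH] H; first by rewrite big_geq // cabs0.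
rewrite big_nat_recr //= (le_trans (cabsD _ _)) // mulrSr lerD ?H //.
by apply: IH => k kn; rewrite H // ltnW.
Qed.

Lemma segment_sum_bound g w d N (M : K) :
  (forall s : K, 0 <= s <= 1 -> cabs (g (w + d * s%:C)) <= M) ->
  cabs (segment_sum g w d N) <= cabs d * M.
Proof.
move=> gM; have p0 : 0 < 2 ^+ N :> K by rewrite exprn_gt0.
rewrite /segment_sum cabsM cabsM cabsV cabsX cabs_nat -mulrA ler_wpM2l ?cabs_ge0 //.
rewrite mulrC ler_pdivrMr // -natrX mulr_natr.
by apply: sum_cabs_le => k /node_itv /gM.
Qed.

Lemma segment_sumB f g w d N :
  segment_sum (fun z => f z - g z) w d N = segment_sum f w d N - segment_sum g w d N.
Proof. by rewrite /segment_sum sumrB mulrBr. Qed.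

Lemma segment_sum_affine (a b z : K[i]) w d N :
  segment_sum (fun t => a + b * (t - z)) w d N = d * (a + b * (w + d / 2 - z)).
Proof.
have p0 : 2 ^+ N != 0 :> K[i] by rewrite expf_neq0 ?pnatr_eq0.
have sum n : \sum_(0 <= k < n) (k%:R + 2^-1) = n%:R ^+ 2 / 2 :> K[i].
  elim: n => [|n IH]; first by rewrite big_geq // expr0n mul0r.
  by rewrite big_nat_recr //= IH -natr1; field.
rewrite /segment_sum.
have -> : \sum_(0 <= k < 2 ^ N) (a + b * (w + d * (node k N)%:C - z)) =
   (a + b * (w - z)) * 2 ^+ N + b * d / 2 ^+ N * \sum_(0 <= k < 2 ^ N) (k%:R + 2^-1).
  rewrite mulr_sumr -natrX mulr_natr -[X in _ *+ X]subn0 -sumr_const_nat -big_split /=.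
  apply: eq_bigr => k _; rewrite /node rmorphM rmorphD !fmorphV rmorphXn /=.
  by rewrite !rmorph_nat natrX; field.
by rewrite sum natrX; field.
Qed.

(** Riemann sum of [g] over the boundary of the parallelogram with corner [w]
    and sides [p], [q]. *)
Definition boundary_sum g w p q N : K[i] :=
  segment_sum g w p N + segment_sum g (w + p) q N
  - segment_sum g (w + q) p N - segment_sum g w q N.

Lemma boundary_sumS g w p q N : boundary_sum g w p q N.+1 =
  boundary_sum g w (p / 2) (q / 2) N +
  boundary_sum g (w + p / 2) (p / 2) (q / 2) N +
  boundary_sum g (w + q / 2) (p / 2) (q / 2) N +
  boundary_sum g (w + p / 2 + q / 2) (p / 2) (q / 2) N.
Proof.
rewrite /boundary_sum !segment_sumS.
have -> : w + p / 2 + p / 2 = w + p by field.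
have -> : w + q / 2 + q / 2 = w + q by field.
have -> : w + p / 2 + q / 2 + p / 2 = w + p + q / 2 by field.
have -> : w + p / 2 + q / 2 + q / 2 = w + q + p / 2 by field.
have -> : w + q / 2 + p / 2 = w + p / 2 + q / 2 by field.
ring.
Qed.

(** On a small parallelogram a differentiable function is nearly affine, and
    the midpoint rule integrates affine functions exactly. *)
Lemma boundary_sum_local g w p q N (a b z : K[i]) (e : K) :
  (forall s t : K, 0 <= s <= 1 -> 0 <= t <= 1 ->
    cabs (g (w + p * s%:C + q * t%:C) - a - b * (w + p * s%:C + q * t%:C - z)) <= e) ->
  cabs (boundary_sum g w p q N) <= 2 * (cabs p + cabs q) * e.
Proof.
move=> ge.
pose h t := g t - (a + b * (t - z)).
have E : boundary_sum g w p q N = boundary_sum h w p q N.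
  by rewrite /boundary_sum !segment_sumB !segment_sum_affine; field.
have H s t : 0 <= s <= 1 -> 0 <= t <= 1 -> cabs (h (w + p * s%:C + q * t%:C)) <= e.
  by move=> s1 t1; rewrite /h opprD addrA ge.
have i0 : 0 <= (0 : K) <= 1 by rewrite lexx ler01.
have i1 : 0 <= (1 : K) <= 1 by rewrite lexx ler01.
have B1 : cabs (segment_sum h w p N) <= cabs p * e.
  apply: segment_sum_bound => s s1; have := H s 0 s1 i0.
  by rewrite mulr0 addr0.
have B2 : cabs (segment_sum h (w + p) q N) <= cabs q * e.
  by apply: segment_sum_bound => s s1; have := H 1 s i1 s1; rewrite mulr1.
have B3 : cabs (segment_sum h (w + q) p N) <= cabs p * e.
  apply: segment_sum_bound => s s1; have := H s 1 s1 i1.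
  by rewrite mulr1 addrAC.
have B4 : cabs (segment_sum h w q N) <= cabs q * e.
  apply: segment_sum_bound => s s1; have := H 0 s i0 s1.
  by rewrite mulr0 addr0.
rewrite E /boundary_sum.
have := cabsB (segment_sum h w p N + segment_sum h (w + p) q N
  - segment_sum h (w + q) p N) (segment_sum h w q N).
have := cabsB (segment_sum h w p N + segment_sum h (w + p) q N)
  (segment_sum h (w + q) p N).
have := cabsD (segment_sum h w p N) (segment_sum h (w + p) q N).
lra.
Qed.

End RiemannSums.

Section Goursat.
Context {K : realType}.
Implicit Types (g : K[i] -> K[i]) (w d p q : K[i]).

Lemma diffC g z h : differentiable g z -> 'd g z h = 'd g z 1 * h.
Proof.
by move=> dg; rewrite -{1}[h]mulr1 -[h * 1]/(h *: (1 : K[i])) linearZ mulrC.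
Qed.

Lemma exists_pow2_gt (x : K) : exists k, x < 2 ^+ k.
Proof.
have [k xk] : exists k : nat, x < k%:R.
  exists (Num.bound `|x|); apply: le_lt_trans (ler_norm x) _; exact: archi_boundP.
exists k; apply: (lt_le_trans xk); rewrite -natrX ler_nat ltnW //.
exact: ltn_expl.
Qed.

(** A bound on the limit superior of the sums over finer and finer
    subdivisions; no limit is claimed to exist. *)
Definition goursat_bound g w p q (c : K) := forall e : K, 0 < e ->
  exists N0, forall N, (N0 <= N)%N -> cabs (boundary_sum g w p q N) <= c + e.

Lemma goursat_bound_split g w p q (c : K) :
  goursat_bound g w (p / 2) (q / 2) (c / 4) ->
  goursat_bound g (w + p / 2) (p / 2) (q / 2) (c / 4) ->
  goursat_bound g (w + q / 2) (p / 2) (q / 2) (c / 4) ->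
  goursat_bound g (w + p / 2 + q / 2) (p / 2) (q / 2) (c / 4) ->
  goursat_bound g w p q c.
Proof.
move=> H1 H2 H3 H4 e e0; have e4 : 0 < e / 4 by rewrite divr_gt0.
have [N1 B1] := H1 _ e4; have [N2 B2] := H2 _ e4.
have [N3 B3] := H3 _ e4; have [N4 B4] := H4 _ e4.
exists (maxn (maxn N1 N2) (maxn N3 N4)).+1 => -[//|N].
rewrite ltnS !geq_max => /andP[/andP[n1 n2] /andP[n3 n4]].
rewrite boundary_sumS.
have b1 := B1 _ n1; have b2 := B2 _ n2; have b3 := B3 _ n3; have b4 := B4 _ n4.
set x1 := boundary_sum _ _ _ _ _ in b1 *; set x2 := boundary_sum _ _ _ _ _ in b2 *.
set x3 := boundary_sum _ _ _ _ _ in b3 *; set x4 := boundary_sum _ _ _ _ _ in b4 *.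
have := cabsD (x1 + x2 + x3) x4; have := cabsD (x1 + x2) x3; have := cabsD x1 x2.
lra.
Qed.

(** Nested intervals: [b k] selects the right or the left half at step [k]. *)
Lemma dyadic_limit (b : nat -> bool) (s : nat -> K) :
  s 0 = 0 -> (forall k, s k.+1 = s k + (b k)%:R / 2 ^+ k.+1) ->
  exists2 l, 0 <= l <= 1 & forall k, s k <= l <= s k + (2 ^+ k)^-1.
Proof.
move=> s0 sS.
have p0 := @exp2V_gt0 K.
have half := @exp2VS K.
have st k : s k <= s k.+1 /\ s k.+1 + (2 ^+ k.+1)^-1 <= s k + (2 ^+ k)^-1.
  rewrite sS half; have := p0 k; case: (b k) => /=; lra.
have up k m : s k <= s (k + m)%N.
  elim: m => [|m IH]; first by rewrite addn0.
  by rewrite addnS (le_trans IH) // (st _).1.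
have dn k m : s (k + m)%N + (2 ^+ (k + m))^-1 <= s k + (2 ^+ k)^-1.
  elim: m => [|m IH]; first by rewrite addn0.
  by rewrite addnS (le_trans (st _).2).
have ub k m : s m <= s k + (2 ^+ k)^-1.
  have [km|mk] := leqP k m.
    have := dn k (m - k)%N; rewrite subnKC // => /(le_trans _); apply.
    by rewrite lerDl ltW.
  have := up m (k - m)%N; rewrite subnKC ?(ltnW mk) // => /le_trans; apply.
  by rewrite lerDl ltW.
have hs : has_sup (range s).
  split; first by exists (s 0); exists 0.
  by exists (s 0 + (2 ^+ 0)^-1) => _ [m _ <-].
have B k : s k <= sup (range s) <= s k + (2 ^+ k)^-1.
  apply/andP; split; first by apply: ub_le_sup; [case: hs | exists k].
  by apply: ge_sup => [|_ [m _ <-]]; first by case: hs.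
exists (sup (range s)) => //.
by have := B 0; rewrite s0 expr0 invr1 add0r.
Qed.

(** A limit superior above [e] on a parallelogram leaves one above [e / 4 ^ k] on
    one of its parts of generation [k]. At the common point of a nested sequence
    of such parts this contradicts [boundary_sum_local], whose bound is there
    negligible with respect to the area. *)
Lemma goursat g w p q :
  (forall s t : K, 0 <= s <= 1 -> 0 <= t <= 1 ->
    differentiable g (w + p * s%:C + q * t%:C)) ->
  forall e : K, 0 < e -> exists N0, forall N, (N0 <= N)%N ->
    cabs (boundary_sum g w p q N) <= e.
Proof.
move=> dg.
have C2 : (2^-1 : K)%:C = 2^-1 by rewrite fmorphV rmorph_nat.
suff H e : 0 < e -> goursat_bound g w p q e.
  move=> e e0; have e2 : 0 < e / 2 by rewrite divr_gt0.
  have [N0 HN] := H _ e2 _ e2; exists N0 => N /HN; lra.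
move=> e0; apply: contrapT => bad0.
pose good k (s t : K) := goursat_bound g (w + p * s%:C + q * t%:C)
  (p / 2 ^+ k) (q / 2 ^+ k) (e / 4 ^+ k).
have step (x : nat * K * K) : exists ij : bool * bool,
    ~ good x.1.1 x.1.2 x.2 -> ~ good x.1.1.+1 (x.1.2 + ij.1%:R / 2 ^+ x.1.1.+1)
                                   (x.2 + ij.2%:R / 2 ^+ x.1.1.+1).
  case: x => [[k s] t] /=; apply: contrapT => H.
  have G (i j : bool) : good k.+1 (s + i%:R / 2 ^+ k.+1) (t + j%:R / 2 ^+ k.+1).
    by apply: contrapT => nG; apply: H; exists (i, j).
  apply: H; exists (true, true) => nG; case: nG.
  have h4 : e / 4 ^+ k.+1 = e / 4 ^+ k / 4 by rewrite exprSr invfM mulrA.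
  have h2 (x : K[i]) : x / 2 ^+ k.+1 = x / 2 ^+ k / 2.
    by rewrite exprSr invfM mulrA.
  have hC (i : bool) : (i%:R / 2 ^+ k.+1 : K)%:C = i%:R / 2 ^+ k / 2.
    by rewrite rmorphM fmorphV rmorphXn /= !rmorph_nat h2.
  have p0 : 2 ^+ k != 0 :> K[i] by rewrite expf_neq0 ?pnatr_eq0.
  have G' (i j : bool) : goursat_bound g
      (w + p * (s%:C + i%:R / 2 ^+ k / 2) + q * (t%:C + j%:R / 2 ^+ k / 2))
      (p / 2 ^+ k / 2) (q / 2 ^+ k / 2) (e / 4 ^+ k / 4).
    by have := G i j; rewrite /good !rmorphD /= !hC h4 !h2.
  have mulh (x y : K[i]) : x * (y + true%:R / 2 ^+ k / 2) = x * y + x / 2 ^+ k / 2.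
    by rewrite mulrDr mul1r !mulrA.
  have mul0 (y : K[i]) : y + false%:R / 2 ^+ k / 2 = y by rewrite !mul0r addr0.
  apply: goursat_bound_split.
  - by have := G' false false; rewrite !mul0.
  - by have := G' true false; rewrite mulh mul0 addrA [_ + q * _]addrAC.
  - by have := G' false true; rewrite mulh mul0 addrA.
  - by have := G' true true; rewrite !mulh !addrA [_ + q * _]addrAC.
have [F HF] := choice step.
pose fix u k : K * K := if k is j.+1 then
  let v := u j in (v.1 + (F (j, v.1, v.2)).1%:R / 2 ^+ j.+1,
                   v.2 + (F (j, v.1, v.2)).2%:R / 2 ^+ j.+1) else (0, 0).
have bad k : ~ good k (u k).1 (u k).2.
  elim: k => [|k IH]; last exact: (HF (k, (u k).1, (u k).2)).
  by rewrite /good /= !mulr0 !addr0 !expr0 !divr1.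
have [s s01 sk] := @dyadic_limit (fun k => (F (k, (u k).1, (u k).2)).1)
  (fun k => (u k).1) erefl (fun k => erefl).
have [t t01 tk] := @dyadic_limit (fun k => (F (k, (u k).1, (u k).2)).2)
  (fun k => (u k).2) erefl (fun k => erefl).
have dz := dg _ _ s01 t01; set z := w + _ + _ in dz.
pose L := cabs p + cabs q; have L0 : 0 <= L by rewrite addr_ge0 ?cabs_ge0.
pose e' := e / (2 * L ^+ 2 + 1).
have den0 : 0 < 2 * L ^+ 2 + 1 by rewrite ltr_wpDl // mulr_ge0 // sqr_ge0.
have e'0 : 0 < e' by rewrite divr_gt0.
have [d d0 Hd] := diff_est dz e'0.
have [k Lk] := exists_pow2_gt (L / d).
have k0 : 0 < 2 ^+ k :> K by rewrite exprn_gt0.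
apply: (bad k) => c c0; exists 0 => N _.
apply: (@le_trans _ _ (e / 4 ^+ k)); last by rewrite lerDl ltW.
have small (x : K[i]) : cabs (x / 2 ^+ k) = cabs x / 2 ^+ k.
  by rewrite cabsM cabsV cabsX cabs_nat.
have Lkd : L / 2 ^+ k < d.
  by rewrite ltr_pdivrMr // mulrC -ltr_pdivrMr.
apply: (@le_trans _ _ (2 * (L / 2 ^+ k) * (e' * (L / 2 ^+ k)))); last first.
  have -> : (4 : K) ^+ k = 2 ^+ k * 2 ^+ k by rewrite -exprMn -natrM.
  have -> : 2 * (L / 2 ^+ k) * (e' * (L / 2 ^+ k)) =
    (2 * L ^+ 2) / (2 * L ^+ 2 + 1) * (e / (2 ^+ k * 2 ^+ k)).
    rewrite /e'; field; rewrite gt_eqF //= gt_eqF //.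
  rewrite ler_piMl ?divr_ge0 ?mulr_ge0 ?(ltW k0) ?(ltW e0) //.
  by rewrite ler_pdivrMr // mul1r lerDl.
have -> : L / 2 ^+ k = cabs (p / 2 ^+ k) + cabs (q / 2 ^+ k) by rewrite !small -mulrDl.
apply: (@boundary_sum_local _ _ _ _ _ _ (g z) ('d g z 1) z) => a b a01 b01.
set x := (X in g X - _ - _).
have C2k : (2 ^+ k : K[i]) = (2 ^+ k : K)%:C by rewrite rmorphXn /= rmorph_nat.
have Ex : x - z = p * ((u k).1 + a / 2 ^+ k - s)%:C + q * ((u k).2 + b / 2 ^+ k - t)%:C.
  rewrite /x /z !rmorphB !rmorphD !rmorphM !fmorphV /= -C2k; ring.
have xz : cabs (x - z) <= L / 2 ^+ k.
  have bnd (v a' l : K) : v <= l <= v + (2 ^+ k)^-1 -> 0 <= a' <= 1 ->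
      `|v + a' / 2 ^+ k - l| <= (2 ^+ k)^-1.
    move=> /andP[l1 l2] /andP[a0 a1]; rewrite ler_norml.
    have : 0 <= a' / 2 ^+ k by rewrite divr_ge0 // ltW.
    have : a' / 2 ^+ k <= (2 ^+ k)^-1 by rewrite ler_piMl // invr_ge0 ltW.
    move: (2 ^+ k)^-1 l1 l2 => y; move: (a' * _) => y'; lra.
  rewrite Ex (le_trans (cabsD _ _)) // !cabsM !cabs_real mulrDl.
  by rewrite lerD // ler_wpM2l ?cabs_ge0 // bnd.
have := Hd (x - z) (le_lt_trans xz Lkd); rewrite subrKC diffC // !nrm_cabs.
by move=> /le_trans; apply; rewrite !small -mulrDl ler_wpM2l // ltW.
Qed.

End Goursat.

(** * Maximum principle *)

Section ComplexExponential.
Context {K : realType}.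

Lemma derive_est (f : K -> K) (x df e : K) : is_derive x 1 f df -> 0 < e ->
  exists2 d : K, 0 < d & forall h, `|h| < d ->
    `|f (x + h) - f x - df * h| <= e * `|h|.
Proof.
move=> [dfx fE] e0; move: (dfx); rewrite /derivable => /cvgrPdist_le/(_ _ e0).
rewrite -/(derive _ _ _) fE near_withinE => /nbhs_normP[d /= d0 H].
exists d => // h hd; have [->|h0] := eqVneq h 0.
  by rewrite addr0 subrr mulr0 subr0 normr0 mulr0.
have := H h; rewrite /= sub0r normrN => /(_ hd h0).
rewrite -[h *: 1]/(h * 1) mulr1 => Hh.
rewrite [x + h]addrC.
have -> : f (h + x) - f x - df * h = - h * (df - h^-1 *: (f (h + x) - f x)).
  by rewrite /GRing.scale /=; field.
by rewrite normrM normrN mulrC ler_wpM2r.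
Qed.

Definition cexp (w : K[i]) : K[i] :=
  (expR (Re w))%:C * (cos (Im w) +i* sin (Im w)).

Lemma cexpD w z : cexp (w + z) = cexp w * cexp z.
Proof.
case: w => a b; case: z => c d; rewrite /cexp /= expRD cosD sinD rmorphM.
set u := (_ +i* _); have -> : u = (cos b +i* sin b) * (cos d +i* sin d).
  by apply/eqP; rewrite eq_complex /= eqxx /= addrC [cos b * _]mulrC mulrC.
by rewrite mulrACA.
Qed.

Lemma cabs_cexp w : cabs (cexp w) = expR (Re w).
Proof.
rewrite /cexp cabsM cabs_real gtr0_norm ?expR_gt0 //.
by rewrite [X in _ * X]/cabs normc_def /= cos2Dsin2 sqrtr1 mulr1.
Qed.

Lemma cexp_2pi w : cexp (w + (0 +i* (2 * pi))) = cexp w.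
Proof.
rewrite cexpD [X in _ * X]/cexp /= expR0 mulr_natl cos2pi sin2pi.
by rewrite -/(real_complex _ 1) !mulr1.
Qed.

(** By the functional equation it suffices to treat the origin, where the
    difference quotients of [expR], [cos] and [sin] are controlled separately. *)
Lemma differentiable_cexp w : differentiable cexp w.
Proof.
have c0 : cexp 0 = 1 by rewrite /cexp /= expR0 cos0 sin0 mul1r.
have d0 : differentiable cexp 0.
  have [||//] := @diff_intro K _ _ cexp 0 idfun 1.
    by move=> h; rewrite mul1r.
  move=> e e0.
  (* the error terms below add up to at most [9 * e1 * cabs (x +i* y)] *)
  have [e1 [e10 e19 e11]] : exists e1 : K, [/\ 0 < e1, 9 * e1 <= e & e1 <= 1].
    exists (Num.min (e / 9) 1); split; first by rewrite lt_min ltr01 divr_gt0.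
      by rewrite mulrC -ler_pdivlMr // ge_min lexx.
    by rewrite ge_min lexx orbT.
  have [da da0 Ha] := derive_est (is_derive_expR (0 : K)) e10.
  have [db db0 Hb] := derive_est (is_derive_cos (0 : K)) e10.
  have [dc dc0 Hc] := derive_est (is_derive_sin (0 : K)) e10.
  exists (Num.min e1 (Num.min da (Num.min db dc))); first by rewrite !lt_min e10 da0 db0.
  case=> x y; rewrite !lt_min !nrm_cabs => /and4P[h1 ha hb hc].
  have xh := cabs_Re (x +i* y); have yh := cabs_Im (x +i* y); rewrite /= in xh yh.
  rewrite add0r c0 /idfun.
  have Ea := Ha x (le_lt_trans xh ha); have Eb := Hb y (le_lt_trans yh hb).
  have Ec := Hc y (le_lt_trans yh hc).
  rewrite !add0r expR0 mul1r in Ea.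
  rewrite !add0r cos0 sin0 oppr0 mul0r subr0 in Eb.
  rewrite !add0r cos0 sin0 mul1r subr0 in Ec.
  rewrite (le_trans (cabs_le _)) //.
  have -> : Re (cexp (x +i* y) - 1 - (x +i* y)) =
    expR x * (cos y - 1) + (expR x - 1 - x) by rewrite /cexp /=; ring.
  have -> : Im (cexp (x +i* y) - 1 - (x +i* y)) =
    expR x * (sin y - y) + (expR x - 1) * y by rewrite /cexp /=; ring.
  have x1 : `|expR x - 1| <= 2 * `|x|.
    have := ler_normD (expR x - 1 - x) x; rewrite subrK => /le_trans; apply.
    by rewrite [2 * _]mulrDl mul1r lerD2r (le_trans Ea) // ler_piMl.
  have xe : `|x| <= e1 by rewrite ltW // (le_lt_trans xh).
  have x3 : `|expR x| <= 3.
    by have := ler_normD (expR x - 1) 1; rewrite subrK normr1; lra.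
  have A1 : `|expR x * (cos y - 1)| <= 3 * (e1 * `|y|) by rewrite normrM ler_pM.
  have A2 : `|expR x * (sin y - y)| <= 3 * (e1 * `|y|) by rewrite normrM ler_pM.
  have A3 : `|(expR x - 1) * y| <= 2 * (e1 * `|y|).
    by rewrite normrM mulrA ler_wpM2r // (le_trans x1) // ler_wpM2l.
  have := ler_normD (expR x * (cos y - 1)) (expR x - 1 - x).
  have := ler_normD (expR x * (sin y - y)) ((expR x - 1) * y).
  have : e1 * `|y| <= e1 * cabs (x +i* y) by rewrite ler_wpM2l // ltW.
  have : e1 * `|x| <= e1 * cabs (x +i* y) by rewrite ler_wpM2l // ltW.
  have : 9 * e1 * cabs (x +i* y) <= e * cabs (x +i* y).
    by rewrite ler_wpM2r ?cabs_ge0.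
  rewrite -mulrA; lra.
have -> : cexp = cexp w \*: (cexp \o (fun z => z - w)).
  apply/funext => z /=; rewrite -[_ *: _]/(_ * _) -cexpD addrC subrK //.
apply: differentiableZ; apply: differentiable_comp.
  by apply: differentiableB; [exact: ex_diff | exact: differentiable_cst].
by rewrite subrr.
Qed.

End ComplexExponential.

Section MaximumPrinciple.
Context {K : realType}.
Implicit Types (f : K[i] -> K[i]).

(** In the logarithmic coordinate [t = cexp w] a circle becomes a vertical
    segment, and by Goursat and periodicity the Riemann sums over two such
    segments have the same limit; the sums over small circles approach
    [2 * pi * f 0]. *)
Lemma cabs_center_le f (r M : K) : 0 < r ->
  (forall t, cabs t <= r -> differentiable f t) ->
  (forall t, cabs t = r -> cabs (f t) <= M) -> cabs (f 0) <= M.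
Proof.
move=> r0 df fM; apply/ler_addgt0Pr => e' e'0.
pose e := e' / 2; have e0 : 0 < e by rewrite divr_gt0.
have c0 : {for 0, continuous f} by apply: differentiable_continuous; apply: df; rewrite cabs0 ltW.
have [d d0 Hd] := continuous_est c0 e0.
pose s := Num.min (d / 2) r.
have s0 : 0 < s by rewrite lt_min divr_gt0.
have sd : s < d by rewrite gt_min half_lt.
have sr : s <= r by rewrite ge_min lexx orbT.
pose g := f \o cexp; pose w := (ln s)%:C; pose p := (ln r - ln s)%:C.
pose q := 0 +i* (2 * pi) : K[i].
have lsr : ln s <= ln r by rewrite ler_ln ?posrE.
have pi0 : 0 < 2 * pi :> K by rewrite mulr_gt0 ?pi_gt0.
have cq : cabs q = 2 * pi.
  by rewrite /cabs normc_def /= expr0n add0r sqrtr_sqr gtr0_norm.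
have Rw (a b : K) : Re (w + p * a%:C + q * b%:C) = ln s + (ln r - ln s) * a.
  by rewrite /w /p /q /=; ring.
have dg (a b : K) : 0 <= a <= 1 -> 0 <= b <= 1 ->
    differentiable g (w + p * a%:C + q * b%:C).
  move=> /andP[a0 a1] _; apply: differentiable_comp; first exact: differentiable_cexp.
  apply: df; rewrite cabs_cexp Rw -[leRHS]lnK ?posrE // ler_expR -lerBrDl.
  by rewrite ler_piMr // subr_ge0.
have [N HN] := goursat dg (mulr_gt0 pi0 e0).
have {HN} := HN N (leqnn _); rewrite /boundary_sum.
have -> : segment_sum g (w + q) p N = segment_sum g w p N.
  congr (_ * _); apply: eq_bigr => k _.
  by rewrite /g /= addrAC cexp_2pi.
rewrite [X in cabs (X - _)]addrKC => B0.
have B1 : cabs (segment_sum g (w + p) q N) <= 2 * pi * M.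
  rewrite -cq; apply: segment_sum_bound => b _; apply: fM.
  have E := Rw 1 b; rewrite rmorph1 !mulr1 subrKC in E.
  by rewrite cabs_cexp E lnK ?posrE.
have B2 : cabs (segment_sum g w q N - q * f 0) <= 2 * pi * e.
  have := segment_sum_affine (f 0) 0 0 w q N; rewrite mul0r addr0 => <-.
  rewrite -segment_sumB -cq; apply: segment_sum_bound => b _.
  rewrite mul0r addr0 ltW //; apply: Hd; rewrite subr0 nrm_cabs cabs_cexp.
  have E := Rw 0 b; rewrite rmorph0 !mulr0 !addr0 in E.
  by rewrite E lnK ?posrE.
set X := segment_sum _ _ _ _ in B0 B1; set Y := segment_sum _ _ _ _ in B0 B2.
have := cabsM q (f 0); rewrite cq => E.
have h1 := cabs_dist (q * f 0) Y; rewrite cabs_distC in h1.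
have h2 := cabs_dist Y X; rewrite cabs_distC in h2.
have : 2 * pi * cabs (f 0) <= 2 * pi * (M + e') by rewrite /e in B0 B2; lra.
by rewrite ler_pM2l.
Qed.

Lemma cabsD_sqr (x y : K[i]) :
  cabs (x + y) ^+ 2 = cabs x ^+ 2 + cabs y ^+ 2 + 2 * Re (x * y^*).
Proof. by case: x => a b; case: y => c d; rewrite !cabs_sqr /=; ring. Qed.

(** The automorphisms of the disk of radius [r] move the centre to any other
    point and preserve the boundary circle. *)
Lemma max_principle f (r M : K) : 0 < r ->
  (forall t, cabs t <= r -> differentiable f t) ->
  (forall t, cabs t = r -> cabs (f t) <= M) ->
  forall a, cabs a <= r -> cabs (f a) <= M.
Proof.
move=> r0 df fM a; rewrite le_eqVlt => /orP[/eqP/fM//|ar].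
pose rc : K[i] := (r ^+ 2)%:C.
have rc0 : rc != 0 by rewrite -cabs_eq0 cabs_real normr_eq0 expf_neq0 // gt_eqF.
have den t : cabs t <= r -> rc + a^* * t != 0.
  move=> tr; rewrite -cabs_gt0; have := cabs_dist rc (- (a^* * t)).
  rewrite opprK cabsN cabs_real cabsM cabs_conj ger0_norm ?sqr_ge0 //.
  apply: lt_le_trans; rewrite subr_gt0 expr2.
  by rewrite (le_lt_trans (ler_wpM2l (cabs_ge0 _) tr)) // ltr_pM2r.
pose phi t := rc * (t + a) * (rc + a^* * t)^-1.
have key t : cabs (rc + a^* * t) ^+ 2 - r ^+ 2 * cabs (t + a) ^+ 2 =
    (r ^+ 2 - cabs t ^+ 2) * (r ^+ 2 - cabs a ^+ 2).
  rewrite !cabsD_sqr cabsM cabs_conj cabs_real ger0_norm ?sqr_ge0 //.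
  have -> : Re (rc * (a^* * t)^*) = r ^+ 2 * Re (t * a^*).
    by rewrite /rc; case: (a) => x y; case: (t) => x' y' /=; ring.
  ring.
have absphi t : cabs t <= r -> cabs (phi t) =
    r * (r * cabs (t + a) / cabs (rc + a^* * t)).
  move=> tr; rewrite /phi !cabsM cabsV cabs_real ger0_norm ?sqr_ge0 //.
  by rewrite expr2 !mulrA.
have phir t : cabs t <= r -> cabs (phi t) <= r.
  move=> tr; rewrite absphi // ger_pMr // ler_pdivrMr ?cabs_gt0 ?den // mul1r.
  rewrite -(ler_pXn2r (n := 2)) ?nnegrE ?mulr_ge0 ?cabs_ge0 ?(ltW r0) //.
  rewrite exprMn -subr_ge0 key mulr_ge0 ?subr_ge0 // ler_pXn2r ?nnegrE ?cabs_ge0 ?(ltW r0) //.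
  exact: ltW.
have phie t : cabs t = r -> cabs (phi t) = r.
  move=> tr; have tr' : cabs t <= r by rewrite tr.
  rewrite absphi // -[RHS]mulr1; congr (_ * _).
  have -> : r * cabs (t + a) = cabs (rc + a^* * t).
    apply/eqP; rewrite -(eqrXn2 (n := 2)) ?mulr_ge0 ?cabs_ge0 ?(ltW r0) //.
    by rewrite exprMn eq_sym -subr_eq0 key tr subrr mul0r.
  by rewrite divff // cabs_eq0 den.
have dphi t : cabs t <= r -> differentiable phi t.
  move=> tr; apply: differentiableM.
    apply: differentiableM; first exact: differentiable_cst.
    by apply: differentiableD; [exact: ex_diff | exact: differentiable_cst].
  apply: differentiableV; last exact: den.
  apply: differentiableD; first exact: differentiable_cst.
  by apply: differentiableM; [exact: differentiable_cst | exact: ex_diff].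
have phi0 : phi 0 = a by rewrite /phi add0r mulr0 addr0 mulrAC mulfV ?mul1r.
rewrite -phi0; apply: (cabs_center_le (f := f \o phi) r0).
  move=> t tr; apply: differentiable_comp; first exact: dphi.
  exact/df/phir.
by move=> t tr; apply/fM/phie.
Qed.

End MaximumPrinciple.

(** * Cauchy estimates *)

Section Estimates1.
Context {K : realType}.
Implicit Types (f : K[i] -> K[i]) (S : seq K[i]).

Lemma differentiable_subC (c t : K[i]) : differentiable (fun z : K[i] => z - c) t.
Proof. by apply: differentiableB; [exact: ex_diff | exact: differentiable_cst]. Qed.

Lemma differentiable_pow (V : normedModType K[i]) (f : V -> K[i]) n t :
  differentiable f t -> differentiable (fun z => f z ^+ n) t.
Proof.
move=> df; elim: n => [|n IH]; first exact: differentiable_cst.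
by under eq_fun do rewrite exprS; apply: differentiableM.
Qed.

Lemma diff_intro1 f t d :
  (forall e : K, 0 < e -> exists2 r : K, 0 < r & forall h, cabs h < r ->
    cabs (f (t + h) - f t - d * h) <= e * cabs h) ->
  differentiable f t /\ 'd f t 1 = d.
Proof.
move=> H; have sM (h : K[i]) : 'd (GRing.scale d) (0 : K[i]) h = d * h.
  by have -> : 'd (GRing.scale d) (0 : K[i]) = GRing.scale d :> (K[i] -> K[i])
    by exact: diff_val.
have [|e e0|df E] := @diff_intro K _ _ f t ('d (GRing.scale d) (0 : K[i])) (cabs d).
- by move=> h; rewrite sM nrm_cabs cabsM.
- by have [r r0 Hr] := H _ e0; exists r => // h; rewrite sM => /Hr.
- by split; [exact: df | apply: etrans (E 1) _; rewrite sM mulr1].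
Qed.

(** Taking roots of growing order removes the constants [c] and [C]. *)
Lemma le_of_power_le (x y c C : K) : 0 <= y -> 0 < c ->
  (forall N, x ^+ N * c <= y ^+ N * C) -> x <= y.
Proof.
move=> y0 c0 H; rewrite leNgt; apply/negP => yx.
have C0 : 0 < C by have := H 0; rewrite !expr0 !mul1r; exact: lt_le_trans.
move: y0; rewrite le_eqVlt => /predU1P[y0|y0].
  have := H 1; rewrite -y0 !expr1 mul0r leNgt => /negP[].
  by rewrite mulr_gt0 // y0.
pose u := x / y - 1; have u0 : 0 < u by rewrite subr_gt0 ltr_pdivlMr // mul1r.
have bern N : 1 + N%:R * u <= (x / y) ^+ N.
  have xy : x / y = 1 + u by rewrite subrKC.
  elim: N => [|N IH]; first by rewrite expr0 mul0r addr0.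
  rewrite exprS {1}xy -natr1; apply: (le_trans _ (ler_wpM2l _ IH)).
    have : 0 <= N%:R * u * u by rewrite !mulr_ge0 // ltW.
    lra.
  lra.
have [N] : exists N : nat, C / c / u < N%:R.
  exists (Num.bound (C / c / u)); apply: archi_boundP.
  by rewrite !divr_ge0 // ltW.
rewrite ltr_pdivrMr // => HN.
have := H N; rewrite -ler_pdivlMr // -mulrA -ler_pdivrMl ?exprn_gt0 // mulrC.
rewrite -expr_div_n => /(le_trans (bern N)); lra.
Qed.

(** Powers of [f] beat the factor [\prod_(s <- S) (t - s) ^+ 2], which removes
    the singularities at the points of [S]. *)
Lemma max_principle_except f S (r M B : K) : 0 < r ->
  (forall s, s \in S -> cabs s < r) ->
  (forall t, cabs t <= r -> t \notin S -> differentiable f t) ->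
  (forall t, cabs t <= r -> t \notin S -> cabs (f t) <= B) ->
  (forall t, cabs t = r -> cabs (f t) <= M) ->
  forall a, cabs a <= r -> a \notin S -> cabs (f a) <= M.
Proof.
move=> r0 Sr df fB fM a ar aS.
have r0' : 0 <= r := ltW r0.
pose P t : K[i] := \prod_(s <- S) (t - s).
have dP t : differentiable P t.
  rewrite /P; elim: (S) => [|s S' IH].
    by under eq_fun do rewrite big_nil; exact: differentiable_cst.
  under eq_fun do rewrite big_cons; apply: differentiableM; last exact: IH.
  exact: differentiable_subC.
have Pfac (S' : seq K[i]) t : cabs t <= r -> {in S', forall s, cabs s < r} ->
    cabs (\prod_(s <- S') (t - s)) <= (2 * r) ^+ size S'.
  move=> tr; elim: S' => [|s' S' IH] H; first by rewrite big_nil cabs1.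
  rewrite big_cons cabsM exprS ler_pM ?cabs_ge0 //.
    rewrite (le_trans (cabsB _ _)) // mulr2n mulrDl mul1r lerD // ltW // H //.
    by rewrite mem_head.
  by apply: IH => z zS; rewrite H // inE zS orbT.
have Pa : 0 < cabs (P a).
  rewrite cabs_gt0 /P prodf_seq_neq0; apply/allP => s sS /=.
  by rewrite subr_eq0; apply: contraNneq aS => ->.
have M0 : 0 <= M.
  by apply: le_trans (cabs_ge0 (f r%:C)) _; rewrite fM // cabs_real ger0_norm.
have B0 : 0 <= B := le_trans (cabs_ge0 _) (fB a ar aS).
pose C := (2 * r) ^+ size S.
have C0 : 0 <= C by rewrite exprn_ge0 // mulr_ge0.
apply: (@le_of_power_le _ _ (cabs (P a) ^+ 2) (C ^+ 2)); rewrite ?exprn_gt0 // => N.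
rewrite -!cabsX -cabsM.
pose h t := f t ^+ N * P t ^+ 2.
have dh t : cabs t <= r -> differentiable h t.
  move=> tr; have [tS|tS] := boolP (t \in S); last first.
    by apply: differentiableM; apply: differentiable_pow => //; exact: df.
  have Pt : P t = 0.
    by apply/eqP; rewrite /P prodf_seq_eq0; apply/hasP; exists t => //=; rewrite subrr eqxx.
  have trr := Sr _ tS.
  pose C' := (2 * r) ^+ (size S).-1.
  have C'0 : 0 <= C' by rewrite exprn_ge0 // mulr_ge0.
  have [|//] := @diff_intro1 h t 0.
  move=> e e0; pose c := B ^+ N * C' ^+ 2.
  have c0 : 0 <= c := mulr_ge0 (exprn_ge0 _ B0) (exprn_ge0 _ C'0).
  have c1 : 0 < c + 1 by rewrite ltr_wpDl.
  exists (Num.min (r - cabs t) (e / (c + 1))).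
    by rewrite lt_min subr_gt0 trr divr_gt0.
  move=> k; rewrite lt_min => /andP[k1 k2].
  have tk : cabs (t + k) <= r by rewrite (le_trans (cabsD _ _)) // -lerBrDl ltW.
  rewrite {2}/h Pt expr0n mulr0 subr0 mul0r subr0 /h.
  have Pk : cabs (P (t + k)) <= cabs k * C'.
    rewrite /P (perm_big _ (perm_to_rem tS)) big_cons cabsM addrKC.
    rewrite ler_wpM2l ?cabs_ge0 // /C' -(size_rem tS) Pfac // => s /mem_rem; exact: Sr.
  have [tkS|tkS] := boolP (t + k \in S).
    have -> : P (t + k) = 0.
      by apply/eqP; rewrite /P prodf_seq_eq0; apply/hasP; exists (t + k) => //=; rewrite subrr eqxx.
    by rewrite expr0n mulr0 cabs0 mulr_ge0 ?cabs_ge0 // ltW.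
  rewrite cabsM !cabsX.
  apply: (@le_trans _ _ (B ^+ N * (cabs k * C') ^+ 2)).
    by rewrite ler_pM ?exprn_ge0 ?cabs_ge0 // lerXn2r ?nnegrE ?cabs_ge0 ?mulr_ge0 ?fB ?cabs_ge0.
  have -> : B ^+ N * (cabs k * C') ^+ 2 = c * cabs k * cabs k by rewrite /c; ring.
  rewrite ler_wpM2r ?cabs_ge0 //.
  apply: (@le_trans _ _ ((c + 1) * cabs k)).
    by rewrite ler_wpM2r ?cabs_ge0 // lerDl.
  by rewrite mulrC -ler_pdivlMr // ltW.
apply: (max_principle r0 dh) => // t tr.
rewrite cabsM !cabsX ler_pM ?exprn_ge0 ?cabs_ge0 // lerXn2r ?nnegrE ?cabs_ge0 ?fM //.
by rewrite Pfac // tr.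
Qed.

(** Near [b] differentiability bounds the slope, elsewhere its denominator does.
    This is the a priori bound that
    [max_principle_except] asks for. *)
Lemma slope_bounded f S (r M : K) b :
  (forall t, cabs t <= r -> t \notin S -> cabs (f t) <= M) ->
  cabs b <= r -> b \notin S -> differentiable f b ->
  exists B, forall t, cabs t <= r -> t \notin b :: S ->
    cabs ((f t - f b) / (t - b)) <= B.
Proof.
move=> fM br bS db; have [d d0 Hd] := diff_est db (ltr01 : 0 < 1 :> K).
exists (cabs ('d f b 1) + 1 + 2 * M / d) => t tr.
have M0 : 0 <= M := le_trans (cabs_ge0 _) (fM b br bS).
rewrite inE negb_or => /andP[tb tS].
have tb0 : 0 < cabs (t - b) by rewrite cabs_gt0 subr_eq0.
rewrite cabsM cabsV ler_pdivrMr //.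
have [lt|ge] := ltP (cabs (t - b)) d.
  have := Hd _ lt; rewrite subrKC diffC // mul1r !nrm_cabs => H.
  have := cabs_dist (f t - f b) ('d f b 1 * (t - b)); rewrite cabsM => H2.
  have : 0 <= 2 * M / d * cabs (t - b) by rewrite !mulr_ge0 ?invr_ge0 ?cabs_ge0 ?(ltW d0).
  lra.
apply: (@le_trans _ _ (2 * M / d * cabs (t - b))).
  rewrite mulrAC ler_pdivlMr //; apply: (@le_trans _ _ (2 * M * d)).
    rewrite ler_wpM2r ?(ltW d0) // mulr2n mulrDl mul1r (le_trans (cabsB _ _)) //.
    by rewrite lerD // fM.
  by rewrite ler_wpM2l // mulr_ge0.
by rewrite ler_wpM2r ?cabs_ge0 // lerDr addr_ge0 ?cabs_ge0.
Qed.

Lemma differentiable_slope f b t : t != b -> differentiable f t ->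
  differentiable (fun t => (f t - f b) / (t - b)) t.
Proof.
move=> tb dt; apply: differentiableM.
  by apply: differentiableB; [exact: dt | exact: differentiable_cst].
apply: differentiableV; last by rewrite subr_eq0.
exact: differentiable_subC.
Qed.

(** The slope at [b] has at most removable singularities, at [b] and on [S]; on
    the circle of radius [r] its denominator is at least [r / 2], and the maximum
    principle carries that bound inside. *)
Lemma lipschitz_est f S (r M : K) : 0 < r ->
  (forall s, s \in S -> cabs s < r) ->
  (forall t, cabs t <= r -> t \notin S -> differentiable f t) ->
  (forall t, cabs t <= r -> t \notin S -> cabs (f t) <= M) ->
  forall a b, cabs a <= r / 2 -> cabs b <= r / 2 -> a \notin S -> b \notin S ->
  cabs (f a - f b) <= 4 * M / r * cabs (a - b).
Proof.
move=> r0 Sr df fM a b ar br aS bS.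
have r2 : r / 2 < r by rewrite half_lt.
have ar' := le_trans ar (ltW r2); have br' := le_trans br (ltW r2).
have [->|ab] := eqVneq a b; first by rewrite !subrr cabs0 mulr0.
have [B HB] := slope_bounded fM br' bS (df _ br' bS).
have ab0 : 0 < cabs (a - b) by rewrite cabs_gt0 subr_eq0.
rewrite -ler_pdivrMr // -cabsV -cabsM.
apply: (@max_principle_except (fun t => (f t - f b) / (t - b)) (b :: S) r _ B r0 _ _ HB _ a ar').
- move=> s; rewrite inE => /predU1P[->|/Sr//]; exact: le_lt_trans br r2.
- move=> t tr; rewrite inE negb_or => /andP[tb tS].
  exact/differentiable_slope/df.
- move=> t tr; have tS : t \notin S by apply/negP => /Sr; rewrite tr ltxx.
  have tb : r / 2 <= cabs (t - b).
    by have := cabs_dist t b; rewrite tr; lra.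
  rewrite cabsM cabsV ler_pdivrMr ?(lt_le_trans _ tb) ?divr_gt0 //.
  apply: (@le_trans _ _ (2 * M)).
    rewrite mulr2n mulrDl mul1r (le_trans (cabsB _ _)) // lerD // fM // tr //.
  have -> : 2 * M = 4 * M / r * (r / 2) by field; rewrite gt_eqF.
  rewrite ler_wpM2l // divr_ge0 ?mulr_ge0 ?(ltW r0) //.
  by rewrite (le_trans (cabs_ge0 (f b))) // fM.
- by rewrite inE negb_or ab.
Qed.

(** The slope [k] at 0 is itself bounded and holomorphic off 0, hence Lipschitz by
    [lipschitz_est]; comparing [k a] with values of [k] close to 0 gives the
    quadratic remainder. *)
Lemma taylor1_est f (r M : K) : 0 < r ->
  (forall t, cabs t <= r -> differentiable f t) ->
  (forall t, cabs t <= r -> cabs (f t) <= M) ->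
  cabs ('d f 0 1) <= 2 * M / r /\
  forall a, cabs a <= r / 2 ->
    cabs (f a - f 0 - 'd f 0 1 * a) <= 8 * M / r ^+ 2 * cabs a ^+ 2.
Proof.
move=> r0 df fM.
have c0 : cabs (0 : K[i]) <= r by rewrite cabs0 ltW.
have d0 := df 0 c0.
have M0 : 0 <= M := le_trans (cabs_ge0 _) (fM 0 c0).
pose k t := (f t - f 0) / (t - 0).
have [B HB] := @slope_bounded f [::] r M 0 (fun t tr _ => fM t tr) c0 isT d0.
have S0 (s : K[i]) : s \in [:: 0] -> cabs s < r.
  by rewrite inE => /eqP ->; rewrite cabs0.
have dk t : cabs t <= r -> t \notin [:: 0] -> differentiable k t.
  by rewrite inE => tr t0; exact: (@differentiable_slope f 0 t t0 (df t tr)).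
have kM t : cabs t <= r -> t \notin [:: 0] -> cabs (k t) <= 2 * M / r.
  apply: (@max_principle_except k [:: 0] r _ B) => // {}t tr.
  rewrite /k subr0 cabsM cabsV tr ler_pM2r ?invr_gt0 //.
  by rewrite mulr2n mulrDl mul1r (le_trans (cabsB _ _)) // lerD // fM // tr.
have lim (e : K) : 0 < e -> exists t, [/\ t != 0, cabs t <= r / 2, cabs t <= e &
    cabs (k t - 'd f 0 1) <= e].
  move=> e0; have [d dd Hd] := diff_est d0 e0.
  pose s := Num.min (d / 2) (Num.min (r / 2) e).
  have s0 : 0 < s by rewrite !lt_min e0 !divr_gt0.
  have sd : s < d by rewrite gt_min half_lt.
  have sC : cabs s%:C = s by rewrite cabs_real gtr0_norm.
  have sn : s%:C != 0 by rewrite -cabs_gt0 sC.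
  exists s%:C; rewrite sC; split=> //; try by rewrite !ge_min lexx ?orbT.
  have := Hd s%:C; rewrite nrm_cabs sC => /(_ sd); rewrite add0r diffC // nrm_cabs => H.
  have -> : k s%:C - 'd f 0 1 = (f s%:C - f 0 - 'd f 0 1 * s%:C) / s%:C.
    by rewrite /k subr0; field.
  by rewrite cabsM cabsV sC ler_pdivrMr.
split.
  apply/ler_addgt0Pr => e /lim[t [t0 tr _ te]].
  have tr' : cabs t <= r by lra.
  have := kM t tr'; rewrite inE => /(_ t0).
  have := cabs_dist ('d f 0 1) (k t); rewrite [cabs (_ - k t)]cabs_distC; lra.
move=> a ar; have [->|a0] := eqVneq a 0.
  by rewrite !subrr mulr0 subr0 cabs0 expr0n mulr0.
have ap : 0 < cabs a by rewrite cabs_gt0.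
have -> : f a - f 0 - 'd f 0 1 * a = (k a - 'd f 0 1) * a.
  by rewrite /k subr0; field.
rewrite cabsM expr2 mulrA ler_pM2r //.
pose c := 8 * M / r ^+ 2.
have cc : 0 <= c by rewrite divr_ge0 ?mulr_ge0 ?exprn_ge0 // ltW.
apply/ler_addgt0Pr => e e0.
have e'0 : 0 < e / (c + 1) by rewrite divr_gt0 // ltr_wpDl.
have [t [t0 tr te kt]] := lim _ e'0.
have := @lipschitz_est k [:: 0] r (2 * M / r) r0 S0 dk kM a t ar tr.
rewrite !inE => /(_ a0 t0).
have -> : 4 * (2 * M / r) / r = c by rewrite /c; field; rewrite gt_eqF.
move=> H.
have h1 : c * cabs (a - t) <= c * cabs a + c * (e / (c + 1)).
  by rewrite -mulrDr ler_wpM2l // (le_trans (cabsB _ _)) // lerD2l.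
have h2 : c * (e / (c + 1)) + e / (c + 1) = e.
  by field; rewrite gt_eqF // ltr_wpDl.
have := cabsD (k a - k t) (k t - 'd f 0 1); rewrite subrKA -/c.
move: (e / (c + 1)) h1 h2 kt; clearbody c; clear -H => u h1 h2 kt h3; lra.
Qed.

End Estimates1.

Lemma eq_leW (K : realType) (x y : K) : x = y -> x <= y.
Proof. by move=> ->. Qed.

Section EstimatesV.
Context {K : realType} {V : normedModType K[i]}.
Implicit Types (f : V -> K[i]) (x y z h : V).

Lemma is_diff_line x h (t : K[i]) :
  is_diff t (fun s : K[i] => x + s *: h) ( *:%R ^~ h).
Proof. by apply: is_diff_eq; rewrite add0r. Qed.

Lemma diff_line (W : normedModType K[i]) (f : V -> W) x h t :
  differentiable f (x + t *: h) ->
  differentiable (fun s : K[i] => f (x + s *: h)) t /\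
  'd (fun s : K[i] => f (x + s *: h)) t 1 = 'd f (x + t *: h) h.
Proof.
move=> df; have dl := is_diff_line x h t.
have dl' : differentiable (fun s : K[i] => x + s *: h) t by exact: ex_diff.
split; first exact: (differentiable_comp dl' df).
have := congr1 (fun L : K[i] -> W => L 1) (diff_comp dl' df) => /= ->.
by rewrite diff_val scale1r.
Qed.

Lemma diff_line0 f x h : differentiable f x ->
  'd (fun s : K[i] => f (x + s *: h)) 0 1 = 'd f x h.
Proof.
move=> df; have [_ ->] := @diff_line _ f x h 0 (eq_rect_r (fun z => differentiable f z) df
  (etrans (congr1 (+%R x) (scale0r h)) (addr0 x))).
by rewrite scale0r addr0.
Qed.

(** One complex variable suffices: restrict [f] to the line through [x] with
    direction [h], scaled so that the disk of radius [r] stays in the ball. *)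
Lemma taylor_estV f x (rho M : K) : 0 < rho ->
  (forall y, nrm (y - x) < rho -> differentiable f y) ->
  (forall y, nrm (y - x) < rho -> cabs (f y) <= M) ->
  (forall h, cabs ('d f x h) <= 4 * M / rho * nrm h) /\
  (forall h, nrm h <= rho / 4 ->
    cabs (f (x + h) - f x - 'd f x h) <= 32 * M / rho ^+ 2 * nrm h ^+ 2).
Proof.
move=> r0 df fM; have dfx : differentiable f x by apply: df; rewrite subrr nrm0.
have M0 : 0 <= M by apply: le_trans (cabs_ge0 (f x)) _; rewrite fM // subrr nrm0.
suff H h : h != 0 -> cabs ('d f x h) <= 4 * M / rho * nrm h /\
    (nrm h <= rho / 4 ->
     cabs (f (x + h) - f x - 'd f x h) <= 32 * M / rho ^+ 2 * nrm h ^+ 2).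
  split=> h; have [->|/H[]//] := eqVneq h 0.
    by rewrite linear0 cabs0 nrm0 mulr0.
  by rewrite linear0 addr0 subrr subr0 cabs0 nrm0 expr0n mulr0.
move=> h0; have hp : 0 < nrm h by rewrite nrm_gt0.
pose r := rho / 2 / nrm h; have rp : 0 < r by rewrite !divr_gt0.
have inb t : cabs t <= r -> nrm (x + t *: h - x) < rho.
  move=> tr; rewrite addrKC nrmZ.
  by rewrite (le_lt_trans (ler_wpM2r (nrm_ge0 h) tr)) // divfK ?gt_eqF //
    half_lt.
have [E1 E2] := @taylor1_est K (fun s => f (x + s *: h)) r M rp
  (fun t tr => (diff_line (df _ (inb t tr))).1) (fun t tr => fM _ (inb t tr)).
rewrite diff_line0 // scale0r addr0 in E1 E2.
have rE : r^-1 = 2 * nrm h / rho.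
  by rewrite /r; field; rewrite !gt_eqF.
split.
  by apply: (le_trans E1); rewrite rE; apply: eq_leW; field; rewrite gt_eqF.
move=> h4; have := E2 1; rewrite cabs1 scale1r mulr1 expr1n mulr1 => E3.
apply: (le_trans (E3 _)); first by rewrite /r !ler_pdivlMr // mul1r; lra.
by rewrite -exprVn rE; apply: eq_leW; field; rewrite gt_eqF.
Qed.

Lemma lipschitz_estV f x (rho M : K) : 0 < rho ->
  (forall y, nrm (y - x) < rho -> differentiable f y) ->
  (forall y, nrm (y - x) < rho -> cabs (f y) <= M) ->
  forall y z, nrm (y - x) <= rho / 8 -> nrm (z - x) <= rho / 8 ->
  cabs (f y - f z) <= 8 * M / rho * nrm (y - z).
Proof.
move=> r0 df fM y z yx zx.
have [->|yz] := eqVneq y z; first by rewrite !subrr cabs0 nrm0 mulr0.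
pose h := y - z; have hp : 0 < nrm h by rewrite nrm_gt0 subr_eq0.
have h4 : nrm h <= rho / 4.
  have -> : h = (y - x) - (z - x) by rewrite opprB subrKA.
  rewrite (le_trans (nrmB _ _)) //; lra.
pose r := rho / 2 / nrm h; have rp : 0 < r by rewrite !divr_gt0.
have inb t : cabs t <= r -> nrm (z + t *: h - x) < rho.
  move=> tr; rewrite addrAC (le_lt_trans (nrmD _ _)) // nrmZ.
  have := ler_wpM2r (nrm_ge0 h) tr; rewrite divfK ?gt_eqF //; lra.
have := @lipschitz_est K (fun s => f (z + s *: h)) [::] r M rp (fun s => ltac:(by []))
  (fun t tr _ => (diff_line (df _ (inb t tr))).1) (fun t tr _ => fM _ (inb t tr)) 1 0.
rewrite scale1r scale0r addr0 subrKC cabs1 cabs0 subr0 cabs1 mulr1 => /(_ _ _ isT isT) H.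
apply: (le_trans (H _ _)).
- by rewrite /r !ler_pdivlMr // mul1r; lra.
- by rewrite divr_ge0 // ltW.
- by rewrite /r; apply: eq_leW; field; rewrite !gt_eqF.
Qed.

(** Holomorphy at a point: differentiability at [x] alone carries no Cauchy
    estimate. *)
Definition holo_near (W : normedModType K[i]) (f : V -> W) x :=
  exists2 d : K, 0 < d & forall y, nrm (y - x) < d -> differentiable f y.

Lemma holo_near_bound f x : holo_near f x ->
  exists rho M : K, [/\ 0 < rho, 0 < M,
    forall y, nrm (y - x) < rho -> differentiable f y &
    forall y, nrm (y - x) < rho -> cabs (f y) <= M].
Proof.
move=> [d d0 df]; have dx : differentiable f x by apply: df; rewrite subrr nrm0.
have [d' d'0 Hd] := continuous_est (differentiable_continuous dx) ltr01.
exists (Num.min d d'), (cabs (f x) + 1); split.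
- by rewrite lt_min d0.
- by rewrite ltr_wpDl ?cabs_ge0.
- by move=> y; rewrite lt_min => /andP[/df].
- move=> y; rewrite lt_min => /andP[_ /Hd]; rewrite nrm_cabs => H.
  have := cabs_dist (f y) (f x); lra.
Qed.

Lemma holo_near_differentiable (W : normedModType K[i]) (f : V -> W) x :
  holo_near f x -> differentiable f x.
Proof. by move=> [d d0]; apply; rewrite subrr nrm0. Qed.

Lemma holo_near_nbhd (W : normedModType K[i]) (f : V -> W) x : holo_near f x ->
  exists2 d : K, 0 < d & forall y, nrm (y - x) < d -> holo_near f y.
Proof.
move=> [d d0 df]; exists d => // y yx; exists (d - nrm (y - x)); first by rewrite subr_gt0.
move=> z; rewrite ltrBrDr => zy; apply: df; apply: le_lt_trans zy.
by rewrite -(subrKA y) nrmD.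
Qed.

(** The remainder of [f] at [x] is of second order, so Cauchy's estimate
    on a small ball gives it a small Lipschitz constant. *)
Lemma strict_est f x (e : K) : holo_near f x -> 0 < e ->
  exists2 d : K, 0 < d & forall y z, nrm (y - x) < d -> nrm (z - x) < d ->
    cabs (f y - f z - 'd f x (y - z)) <= e * nrm (y - z).
Proof.
move=> hf e0; have [rho [M [r0 M0 df fM]]] := holo_near_bound hf.
have [_ T] := taylor_estV r0 df fM.
pose C := 32 * M / rho ^+ 2.
have C0 : 0 < C by rewrite divr_gt0 ?mulr_gt0 ?exprn_gt0.
have C8 : 0 < 8 * C by rewrite mulr_gt0.
have [s [s0 sr sC]] : exists s : K, [/\ 0 < s, s <= rho / 4 & 8 * C * s <= e].
  exists (Num.min (rho / 4) (e / (8 * C))); split.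
  - by rewrite lt_min !divr_gt0.
  - by rewrite ge_min lexx.
  - by rewrite mulrC -(ler_pdivlMr _ _ C8) ge_min lexx orbT.
have dfx : differentiable f x by apply: df; rewrite subrr nrm0.
pose g y := f y - f x - 'd f x (y - x).
have dg y : nrm (y - x) < s -> differentiable g y.
  move=> ys; apply: differentiableB.
    apply: differentiableB; last exact: differentiable_cst.
    by apply: df; apply: (lt_le_trans ys); lra.
  apply: (@differentiable_comp _ _ _ _ (fun y => y - x) ('d f x)).
    by apply: differentiableB; [exact: ex_diff | exact: differentiable_cst].
  exact/linear_differentiable/diff_continuous.
have gM y : nrm (y - x) < s -> cabs (g y) <= C * s ^+ 2.
  move=> ys; have := T (y - x) (ltW (lt_le_trans ys sr)); rewrite subrKC -/(g y).
  move=> /le_trans; apply; rewrite ler_wpM2l ?(ltW C0) //.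
  by rewrite lerXn2r ?nnegrE ?nrm_ge0 ?(ltW s0) ?(ltW ys).
exists (s / 8); first by rewrite divr_gt0.
move=> y z ys zs; have := lipschitz_estV s0 dg gM (ltW ys) (ltW zs).
have -> : g y - g z = f y - f z - 'd f x (y - z).
  have -> : y - z = (y - x) - (z - x) by rewrite opprB subrKA.
  by rewrite (linearB ('d f x)) /g; ring.
move=> /le_trans; apply; rewrite ler_wpM2r ?nrm_ge0 //.
by apply: le_trans sC; apply: eq_leW; field; rewrite gt_eqF.
Qed.

End EstimatesV.

(** * Limits and removable singularities *)

Section RowNorm.
Context {K : realType}.

Lemma cabs_coord_le n (w : 'rV[K[i]]_n) j : cabs (w 0 j) <= nrm w.
Proof.
rewrite -lecR nrmE cabsE; apply: (@le_trans _ _ (mx_norm w)) => //.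
by rewrite mx_normE -[leLHS]nngE num_le; exact: (le_bigmax _ _ (0, j)).
Qed.

Lemma nrm_row_le n (w : 'rV[K[i]]_n) (c : K) : 0 <= c ->
  (forall j, cabs (w 0 j) <= c) -> nrm w <= c.
Proof.
move=> c0 H; have [->|w0] := eqVneq w 0; first by rewrite nrm0.
have [|[i j] E] := @mx_norm_neq0 _ _ _ w; first by rewrite -normr_eq0 in w0.
by rewrite -lecR nrmE (_ : `|w| = mx_norm w) // E /= (ord1 i) -cabsE lecR.
Qed.

Lemma nrm_delta n (j : 'I_n) : nrm (delta_mx 0 j : 'rV[K[i]]_n) <= 1.
Proof.
by apply: nrm_row_le => // k; rewrite mxE eqxx /=; case: (k == j); rewrite ?cabs0 ?cabs1 ?lexx ?ler01.
Qed.

Lemma lin_row n (L : {linear 'rV[K[i]]_n -> K[i]}) (h : 'rV[K[i]]_n) :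
  L h = \sum_j h 0 j * L (delta_mx 0 j).
Proof.
rewrite {1}[h]row_sum_delta linear_sum; apply: eq_bigr => j _.
by rewrite linearZ.
Qed.

Lemma cabs_sum_le (I : finType) (F : I -> K[i]) (b : K) :
  (forall i, cabs (F i) <= b) -> cabs (\sum_i F i) <= #|I|%:R * b.
Proof.
move=> H; rewrite mulr_natl -sumr_const.
elim/big_ind2: _ => [|x a y c xa yc|i _]; rewrite ?cabs0 //.
by rewrite (le_trans (cabsD _ _)) // lerD.
Qed.

End RowNorm.

Section Limits.
Context {K : realType}.

(** Completeness, for families indexed by any set: Cauchy up to the errors
    [eta i] implies convergent up to the same errors. *)
Lemma common_center_real (I : Type) (P : set I) (u : I -> K) (eta : I -> K) :
  P !=set0 -> (forall i j, P i -> P j -> `|u i - u j| <= eta i + eta j) ->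
  exists c, forall i, P i -> `|u i - c| <= eta i.
Proof.
move=> [i0 Pi0] H.
pose A := [set u i - eta i | i in P].
have ub i j : P i -> P j -> u j - eta j <= u i + eta i.
  by move=> Pi Pj; have := H _ _ Pi Pj; rewrite ler_distl; lra.
have hs : has_sup A.
  split; first by exists (u i0 - eta i0), i0.
  by exists (u i0 + eta i0) => _ [j Pj <-]; exact: ub.
exists (sup A) => i Pi; rewrite ler_distl; apply/andP; split.
  by rewrite lerBlDr; apply: ge_sup; [case: hs | move=> _ [j Pj <-]; exact: ub].
by rewrite -lerBlDr; apply: ub_le_sup; [case: hs | exists i].
Qed.

Lemma common_center (I : Type) (P : set I) (u : I -> K[i]) (eta : I -> K) :
  P !=set0 -> (forall i j, P i -> P j -> cabs (u i - u j) <= eta i + eta j) ->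
  exists c, forall i, P i -> cabs (u i - c) <= 2 * eta i.
Proof.
move=> P0 H.
have RB (x y : K[i]) : Re (x - y) = Re x - Re y by case: x; case: y.
have IB (x y : K[i]) : Im (x - y) = Im x - Im y by case: x; case: y.
have [|a Ha] := @common_center_real _ P (fun i => Re (u i)) eta P0.
  by move=> i j Pi Pj; rewrite -RB (le_trans (cabs_Re _)) ?H.
have [|b Hb] := @common_center_real _ P (fun i => Im (u i)) eta P0.
  by move=> i j Pi Pj; rewrite -IB (le_trans (cabs_Im _)) ?H.
exists (a +i* b) => i Pi; rewrite (le_trans (cabs_le _)) // RB IB /=.
by have := Ha i Pi; have := Hb i Pi; lra.
Qed.

Lemma lipschitz_limit (g : K[i] -> K[i]) (rho L : K) : 0 < rho ->
  (forall a b, cabs a <= rho -> cabs b <= rho -> a != 0 -> b != 0 ->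
    cabs (g a - g b) <= L * cabs (a - b)) ->
  exists c, forall a, cabs a <= rho -> a != 0 -> cabs (g a - c) <= 2 * L * cabs a.
Proof.
move=> r0 H.
have rC : cabs rho%:C = rho by rewrite cabs_real gtr0_norm.
have rn : rho%:C != 0 by rewrite -cabs_gt0 rC.
have L0 : 0 <= L.
  have := H rho%:C (- rho%:C); rewrite cabsN rC oppr_eq0 lexx => /(_ isT isT rn rn).
  rewrite opprK -[rho%:C + _]mulr2n -mulr_natr cabsM rC cabs_nat => /(le_trans (cabs_ge0 _)).
  by rewrite pmulr_lge0 // mulr_gt0.
have [||c Hc] := @common_center _ [set a | cabs a <= rho /\ a != 0] g (fun a => L * cabs a).
- by exists rho%:C; rewrite /= rC lexx.
- move=> a b [ar a0] [br b0]; apply: (le_trans (H a b ar br a0 b0)).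
  by rewrite -mulrDr ler_wpM2l // cabsB.
by exists c => a ar a0; rewrite -mulrA Hc.
Qed.

(** Riemann's theorem: a bounded holomorphic function is Lipschitz near the
    puncture and has a limit [c] there; then its slope [q] at the puncture is
    bounded, and the same argument gives the derivative [c']. *)
Lemma removable_singularity (f : K[i] -> K[i]) (r M : K) : 0 < r ->
  (forall t, cabs t <= r -> t != 0 -> differentiable f t) ->
  (forall t, cabs t <= r -> t != 0 -> cabs (f t) <= M) ->
  exists c, differentiable (fun t => if t == 0 then c else f t) 0.
Proof.
move=> r0 df fM.
have S0 (s : K[i]) (r' : K) : 0 < r' -> s \in [:: 0] -> cabs s < r'.
  by move=> r'0; rewrite inE => /eqP ->; rewrite cabs0.
have nin (t : K[i]) : (t \notin [:: 0]) = (t != 0) by rewrite inE.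
have r20 : 0 < r / 2 by rewrite divr_gt0.
have r2 : r / 2 <= r by lra.
have Lf (a b : K[i]) : cabs a <= r / 2 -> cabs b <= r / 2 -> a != 0 -> b != 0 ->
    cabs (f a - f b) <= 4 * M / r * cabs (a - b).
  rewrite -!nin; apply: (@lipschitz_est K f [:: 0] r M r0).
  - by move=> s; exact: S0.
  - by move=> t tr; rewrite nin; exact: df.
  - by move=> t tr; rewrite nin; exact: fM.
have [c Hc] := lipschitz_limit r20 Lf.
exists c; pose q t := (f t - c) / t.
pose B := 2 * (4 * M / r).
have Lq (a b : K[i]) : cabs a <= r / 2 / 2 -> cabs b <= r / 2 / 2 -> a != 0 -> b != 0 ->
    cabs (q a - q b) <= 4 * B / (r / 2) * cabs (a - b).
  rewrite -!nin; apply: (@lipschitz_est K q [:: 0] (r / 2) B r20).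
  - by move=> s; exact: S0.
  - move=> t tr; rewrite nin => t0; apply: differentiableM.
      apply: differentiableB; last exact: differentiable_cst.
      by apply: df => //; exact: le_trans tr r2.
    by apply: differentiableV => //; exact: ex_diff.
  - move=> t tr; rewrite nin => t0.
    by rewrite /q cabsM cabsV ler_pdivrMr ?cabs_gt0 // Hc.
have r40 : 0 < r / 2 / 2 by rewrite divr_gt0.
have [c' Hc'] := lipschitz_limit r40 Lq.
set L := 2 * _ in Hc'.
have [|//] := @diff_intro1 K (fun t => if t == 0 then c else f t) 0 c'.
move=> e e0; pose d := Num.min (r / 2 / 2) (e / (`|L| + 1)).
have L1 : 0 < `|L| + 1 by rewrite ltr_wpDl.
exists d; first by rewrite lt_min r40 divr_gt0.
move=> h; rewrite lt_min add0r eqxx => /andP[h1 h2].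
have [->|h0] := eqVneq h 0; first by rewrite subrr mulr0 subr0 cabs0 mulr0.
have -> : f h - c - c' * h = (q h - c') * h by rewrite /q; field.
rewrite cabsM ler_wpM2r ?cabs_ge0 //.
apply: (le_trans (Hc' _ (ltW h1) h0)).
apply: (@le_trans _ _ ((`|L| + 1) * cabs h)).
  by rewrite ler_wpM2r ?cabs_ge0 // (le_trans (ler_norm _)) // lerDl.
by rewrite mulrC -ler_pdivlMr // ltW.
Qed.

(** Locally uniform limits of holomorphic functions are holomorphic: by the
    Cauchy estimate the differentials converge, and the quadratic remainder
    bound passes to the limit. *)
Lemma differentiable_limit n (I : Type) (P : set I) (g : I -> 'rV[K[i]]_n -> K[i])
    (G : 'rV[K[i]]_n -> K[i]) x (rho M : K) (eta : I -> K) : 0 < rho ->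
  (forall i y, P i -> nrm (y - x) < rho -> differentiable (g i) y) ->
  (forall i y, P i -> nrm (y - x) < rho -> cabs (g i y) <= M) ->
  (forall i y, P i -> nrm (y - x) < rho -> cabs (g i y - G y) <= eta i) ->
  (forall e, 0 < e -> exists2 i, P i & eta i <= e) ->
  differentiable G x.
Proof.
move=> r0 dg gM gG small.
have P0 : P !=set0 by have [i Pi _] := small 1 ltr01; exists i.
have xx : nrm (x - x) < rho by rewrite subrr nrm0.
have dgx i : P i -> differentiable (g i) x by move=> Pi; exact: dg.
have eta0 i : P i -> 0 <= eta i by move=> Pi; exact: le_trans (cabs_ge0 _) (gG i x Pi xx).
have cau i j h : P i -> P j ->
    cabs ('d (g i) x h - 'd (g j) x h) <= 4 * (eta i + eta j) / rho * nrm h.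
  move=> Pi Pj.
  have [||H _] := @taylor_estV K _ (fun y => g i y - g j y) x rho (eta i + eta j) r0.
  - by move=> y yx; apply: differentiableB; exact: dg.
  - move=> y yx; have := gG i y Pi yx; have := gG j y Pj yx.
    have := cabsB (g i y - G y) (g j y - G y).
    by rewrite opprB subrKA; lra.
  have := H h.
  have := congr1 (fun L : _ -> K[i] => L h) (diffB (dgx i Pi) (dgx j Pj)).
  by rewrite /= => <-.
have /choice[l Hl] (j : 'I_n) : exists l, forall i, P i ->
    cabs ('d (g i) x (delta_mx 0 j) - l) <= 2 * (4 * eta i / rho).
  apply: (@common_center _ P (fun i => 'd (g i) x (delta_mx 0 j))) => // i k Pi Pk.
  apply: (le_trans (cau _ _ _ Pi Pk)).
  rewrite -mulrDl -mulrDr ler_piMr ?nrm_delta //.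
  by rewrite divr_ge0 ?(ltW r0) // mulr_ge0 // addr_ge0 ?eta0.
have Llin : linear (fun h : 'rV[K[i]]_n => \sum_j h 0 j * l j).
  move=> a u v; rewrite scaler_sumr -big_split /=; apply: eq_bigr => j _.
  by rewrite !mxE mulrDl -mulrA.
pose Lm := GRing.isLinear.Build _ _ _ _ _ Llin.
pose L : {linear 'rV[K[i]]_n -> K[i]} := HB.pack (fun h : 'rV[K[i]]_n => \sum_j h 0 j * l j) Lm.
have LE h : L h = \sum_j h 0 j * l j by [].
have gL i h : P i -> cabs ('d (g i) x h - L h) <= n%:R * (2 * (4 * eta i / rho) * nrm h).
  move=> Pi; rewrite (lin_row ('d (g i) x)) LE -sumrB.
  have := @cabs_sum_le K 'I_n (fun j => h 0 j * 'd (g i) x (delta_mx 0 j) - h 0 j * l j).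
  rewrite card_ord; apply => j; rewrite -mulrBr cabsM mulrC.
  by rewrite ler_pM ?cabs_ge0 ?cabs_coord_le ?Hl.
pose b := \sum_j cabs (l j).
have Lb h : cabs (L h) <= n%:R * (b * nrm h).
  rewrite LE; have := @cabs_sum_le K 'I_n (fun j => h 0 j * l j).
  rewrite card_ord; apply => j; rewrite cabsM mulrC ler_pM ?cabs_ge0 ?cabs_coord_le //.
  by rewrite /b (bigD1 j) //= lerDl sumr_ge0 // => k _; exact: cabs_ge0.
pose C := 32 * M / rho ^+ 2.
have M0 : 0 <= M by have [i Pi] := P0; exact: le_trans (cabs_ge0 _) (gM i x Pi xx).
have C0 : 0 <= C by rewrite divr_ge0 ?exprn_ge0 ?mulr_ge0 // ltW.
have T h : nrm h < rho / 4 -> cabs (G (x + h) - G x - L h) <= C * nrm h ^+ 2.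
  move=> hr; apply/ler_addgt0Pr => e e0.
  pose c := 2 + n%:R * (2 * (4 / rho) * nrm h).
  have c0 : 0 < c.
    by rewrite ltr_wpDr // !mulr_ge0 ?invr_ge0 ?nrm_ge0 // ltW.
  have [i Pi ie] := small _ (divr_gt0 e0 c0).
  have [_ Ti] := taylor_estV r0 (fun y => dg i y Pi) (fun y => gM i y Pi).
  have T1 := Ti h (ltW hr).
  have xh : nrm (x + h - x) < rho by rewrite addrKC; lra.
  have G1 := gG i _ Pi xh; have G2 := gG i _ Pi xx; have G3 := gL i h Pi.
  have E : c * eta i = 2 * eta i + n%:R * (2 * (4 * eta i / rho) * nrm h).
    by rewrite /c; ring.
  have ce : c * eta i <= e by rewrite mulrC -ler_pdivlMr.
  have -> : G (x + h) - G x - L h = (g i (x + h) - g i x - 'd (g i) x h)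
    - (g i (x + h) - G (x + h)) + (g i x - G x) + ('d (g i) x h - L h) by ring.
  move: T1 G1 G2 G3; rewrite -/C.
  set u1 := _ - _ - 'd _ _ _; set u2 := _ - G (x + h); set u3 := _ - G x.
  set u4 := _ - L h => T1 G1 G2 G3.
  have := cabsD (u1 - u2 + u3) u4; have := cabsD (u1 - u2) u3; have := cabsB u1 u2.
  lra.
have [|//|//] := @diff_intro K _ _ G x L (n%:R * b).
  by move=> h; rewrite -mulrA Lb.
move=> e e0; exists (Num.min (rho / 4) (e / (C + 1))).
  by rewrite lt_min !divr_gt0 // ltr_wpDl.
move=> h; rewrite lt_min => /andP[h1 h2]; apply: (le_trans (T _ h1)).
rewrite expr2 mulrA ler_wpM2r ?nrm_ge0 //.
apply: (@le_trans _ _ ((C + 1) * nrm h)).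
  by rewrite ler_wpM2r ?nrm_ge0 // lerDl.
by rewrite mulrC -ler_pdivlMr ?ltr_wpDl // ltW.
Qed.

(** The directional derivative is the locally uniform limit of the difference
    quotients, which are holomorphic. *)
Lemma differentiable_diff n (f : 'rV[K[i]]_n -> K[i]) x e :
  holo_near f x -> differentiable (fun y => 'd f y e) x.
Proof.
move=> hf; have [rho [M [r0 M0 df fM]]] := holo_near_bound hf.
have r20 : 0 < rho / 2 by rewrite divr_gt0.
have sub y z : nrm (y - x) < rho / 2 -> nrm (z - y) < rho / 2 -> nrm (z - x) < rho.
  move=> yx zy; have := nrmD (z - y) (y - x); rewrite subrKA; lra.
have T y (yx : nrm (y - x) < rho / 2) := @taylor_estV K _ f y _ _ r20
  (fun z zy => df z (sub y z yx zy)) (fun z zy => fM z (sub y z yx zy)).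
pose q := nrm e + 1; have q0 : 0 < q by rewrite ltr_wpDl ?nrm_ge0.
have eq : nrm e <= q by rewrite lerDl.
pose D := 4 * M / (rho / 2) * nrm e.
pose E := 32 * M / (rho / 2) ^+ 2 * q ^+ 2.
have E0 : 0 < E by rewrite mulr_gt0 ?divr_gt0 ?exprn_gt0 ?mulr_gt0.
pose P := [set s : K | 0 < s /\ s <= rho / 2 / 4 / q].
have app (s : K) y : P s -> nrm (y - x) < rho / 2 ->
    cabs ((f (y + s%:C *: e) - f y) / s%:C - 'd f y e) <= E * s.
  move=> [s0 sr] yx; have [_] := T y yx; move=> /(_ (s%:C *: e)).
  have sC : cabs s%:C = s by rewrite cabs_real gtr0_norm.
  have sn : s%:C != 0 by rewrite -cabs_gt0 sC.
  rewrite nrmZ sC linearZ /= => H.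
  have -> : (f (y + s%:C *: e) - f y) / s%:C - 'd f y e =
    (f (y + s%:C *: e) - f y - s%:C * 'd f y e) / s%:C by field.
  rewrite cabsM cabsV sC ler_pdivrMr //; apply: (le_trans (H _)).
    apply: (@le_trans _ _ (s * q)); first by rewrite ler_wpM2l // ltW.
    by rewrite -ler_pdivlMr.
  rewrite [(s * nrm e) ^+ 2]exprMn.
  apply: (@le_trans _ _ (32 * M / (rho / 2) ^+ 2 * (s ^+ 2 * q ^+ 2))).
    have F0 : 0 <= 32 * M / (rho / 2) ^+ 2.
      by apply: divr_ge0 (sqr_ge0 _); apply: mulr_ge0 => //; exact: ltW.
    apply: (ler_wpM2l F0); apply: (ler_wpM2l (sqr_ge0 s)).
    by rewrite lerXn2r ?nnegrE ?nrm_ge0 ?(ltW q0).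
  by apply: eq_leW; rewrite /E; ring.
have b0 : 0 < rho / 2 / 4 / q by rewrite !divr_gt0.
apply: (@differentiable_limit n K P (fun s y => (f (y + s%:C *: e) - f y) / s%:C)
  _ x (rho / 2 / 2) (D + E * (rho / 2 / 4 / q)) (fun s => E * s)).
- by rewrite divr_gt0.
- move=> s y [s0 sr] yx; apply: differentiableM; last exact: differentiable_cst.
  apply: differentiableB; last by apply: df; lra.
  apply: (@differentiable_comp _ _ _ _ (fun y => y + s%:C *: e) f).
    by apply: differentiableD; [exact: ex_diff | exact: differentiable_cst].
  apply: df; rewrite addrAC (le_lt_trans (nrmD _ _)) // nrmZ cabs_pos //.
  have : s * nrm e <= rho / 2 / 4.
    apply: (@le_trans _ _ (s * q)); first by rewrite ler_wpM2l // ltW.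
    by rewrite -ler_pdivlMr.
  lra.
- move=> s y Ps yx; have yx' : nrm (y - x) < rho / 2 by lra.
  have := app s y Ps yx'; have [/(_ e)] := T y yx'; rewrite -/D => H _.
  have : E * s <= E * (rho / 2 / 4 / q) by rewrite ler_pM2l //; case: Ps.
  set u := _ / s%:C; have := cabsD (u - 'd f y e) ('d f y e); rewrite subrK; lra.
- by move=> s y Ps yx; apply: app => //; lra.
- move=> d d0; exists (Num.min (rho / 2 / 4 / q) (d / E)).
    by split; rewrite ?lt_min ?b0 ?divr_gt0 // ge_min lexx.
  by rewrite mulrC -ler_pdivlMr // ge_min lexx orbT.
Qed.

Lemma holo_near_diff n (f : 'rV[K[i]]_n -> K[i]) x e :
  holo_near f x -> holo_near (fun y => 'd f y e) x.
Proof.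
move=> /holo_near_nbhd[d d0 H]; exists d => // y /H; exact: differentiable_diff.
Qed.

End Limits.

(** * Zeros of holomorphic functions *)

Section Zeros.
Context {K : realType}.

Lemma diff_near_eq (V W : normedModType K[i]) (f g : V -> W) x (d : K) : 0 < d ->
  (forall y, nrm (y - x) < d -> f y = g y) -> differentiable f x ->
  differentiable g x /\ forall h, 'd g x h = 'd f x h.
Proof.
move=> d0 fg df; have [c c0 Hc] := nrm_diff_bound df.
apply: (diff_intro Hc) => e e0; have [r r0 Hr] := diff_est df e0.
exists (Num.min d r); first by rewrite lt_min d0.
move=> h; rewrite lt_min => /andP[h1 /Hr]; rewrite !fg ?subrr ?nrm0 //.
by rewrite addrKC.
Qed.

Lemma diffM1 (f g : K[i] -> K[i]) t : differentiable f t -> differentiable g t ->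
  'd (fun z => f z * g z) t 1 = f t * 'd g t 1 + g t * 'd f t 1.
Proof.
by move=> df dg; exact: (congr1 (fun L : K[i] -> K[i] => L 1) (diffM df dg)).
Qed.

Lemma diffX1 n (t : K[i]) :
  'd (fun z : K[i] => z ^+ n.+1) t 1 = n.+1%:R * t ^+ n.
Proof.
have did (s : K[i]) : differentiable (fun z : K[i] => z) s by exact: ex_diff.
have id1 (s : K[i]) : 'd (fun z : K[i] => z) s 1 = 1.
  exact: (congr1 (fun L : K[i] -> K[i] => L 1) (@diff_val _ _ _ _ _ _ _ (is_diff_id s))).
elim: n => [|n IH].
  by rewrite expr0 mulr1 -[RHS](id1 t); apply: (diff_near_eq (d := 1) _ _ (did t)).2.
have E : 'd (fun z : K[i] => z * z ^+ n.+1) t 1 = t * 'd (fun z : K[i] => z ^+ n.+1) t 1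
    + t ^+ n.+1 * 'd (fun z : K[i] => z) t 1.
  by apply: diffM1 => //; exact: differentiable_pow.
have -> : (fun z : K[i] => z ^+ n.+2) = (fun z => z * z ^+ n.+1).
  by apply/funext => z; rewrite exprS.
have key (a b c d : K[i]) : a = c -> b = d -> t * a + t ^+ n.+1 * b = t * c + t ^+ n.+1 * d.
  by move=> -> ->.
apply: (etrans E); apply: (etrans (key _ _ _ _ IH (id1 t))).
by rewrite -[n.+2%:R]natr1 exprS; ring.
Qed.

(** By bisection: when [g] moves by more than [e] times the length of an interval,
    it does so on one of the halves, and the common point of the nested intervals
    has speed at least [e]. *)
Lemma constant_of_zero_speed (g : K -> K[i]) :
  (forall s e, 0 <= s <= 1 -> 0 < e -> exists2 d, 0 < d & forall s', 0 <= s' <= 1 ->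
    `|s' - s| < d -> cabs (g s' - g s) <= e * `|s' - s|) -> g 1 = g 0.
Proof.
move=> H; apply/eqP; rewrite -subr_eq0 -cabs_eq0 eq_le cabs_ge0 andbT.
rewrite leNgt; apply/negP => pos.
have [e e0 big] : exists2 e, 0 < e & e < cabs (g 1 - g 0).
  by exists (cabs (g 1 - g 0) / 2); [rewrite divr_gt0 | lra].
pose bad k s := e * (2 ^+ k)^-1 < cabs (g (s + (2 ^+ k)^-1) - g s).
have p0 := @exp2V_gt0 K.
have half := @exp2VS K.
have step (x : nat * K) : exists b : bool, bad x.1 x.2 ->
    bad x.1.+1 (x.2 + b%:R / 2 ^+ x.1.+1).
  case: x => k s /=; apply: contrapT => nb.
  have nG (b : bool) : ~ bad k.+1 (s + b%:R / 2 ^+ k.+1).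
    by move=> G; apply: nb; exists b.
  apply: nb; exists false; rewrite /bad => B.
  have /negP := nG false; have /negP := nG true; rewrite /bad -!leNgt mul0r addr0 mul1r.
  rewrite half; have -> : s + (2 ^+ k)^-1 / 2 + (2 ^+ k)^-1 / 2 = s + (2 ^+ k)^-1 by field.
  set a := g (s + _ / 2).
  have := cabsD (g (s + (2 ^+ k)^-1) - a) (a - g s); rewrite subrKA; lra.
have [F HF] := choice step.
pose fix u k := if k is j.+1 then u j + (F (j, u j))%:R / 2 ^+ j.+1 else 0.
have allbad k : bad k (u k).
  elim: k => [|k IH]; last exact: (HF (k, u k)).
  by rewrite /bad /= expr0 invr1 mulr1 add0r.
have [l l01 lk] := @dyadic_limit K (fun k => F (k, u k)) u erefl (fun k => erefl).
have [d d0 Hd] := H l e l01 e0.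
have [k dk] := exists_pow2_gt d^-1.
have kd : (2 ^+ k)^-1 < d by rewrite invf_plt ?posrE ?exprn_gt0.
have u0 j : 0 <= u j.
  elim: j => [|j IH] //=; rewrite addr_ge0 // mulr_ge0 ?ler0n // ltW //.
have u1 j : u j + (2 ^+ j)^-1 <= 1.
  elim: j => [|j IH] /=; first by rewrite expr0 invr1 add0r.
  by move: IH; rewrite half; case: (F _) => /=; have := p0 j; lra.
have := allbad k; rewrite /bad ltNge => /negP[].
have /andP[l1 l2] := lk k; have uk0 := u0 k; have uk1 := u1 k; have pk := p0 k.
have A := Hd (u k + (2 ^+ k)^-1); have B := Hd (u k).
rewrite ger0_norm in A; last by rewrite subr_ge0.
rewrite ler0_norm in B; last by rewrite subr_le0.
have {}A : cabs (g (u k + (2 ^+ k)^-1) - g l) <= e * (u k + (2 ^+ k)^-1 - l).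
  by apply: A; lra.
have {}B : cabs (g (u k) - g l) <= e * - (u k - l) by apply: B; lra.
have := cabsB (g (u k + (2 ^+ k)^-1) - g l) (g (u k) - g l); rewrite opprB subrKA.
lra.
Qed.

Lemma linZ (V : normedModType K[i]) (L : {linear V -> K[i]}) t v :
  L (t *: v) = t * L v.
Proof. by rewrite linearZ. Qed.

Lemma constant_on_segment (V : normedModType K[i]) (f : V -> K[i]) x v :
  (forall s : K, 0 <= s <= 1 ->
    differentiable f (x + s%:C *: v) /\ 'd f (x + s%:C *: v) v = 0) ->
  f (x + v) = f x.
Proof.
move=> df; have q0 : 0 < nrm v + 1 by rewrite ltr_wpDl ?nrm_ge0.
have := @constant_of_zero_speed (fun s => f (x + s%:C *: v)).
rewrite rmorph1 rmorph0 scale1r scale0r addr0; apply=> s e s01 e0.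
have [dfs d0] := df s s01; have [d dp Hd] := diff_est dfs (divr_gt0 e0 q0).
exists (d / (nrm v + 1)); first by rewrite divr_gt0.
move=> s' _; rewrite ltr_pdivlMr // => ss.
have hv : nrm ((s' - s)%:C *: v) <= `|s' - s| * (nrm v + 1).
  by rewrite nrmZ cabs_real ler_wpM2l // lerDl.
have := Hd _ (le_lt_trans hv ss); rewrite linZ d0 mulr0 subr0.
rewrite -addrA -scalerDl -rmorphD /= subrKC => /le_trans; apply.
apply: (@le_trans _ _ (e / (nrm v + 1) * (`|s' - s| * (nrm v + 1)))).
  by rewrite ler_wpM2l // divr_ge0 ?ltW.
by apply: eq_leW; field; rewrite gt_eqF.
Qed.

Lemma divide_zero (f : K[i] -> K[i]) (r M : K) : 0 < r ->
  (forall t, cabs t <= r -> differentiable f t) ->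
  (forall t, cabs t <= r -> cabs (f t) <= M) -> f 0 = 0 ->
  exists g, (forall t, cabs t <= r -> differentiable g t) /\
    forall t, f t = t * g t.
Proof.
move=> r0 df fM f0; have z0 : cabs (0 : K[i]) <= r by rewrite cabs0 ltW.
have [B HB] := @slope_bounded K f [::] r M 0 (fun t tr _ => fM t tr) z0 isT (df 0 z0).
have dq t : cabs t <= r -> t != 0 -> differentiable (fun t => f t / t) t.
  move=> tr t0; apply: differentiableM; first exact: df.
  by apply: differentiableV => //; exact: ex_diff.
have [|c dc] := @removable_singularity K (fun t => f t / t) r B r0 dq.
  move=> t tr t0; have := HB t tr; rewrite f0 !subr0; apply.
  by rewrite inE.
exists (fun t => if t == 0 then c else f t / t); split.
  move=> t tr; have [-> //|t0] := eqVneq t 0.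
  have t0' : 0 < cabs t by rewrite cabs_gt0.
  apply: (diff_near_eq (f := fun t => f t / t) t0' _ (dq t tr t0)).1 => y.
  rewrite nrm_cabs => yt; case: eqP => // y0.
  by move: yt; rewrite y0 sub0r cabsN ltxx.
by move=> t; case: eqP => [->|/eqP t0]; [rewrite mul0r f0 | field].
Qed.

(** If the division by the variable could be continued forever, the quotients
    would satisfy [cabs (f t / t ^+ k) <= M / r ^+ k] by the maximum principle, and
    [f t] would vanish for [cabs t < r]. *)
Lemma zero_order (f : K[i] -> K[i]) (r M : K) : 0 < r ->
  (forall t, cabs t <= r -> differentiable f t) ->
  (forall t, cabs t <= r -> cabs (f t) <= M) ->
  ~ (forall t, cabs t < r -> f t = 0) ->
  exists k g, [/\ forall t, cabs t <= r -> differentiable g t,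
    forall t, f t = t ^+ k * g t & g 0 != 0].
Proof.
move=> r0 df fM nz; apply: contrapT => nex; apply: nz => t tr.
have z0 : cabs (0 : K[i]) <= r by rewrite cabs0 ltW.
have fac k : exists g, [/\ forall t, cabs t <= r -> differentiable g t,
    forall t, f t = t ^+ k * g t &
    forall t, cabs t <= r -> cabs (g t) <= M / r ^+ k].
  elim: k => [|k [g [dg fg gM]]].
    by exists f; split=> // s; rewrite ?expr0 ?mul1r ?divr1 //; exact: fM.
  have [g0|g0] := eqVneq (g 0) 0; last by case: nex; exists k, g.
  have [g' [dg' gg']] := divide_zero r0 dg gM g0.
  exists g'; split=> // [s|]; first by rewrite exprSr -mulrA -gg'.
  apply: (max_principle r0 dg') => s sr.
  have sr' : cabs s <= r by rewrite sr.
  rewrite ler_pdivlMr ?exprn_gt0 // -[X in _ * X ^+ _]sr -cabsX -cabsM mulrC.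
  by rewrite exprSr -mulrA -gg' -fg fM.
apply/eqP; rewrite -cabs_eq0 eq_le cabs_ge0 andbT leNgt; apply/negP => ft0.
have : 1 <= cabs t / r.
  apply: (@le_of_power_le K 1 (cabs t / r) (cabs (f t)) M) => // [|N].
    by rewrite divr_ge0 ?cabs_ge0 ?ltW.
  have [g [_ fg gM]] := fac N.
  rewrite expr1n mul1r fg cabsM cabsX expr_div_n -mulrA ler_wpM2l ?exprn_ge0 ?cabs_ge0 //.
  by rewrite mulrC gM // ltW.
by rewrite ler_pdivlMr // mul1r leNgt tr.
Qed.

Lemma zero_order_lower (g : K[i] -> K[i]) k : differentiable g 0 -> g 0 != 0 ->
  exists2 d : K, 0 < d & forall t, cabs t < d ->
    cabs t ^+ k * (cabs (g 0) / 2) <= cabs (t ^+ k * g t).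
Proof.
move=> dg g0; have gp : 0 < cabs (g 0) / 2 by rewrite divr_gt0 ?cabs_gt0.
have [d d0 Hd] := continuous_est (differentiable_continuous dg) gp.
exists d => // t td; rewrite cabsM cabsX ler_wpM2l ?exprn_ge0 ?cabs_ge0 //.
have := Hd t; rewrite subr0 !nrm_cabs => /(_ td); rewrite cabs_distC.
have := cabs_dist (g 0) (g t); lra.
Qed.

(** Hurwitz: a zero of [u] on the line through [x] cannot disappear when the
    line is moved slightly; otherwise the maximum principle would apply to the
    inverse of [u], which is bounded on a circle and huge at its centre. *)
Lemma hurwitz (V : normedModType K[i]) (u : V -> K[i]) x e :
  holo_near u x -> u x = 0 ->
  (forall d : K, 0 < d -> exists2 t, cabs t < d & u (x + t *: e) != 0) ->
  forall eps : K, 0 < eps -> exists2 d : K, 0 < d & forall y, nrm (y - x) < d ->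
    exists2 t, cabs t < eps & u (y + t *: e) = 0.
Proof.
move=> hu ux0 nz eps eps0; have [rho [M [r0 M0 du uM]]] := holo_near_bound hu.
pose q := nrm e + 1; have q0 : 0 < q by rewrite ltr_wpDl ?nrm_ge0.
pose r := rho / 32 / q; have rp : 0 < r by rewrite !divr_gt0.
have te t : cabs t <= r -> nrm (t *: e) <= rho / 32.
  move=> tr; rewrite nrmZ; apply: (@le_trans _ _ (r * q)).
    by apply: ler_pM; rewrite ?cabs_ge0 ?nrm_ge0 ?lerDl.
  by rewrite /r divfK // gt_eqF.
have inx t : cabs t <= r -> nrm (x + t *: e - x) < rho.
  by move=> /te; rewrite addrKC; lra.
have dl t (tr : cabs t <= r) := (diff_line (du _ (inx t tr))).1.
have [||k [g [dg ug g0]]] := @zero_order (fun t => u (x + t *: e)) r M rp dl.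
- by move=> t tr; exact/uM/inx.
- by move=> Z; have [t tr] := nz r rp; rewrite Z // eqxx.
have z0 : cabs (0 : K[i]) <= r by rewrite cabs0 ltW.
have [d d0 low] := zero_order_lower k (dg 0 z0) g0.
pose eps' := Num.min eps (Num.min r d) / 2.
have mn0 : 0 < Num.min eps (Num.min r d) by rewrite !lt_min eps0 rp.
have e'0 : 0 < eps' by rewrite divr_gt0.
have e'm : eps' < Num.min eps (Num.min r d) by rewrite half_lt.
move: e'm; rewrite !lt_min => /and3P[ee er ed].
pose m := eps' ^+ k * (cabs (g 0) / 2).
have m0 : 0 < m by rewrite mulr_gt0 ?exprn_gt0 ?divr_gt0 ?cabs_gt0.
have um t : cabs t = eps' -> m <= cabs (u (x + t *: e)).
  by move=> tE; rewrite ug /m -tE low // tE.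
pose L := 8 * M / rho; have L0 : 0 < L by rewrite divr_gt0 ?mulr_gt0.
have lip := lipschitz_estV r0 du uM.
have m4 : 0 < m / 4 by rewrite divr_gt0.
exists (Num.min (rho / 32) (m / 4 / L)).
  by rewrite lt_min (divr_gt0 m4 L0) divr_gt0.
move=> y; rewrite lt_min => /andP[y1 y2].
have Lm : L * nrm (y - x) <= m / 4 by rewrite mulrC -ler_pdivlMr // ltW.
have yte t : cabs t <= r -> nrm (y + t *: e - x) <= rho / 16.
  by move=> /te H; rewrite addrAC (le_trans (nrmD _ _)) //; lra.
have near t : cabs t <= r -> cabs (u (y + t *: e) - u (x + t *: e)) <= m / 4.
  move=> tr; have E : (y + t *: e) - (x + t *: e) = y - x.
    by rewrite opprD addrACA subrr addr0.
  apply: le_trans Lm; rewrite -E; apply: lip.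
    by have := yte t tr; lra.
  by rewrite addrKC; have := te t tr; lra.
apply: contrapT => nozero.
have nzt t : cabs t <= eps' -> u (y + t *: e) != 0.
  by move=> tr; apply/eqP => u0; apply: nozero; exists t => //; exact: le_lt_trans tr ee.
have := @max_principle K (fun t => (u (y + t *: e))^-1) eps' (4 / (3 * m)) e'0.
move=> /(_ _ _ 0) H.
have m34 : 0 < 3 * m / 4 by move: m0; clear; lra.
have mE : 4 / (3 * m) = (3 * m / 4)^-1 by rewrite invf_div.
have : cabs (u (y + 0 *: e))^-1 <= 4 / (3 * m).
  apply: H; last by rewrite cabs0 ltW.
    move=> t tr; have tr' : cabs t <= r by apply: le_trans tr (ltW er).
    apply: differentiableV; last exact: nzt.
    by apply: (diff_line _).1; apply: du; have := yte t tr'; lra.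
  move=> t tE; have tr' : cabs t <= r by rewrite tE ltW.
  have h1 := um t tE; have h2 := near t tr'.
  have h3 := cabs_dist (u (x + t *: e)) (u (y + t *: e)).
  rewrite [cabs (_ - u (y + _))]cabs_distC in h3.
  have U : 3 * m / 4 <= cabs (u (y + t *: e)) by lra.
  by rewrite cabsV mE lef_pV2 ?posrE // (lt_le_trans m34).
have uy : 0 < cabs (u y).
  by rewrite cabs_gt0; have := nzt 0; rewrite cabs0 scale0r addr0; apply; rewrite ltW.
rewrite scale0r addr0 cabsV mE lef_pV2 ?posrE //.
have := near 0; rewrite cabs0 !scale0r !addr0 ux0 subr0 => /(_ (ltW rp)); lra.
Qed.

(** The uniqueness half of the implicit function theorem: in a direction [v]
    transverse to it, a level set of [w] is a Lipschitz graph. Existence comes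
    from [hurwitz]. *)
Lemma level_set_lipschitz (V : normedModType K[i]) (w : V -> K[i]) x v :
  holo_near w x -> 'd w x v != 0 ->
  exists d C : K, [/\ 0 < d, 0 < C & forall p p' h t,
    nrm (p - x) < d -> nrm (p' - x) < d -> w p = w p' -> p' - p = h + t *: v ->
    cabs t <= C * nrm h].
Proof.
move=> hw wv; pose c := cabs ('d w x v); have c0 : 0 < c by rewrite cabs_gt0.
have [b b0 Hb] := nrm_diff_bound (holo_near_differentiable hw).
pose q := nrm v + 1; have q0 : 0 < q by rewrite ltr_wpDl ?nrm_ge0.
have e0 : 0 < c / 2 / q by rewrite !divr_gt0.
have [d d0 Hd] := strict_est hw e0.
exists d, ((b + c / 2 / q) / (c / 2)); split=> //.
  by rewrite divr_gt0 ?addr_gt0 // divr_gt0.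
move=> p p' h t px p'x wpp ph.
have := Hd p' p p'x px; rewrite -wpp subrr sub0r cabsN ph.
rewrite (linearD ('d w x)) linZ.
set A := 'd w x h; set B := t * _ => H.
have HB : cabs B = cabs t * c by rewrite cabsM.
have HA : cabs A <= b * nrm h := Hb h.
have := cabs_dist B (- A); rewrite opprK cabsN [B + A]addrC => H2.
have H3 : nrm (h + t *: v) <= nrm h + cabs t * q.
  by rewrite (le_trans (nrmD _ _)) // lerD2l nrmZ ler_wpM2l ?cabs_ge0 // lerDl.
have H4 : c / 2 / q * nrm (h + t *: v) <= c / 2 / q * nrm h + cabs t * (c / 2).
  apply: (le_trans (ler_wpM2l (ltW e0) H3)); apply: eq_leW; field; rewrite gt_eqF //.
rewrite mulrAC ler_pdivlMr ?divr_gt0 // mulrDl; lra.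
Qed.

Lemma transverse_nonconstant (V : normedModType K[i]) (w : V -> K[i]) x v :
  holo_near w x -> 'd w x v != 0 ->
  forall r : K, 0 < r -> exists2 t, cabs t < r & w (x + t *: v) != w x.
Proof.
move=> hw wv r r0; have [d [C [d0 C0 lip]]] := level_set_lipschitz hw wv.
have q0 : 0 < nrm v + 1 by rewrite ltr_wpDl ?nrm_ge0.
have m0 : 0 < Num.min r (d / (nrm v + 1)) by rewrite lt_min r0 divr_gt0.
have := half_lt m0; set t := _ / 2 => tm; have t0 : 0 < t by rewrite divr_gt0.
have tC : cabs t%:C = t by rewrite cabs_real gtr0_norm.
move: tm; rewrite lt_min => /andP[tr]; rewrite ltr_pdivlMr // => td.
exists t%:C; first by rewrite tC.
apply/eqP => wt; have E : x + t%:C *: v - x = 0 + t%:C *: v by rewrite addrAC subrr.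
have xx : nrm (x - x) < d by rewrite subrr nrm0.
have xt : nrm (x + t%:C *: v - x) < d.
  rewrite E add0r nrmZ tC; apply: le_lt_trans td.
  by rewrite ler_wpM2l ?lerDl // ltW.
have := lip x (x + t%:C *: v) 0 t%:C xx xt (esym wt) E.
by rewrite nrm0 mulr0 tC leNgt t0.
Qed.

End Zeros.

(** * Osgood's theorem: injective holomorphic maps have invertible differentials *)

Section Calculus.
Context {K : realType}.

Lemma diff_introL (V W : normedModType K[i]) (f : V -> W) (x : V) (L : V -> W) (c : K) :
  linear L -> (forall h, nrm (L h) <= c * nrm h) ->
  (forall e : K, 0 < e -> exists2 d : K, 0 < d & forall h, nrm h < d ->
    nrm (f (x + h) - f x - L h) <= e * nrm h) ->
  differentiable f x /\ forall h, 'd f x h = L h.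
Proof.
move=> Llin; pose Lm := GRing.isLinear.Build _ _ _ _ _ Llin.
pose L' : {linear V -> W} := HB.pack L Lm.
exact: (@diff_intro K V W f x L' c).
Qed.

Lemma diff_linear (V W : normedModType K[i]) (L : V -> W) (x : V) (c : K) :
  linear L -> (forall h, nrm (L h) <= c * nrm h) ->
  differentiable L x /\ forall h, 'd L x h = L h.
Proof.
move=> Llin Lc; apply: (diff_introL Llin Lc) => e e0; exists 1 => // h _.
have -> : x + h = 1 *: h + x by rewrite scale1r addrC.
by rewrite Llin scale1r addrK subrr nrm0 mulr_ge0 ?nrm_ge0 // ltW.
Qed.

Lemma diff_compE (U V W : normedModType K[i]) (f : U -> V) (g : V -> W) x :
  differentiable f x -> differentiable g (f x) ->
  differentiable (fun y => g (f y)) x /\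
  forall h, 'd (fun y => g (f y)) x h = 'd g (f x) ('d f x h).
Proof.
move=> df dg; split; first exact: (differentiable_comp df dg).
by move=> h; exact: (congr1 (fun L : U -> W => L h) (diff_comp df dg)).
Qed.

Lemma diff_coord (V : normedModType K[i]) n (f : V -> 'rV[K[i]]_n) x j :
  differentiable f x -> differentiable (fun y => f y 0 j) x /\
  forall h, 'd (fun y => f y 0 j) x h = 'd f x h 0 j.
Proof.
move=> df.
have Llin : linear (fun w : 'rV[K[i]]_n => w 0 j) by move=> a u v; rewrite !mxE.
have Lb (w : 'rV[K[i]]_n) : nrm (w 0 j) <= 1 * nrm w by rewrite mul1r cabs_coord_le.
have [dL EL] := diff_linear (f x) Llin Lb.
have [dc Ec] := diff_compE df dL; split; first exact: dc.
by move=> h; rewrite Ec EL.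
Qed.

Lemma holo_near_coord (V : normedModType K[i]) n (f : V -> 'rV[K[i]]_n) x j :
  holo_near f x -> holo_near (fun y => f y 0 j) x.
Proof. by move=> [d d0 df]; exists d => // y /df H; exact: (diff_coord j H).1. Qed.

Lemma differentiable_bigsum (V : normedModType K[i]) (I : Type) (s : seq I)
    (F : I -> V -> K[i]) x : (forall i, differentiable (F i) x) ->
  differentiable (fun y => \sum_(i <- s) F i y) x.
Proof.
move=> dF; elim: s => [|i s IH].
  by under eq_fun do rewrite big_nil; exact: differentiable_cst.
by under eq_fun do rewrite big_cons; apply: differentiableD.
Qed.

Lemma differentiable_bigprod (V : normedModType K[i]) (I : Type) (s : seq I)
    (F : I -> V -> K[i]) x : (forall i, differentiable (F i) x) ->
  differentiable (fun y => \prod_(i <- s) F i y) x.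
Proof.
move=> dF; elim: s => [|i s IH].
  by under eq_fun do rewrite big_nil; exact: differentiable_cst.
by under eq_fun do rewrite big_cons; apply: differentiableM.
Qed.

Definition jacobian_det n (f : 'rV[K[i]]_n -> 'rV[K[i]]_n) y : K[i] :=
  \det (\matrix_(i, j) 'd (fun z => f z 0 j) y (delta_mx 0 i)).

Lemma jacobian_det_eq0 n (f : 'rV[K[i]]_n -> 'rV[K[i]]_n) y : differentiable f y ->
  jacobian_det f y = 0 <-> exists2 e, e != 0 & 'd f y e = 0.
Proof.
move=> df; rewrite /jacobian_det; set A := \matrix_(i, j) _.
have EA e : e *m A = 'd f y e.
  apply/rowP => j; rewrite -(diff_coord j df).2 lin_row mxE.
  by apply: eq_bigr => i _; rewrite mxE.
split=> [/eqP/det0P[e e0 eA]|[e e0 de]]; first by exists e => //; rewrite -EA.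
by apply/eqP/det0P; exists e => //; rewrite EA.
Qed.

Lemma holo_near_jacobian_det n (f : 'rV[K[i]]_n -> 'rV[K[i]]_n) x :
  holo_near f x -> holo_near (jacobian_det f) x.
Proof.
move=> /holo_near_nbhd[d d0 H]; exists d => // y /H hy; rewrite /jacobian_det.
rewrite /determinant; apply: differentiable_bigsum => s; apply: differentiableM.
  exact: differentiable_cst.
apply: differentiable_bigprod => i; under eq_fun do rewrite mxE.
by apply: differentiable_diff; exact: holo_near_coord.
Qed.

(** Deduced from [differentiable_diff] by viewing [f] as a function on row vectors
    of length one. *)
Lemma differentiable_diff1 (f : K[i] -> K[i]) t : holo_near f t ->
  differentiable (fun s => 'd f s 1) t.
Proof.
move=> [d d0 df].
pose dl : 'rV[K[i]]_1 := delta_mx 0 0.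
have cE (s : K[i]) : (s *: dl) 0 0 = s by rewrite !mxE eqxx mulr1.
have clin : linear (fun y : 'rV[K[i]]_1 => y 0 0) by move=> a u v; rewrite !mxE.
have cb (y : 'rV[K[i]]_1) : nrm (y 0 0) <= 1 * nrm y by rewrite mul1r cabs_coord_le.
have dc (y : 'rV[K[i]]_1) := diff_linear y clin cb.
pose F (y : 'rV[K[i]]_1) := f (y 0 0).
have hF (y : 'rV[K[i]]_1) : nrm (y 0 0 - t) < d -> differentiable F y /\ 'd F y dl = 'd f (y 0 0) 1.
  move=> yd; have [dF EF] := diff_compE (dc y).1 (df _ yd); split=> //.
  by rewrite EF (dc y).2 mxE.
have hFt : holo_near F (t *: dl).
  exists d => // y yd; apply: (hF y _).1; apply: le_lt_trans yd.
  by have := cabs_coord_le (y - t *: dl) 0; rewrite !mxE eqxx mulr1.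
have dG := differentiable_diff dl hFt.
have sl : linear (fun s : K[i] => s *: dl).
  by move=> a u v; rewrite scalerDl scalerA.
have sb (s : K[i]) : nrm (s *: dl) <= nrm dl * nrm s by rewrite nrmZ mulrC.
have [ds _] := diff_linear t sl sb.
have [dd _] := diff_compE ds dG.
apply: (diff_near_eq d0 _ dd).1 => s sd.
by rewrite (hF _ _).2 cE.
Qed.

Lemma finite_min (I : finType) (d : I -> K) : (forall i, 0 < d i) ->
  exists2 e : K, 0 < e & forall i, e <= d i.
Proof.
move=> d0; pose S := 1 + \sum_i (d i)^-1.
have S0 : 0 < S by rewrite ltr_wpDr // sumr_ge0 // => i _; rewrite invr_ge0 ltW.
exists S^-1; first by rewrite invr_gt0.
move=> i; rewrite -[leRHS]invrK lef_pV2 ?posrE ?invr_gt0 // /S (bigD1 i) //=.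
rewrite addrCA lerDl addr_ge0 // sumr_ge0 // => j _; rewrite invr_ge0 ltW //.
Qed.

Lemma diff_subC (V : normedModType K[i]) (f : V -> K[i]) c x h : differentiable f x ->
  'd (fun y => f y - c) x h = 'd f x h.
Proof.
move=> df; have := congr1 (fun L : V -> K[i] => L h) (diffB df (differentiable_cst c x)).
move=> /= E; apply: (etrans E); rewrite -[RHS]subr0; congr (_ - _).
exact: (congr1 (fun L : V -> K[i] => L h) (diff_cst c x)).
Qed.

Lemma diff_shift (f : K[i] -> K[i]) y : differentiable f y ->
  'd (fun s => f (y + s)) 0 1 = 'd f y 1.
Proof.
move=> df; apply: (diff_intro1 _).2 => e e0; have [d d0 Hd] := diff_est df e0.
exists d => // h hd; have H := Hd h hd; rewrite add0r addr0 -(diffC _ df).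
exact: H.
Qed.

End Calculus.

Section OneVariable.
Context {K : realType}.

(** If [f] is flat at [0], then for a nearby point [y] with nonzero derivative
    the quotient of [s] by [f (y + s) - f y] is holomorphic and, by the maximum
    principle, bounded by a constant independent of [y]; letting [y] tend to
    [0] contradicts flatness. *)
Lemma injective_diff1 (f : K[i] -> K[i]) : holo_near f 0 ->
  (exists2 d : K, 0 < d & forall s t, cabs s < d -> cabs t < d -> f s = f t -> s = t) ->
  'd f 0 1 != 0.
Proof.
move=> hf [d0 d00 inj]; apply/eqP => f'0.
have [rho0 [M [r00 M0 df0 fM0]]] := holo_near_bound hf.
pose rho := Num.min d0 rho0; have r0 : 0 < rho by rewrite lt_min d00.
have injr s t : cabs s < rho -> cabs t < rho -> f s = f t -> s = t.
  by rewrite !lt_min => /andP[a _] /andP[b _]; exact: inj.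
have df t : cabs t < rho -> differentiable f t.
  by rewrite lt_min => /andP[_ H]; apply: df0; rewrite subr0.
have fM t : cabs t < rho -> cabs (f t) <= M.
  by rewrite lt_min => /andP[_ H]; apply: fM0; rewrite subr0.
have df' t : nrm (t - 0) < rho -> differentiable f t by rewrite subr0; exact: df.
have fM' t : nrm (t - 0) < rho -> cabs (f t) <= M by rewrite subr0; exact: fM.
clear inj df0 fM0; pose r := rho / 32; have rp : 0 < r by rewrite divr_gt0.
have rr : r < rho by rewrite /r; lra.
have z0 : cabs (0 : K[i]) <= r by rewrite cabs0 ltW.
have rC (s : K) : 0 < s -> cabs s%:C = s by move=> s0; rewrite cabs_real gtr0_norm.
have [|||k [g [dg fg g0]]] := @zero_order K (fun t => f t - f 0) r (2 * M) rp.
- move=> t tr; apply: differentiableB; last exact: differentiable_cst.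
  by apply: df; exact: le_lt_trans rr.
- move=> t tr; rewrite (le_trans (cabsB _ _)) // mulr2n mulrDl mul1r lerD // fM //.
    exact: le_lt_trans rr.
  by rewrite cabs0.
- have r2 : 0 < r / 2 by rewrite divr_gt0.
  have r2r : r / 2 < r by rewrite half_lt.
  move=> /(_ (r / 2)%:C); rewrite rC // => /(_ r2r) /eqP; rewrite subr_eq0 => /eqP E.
  have := injr (r / 2)%:C 0; rewrite rC // cabs0 => /(_ (lt_trans r2r rr) r0 E) Z.
  by have := rC _ r2; rewrite Z cabs0 => /eqP; rewrite lt_eqF.
have [d d0' low] := zero_order_lower k (dg 0 z0) g0.
pose eps := Num.min r d / 2.
have mn0 : 0 < Num.min r d by rewrite lt_min rp.
have eps0 : 0 < eps by rewrite divr_gt0.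
have : eps < Num.min r d by rewrite half_lt.
rewrite lt_min => /andP[er ed].
pose m := eps ^+ k * (cabs (g 0) / 2).
have m0 : 0 < m.
  by apply: mulr_gt0; [rewrite exprn_gt0 | rewrite divr_gt0 // cabs_gt0].
have fm t : cabs t = eps -> m <= cabs (f t - f 0).
  by move=> tE; rewrite fg /m -tE low // tE.
pose c := m / (8 * eps); have c0 : 0 < c by rewrite divr_gt0 // mulr_gt0.
have [d1 d10 flat] := diff_est (df 0 (le_lt_trans z0 rr)) c0.
pose s0 := Num.min (d1 / 2) eps.
have s00 : 0 < s0 by rewrite lt_min eps0 divr_gt0.
have s0e : s0 <= eps by rewrite ge_min lexx orbT.
have s0d : s0 < d1 by rewrite gt_min half_lt.
have flat0 : cabs (f s0%:C - f 0) <= c * s0.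
  have := flat s0%:C; rewrite nrm_cabs rC // => /(_ s0d).
  rewrite add0r diffC ?f'0 ?mul0r ?subr0 //.
  by apply: df; rewrite cabs0.
pose L := 8 * M / rho; have L0 : 0 < L by rewrite divr_gt0 ?mulr_gt0.
have lip := lipschitz_estV r0 df' fM'.
pose dy := Num.min (rho / 32) (Num.min (m / 4 / L) (c * s0 / 2 / L)).
have dy0 : 0 < dy.
  rewrite !lt_min; apply/and3P; split; first by rewrite divr_gt0.
    by apply: divr_gt0 L0; rewrite divr_gt0.
  by apply: divr_gt0 L0; apply: divr_gt0 => //; exact: mulr_gt0.
have [y yd y'0] : exists2 y, cabs y < dy & 'd f y 1 != 0.
  apply: contrapT => H.
  have H' y : cabs y < dy -> 'd f y 1 = 0.
    by move=> yd; apply/eqP; apply: contrapT => /negP y0; apply: H; exists y.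
  have d2 : 0 < dy / 2 by rewrite divr_gt0.
  have d2' : dy / 2 < dy by rewrite half_lt.
  have dyr : dy < rho by rewrite gt_min -/r rr.
  have E : f (0 + (dy / 2)%:C) = f 0.
    apply: constant_on_segment => s s01; rewrite add0r.
    have b0 : cabs (s%:C *: (dy / 2)%:C) < dy.
      case/andP: s01 => sge0 s1; apply: le_lt_trans d2'.
      by rewrite cabsM !cabs_real ger0_norm // (gtr0_norm d2) ler_piMl // ltW.
    have dfs := df _ (lt_trans b0 dyr).
    by split=> //; rewrite diffC // H' // mul0r.
  have := injr _ _ _ _ E; rewrite add0r rC // cabs0 => /(_ (lt_trans d2' dyr) r0) Z.
  by have := rC _ d2; rewrite Z cabs0 => /eqP; rewrite lt_eqF.
move: yd; rewrite !lt_min => /and3P[y1 y2 y3].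
have Lm : L * cabs y <= m / 4 by rewrite mulrC -ler_pdivlMr // ltW.
have Lc : L * cabs y <= c * s0 / 2 by rewrite mulrC -ler_pdivlMr // ltW.
have ylip t : cabs t <= r -> cabs (f (y + t) - f t) <= L * cabs y.
  move=> tr; have E : y = (y + t) - t by rewrite addrK.
  rewrite {2}E; apply: lip; rewrite subr0 nrm_cabs; last by move: tr; rewrite /r; lra.
  by rewrite (le_trans (cabsD _ _)) //; move: tr; rewrite /r; lra.
have yin t : cabs t <= eps -> cabs (y + t) < rho.
  move=> te; rewrite (le_lt_trans (cabsD _ _)) //; move: er; rewrite /r; lra.
have yin0 : cabs y < rho by have := yin 0; rewrite cabs0 addr0; apply; rewrite ltW.
have dyt t : cabs t <= eps -> differentiable (fun s => f (y + s) - f y) t.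
  move=> te; apply: differentiableB; last exact: differentiable_cst.
  apply: (@differentiable_comp _ _ _ _ (fun s => y + s) f); last exact/df/yin.
  by apply: differentiableD; [exact: differentiable_cst | exact: ex_diff].
have [||q [dq Eq]] := @divide_zero K (fun s => f (y + s) - f y) eps (2 * M) eps0 dyt.
- move=> t te; rewrite (le_trans (cabsB _ _)) // mulr2n mulrDl mul1r lerD // fM //.
  exact: yin.
- by rewrite addr0 subrr.
have e00 : cabs (0 : K[i]) <= eps by rewrite cabs0 ltW.
have q0 : q 0 != 0.
  have did : differentiable (fun z : K[i] => z) 0 by exact: ex_diff.
  have E1 := diffM1 did (dq 0 e00).
  have E2 : 'd (fun s : K[i] => s * q s) 0 1 = 'd (fun s => f (y + s) - f y) 0 1.
    by apply: (diff_near_eq (d := 1) _ _ (dyt 0 e00)).2 => // s _; rewrite Eq.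
  have dys : differentiable (fun s => f (y + s)) 0.
    apply: (@differentiable_comp _ _ _ _ (fun s => y + s) f); last exact/df/yin.
    by apply: differentiableD; [exact: differentiable_cst | exact: ex_diff].
  have E3 := diff_subC (f y) (1 : K[i]) dys.
  have E4 := diff_shift (df y yin0).
  apply/eqP => q0; case/negP: y'0; apply/eqP.
  apply: (etrans (esym E4)); apply: (etrans (esym E3)); apply: (etrans (esym E2)).
  have key (a b u v : K[i]) : a = 0 -> u = 0 -> a * b + u * v = 0.
    by move=> -> ->; rewrite !mul0r addr0.
  exact: (etrans E1 (key _ _ _ _ erefl q0)).
have qn t : cabs t <= eps -> q t != 0.
  move=> te; have [-> //|t0] := eqVneq t 0; apply/eqP => qt.
  have : f (y + t) - f y = 0 by rewrite Eq qt mulr0.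
  move=> /eqP; rewrite subr_eq0 => /eqP /(injr _ _ (yin t te) yin0) /eqP.
  by rewrite -subr_eq0 addrKC (negPf t0).
have qb : cabs (q s0%:C)^-1 <= (m / 2 / eps)^-1.
  have B0 : 0 < m / 2 / eps by rewrite !divr_gt0.
  apply: (@max_principle K (fun t => (q t)^-1) eps _ eps0).
  - by move=> t te; apply: differentiableV; [exact: dq | exact: qn].
  - move=> t tE; have te : cabs t <= eps by rewrite tE.
    have tr : cabs t <= r by rewrite tE ltW.
    rewrite cabsV lef_pV2 ?posrE ?cabs_gt0 ?qn // ler_pdivrMr // -tE -cabsM [q t * t]mulrC -Eq.
    have h1 := fm t tE; have h2 := ylip t tr; have h3 := ylip 0 z0.
    rewrite addr0 in h3.
    have := cabs_dist (f t - f 0) (- ((f (y + t) - f t) - (f y - f 0))).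
    have := cabsB (f (y + t) - f t) (f y - f 0).
    have -> : f t - f 0 - - (f (y + t) - f t - (f y - f 0)) = f (y + t) - f y by ring.
    rewrite cabsN; lra.
  - by rewrite rC.
have s0r : cabs s0%:C <= r by rewrite rC //; exact: le_trans s0e (ltW er).
have s0e' : cabs s0%:C <= eps by rewrite rC.
have h1 : m / 2 / eps * s0 <= cabs (f (y + s0%:C) - f y).
  rewrite Eq cabsM rC // mulrC ler_pM2l //.
  by move: qb; rewrite cabsV lef_pV2 ?posrE ?cabs_gt0 ?qn // !divr_gt0.
have h2 := ylip _ s0r; have h3 := ylip 0 z0; rewrite addr0 in h3.
have E : f (y + s0%:C) - f y =
  (f (y + s0%:C) - f s0%:C) - (f y - f 0) + (f s0%:C - f 0) by ring.
have := cabsD ((f (y + s0%:C) - f s0%:C) - (f y - f 0)) (f s0%:C - f 0).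
have := cabsB (f (y + s0%:C) - f s0%:C) (f y - f 0).
rewrite -E => h4 h5.
have cE : m / 2 / eps * s0 = 4 * (c * s0) by rewrite /c; field; rewrite gt_eqF.
have cs0 : 0 < c * s0 by rewrite mulr_gt0.
move: h1 h2 h3 h4 h5 flat0 Lc; rewrite cE; clear -cs0; lra.
Qed.

End OneVariable.

Section Transversal.
Context {K : realType}.
Implicit Types (n : nat).

Definition vanishes_near n (Z : set 'rV[K[i]]_n) (w : 'rV[K[i]]_n -> K[i]) x :=
  exists2 d : K, 0 < d & forall y, nrm (y - x) < d -> Z y -> w y = 0.

Lemma vanishes_near_nbhd n (Z : set 'rV[K[i]]_n) w x : vanishes_near Z w x ->
  exists2 d : K, 0 < d & forall y, nrm (y - x) < d -> vanishes_near Z w y.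
Proof.
move=> [d d0 wZ]; exists d => // y yx; exists (d - nrm (y - x)); first by rewrite subr_gt0.
move=> z; rewrite ltrBrDr => zy; apply: wZ; apply: le_lt_trans zy.
by rewrite -(subrKA y) nrmD.
Qed.

(** If every function vanishing on [Z] also had all its first derivatives
    vanishing on [Z], then by iteration such functions would vanish to infinite
    order. *)
Lemma transversal_function n (Z : set 'rV[K[i]]_n) q w0 (rho : K) :
  0 < rho -> Z q -> holo_near w0 q -> vanishes_near Z w0 q ->
  (forall d : K, 0 < d -> exists2 y, nrm (y - q) < d & w0 y != 0) ->
  exists x w e, [/\ Z x, nrm (x - q) < rho, holo_near w x, vanishes_near Z w x &
    'd w x e != 0].
Proof.
move=> rho0 Zq hw0 van0 nz0; apply: contrapT => NB.
have flat x w e : Z x -> nrm (x - q) < rho -> holo_near w x -> vanishes_near Z w x ->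
    'd w x e = 0.
  move=> Zx xq hw vw; apply/eqP; apply: contrapT => /negP H.
  by apply: NB; exists x, w, e.
(* on a line through [q] no function vanishing on [Z] has a zero of finite
   order [k] at [q], because its derivative along the line vanishes on [Z] too *)
have claim e k : forall w, holo_near w q -> vanishes_near Z w q -> forall (r : K) psi,
    0 < r -> (forall t, cabs t < r -> differentiable psi t) ->
    (forall t, cabs t < r -> w (q + t *: e) = t ^+ k * psi t) -> psi 0 != 0 -> False.
  elim: k => [|k IH] w hw vw r psi r0 dpsi wE /eqP; apply.
    have := wE 0; rewrite cabs0 scale0r addr0 expr0 mul1r => <- //.
    by have [d d0] := vw; apply=> //; rewrite subrr nrm0.
  apply: contrapT => psi0.
  have [d1 d10 hn] := holo_near_nbhd hw.
  have [d2 d20 vn] := vanishes_near_nbhd vw.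
  have c0 : cabs (0 : K[i]) < r by rewrite cabs0.
  pose psi1 t := k.+1%:R * psi t + t * 'd psi t 1.
  pose r1 := Num.min r (d1 / (nrm e + 1)).
  have q0 : 0 < nrm e + 1 by rewrite ltr_wpDl ?nrm_ge0.
  have r10 : 0 < r1 by rewrite lt_min r0 divr_gt0.
  apply: (IH (fun y => 'd w y e) (holo_near_diff e hw) _ r1 psi1 r10).
  - exists (Num.min rho (Num.min d1 d2)); first by rewrite !lt_min rho0 d10.
    move=> y; rewrite !lt_min => /and3P[y1 y2 y3] Zy.
    exact: (flat y w e Zy y1 (hn y y2) (vn y y3)).
  - move=> t; rewrite lt_min => /andP[tr _]; apply: differentiableD.
      by apply: differentiableM; [exact: differentiable_cst | exact: dpsi].
    apply: differentiableM; first exact: ex_diff.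
    apply: differentiable_diff1; exists (r - cabs t); first by rewrite subr_gt0.
    move=> s; rewrite nrm_cabs ltrBrDr => st; apply: dpsi; apply: le_lt_trans st.
    by have := cabsD (s - t) t; rewrite subrK.
  - move=> t; rewrite lt_min => /andP[tr]; rewrite ltr_pdivlMr // => td.
    have tin : nrm (q + t *: e - q) < d1.
      rewrite addrKC nrmZ; apply: le_lt_trans td.
      by rewrite ler_wpM2l ?cabs_ge0 // lerDl.
    have dwt := holo_near_differentiable (hn _ tin).
    have [dl El] := diff_line dwt.
    have rt : 0 < r - cabs t by rewrite subr_gt0.
    have dX : differentiable (fun s : K[i] => s ^+ k.+1) t.
      by apply: differentiable_pow; exact: ex_diff.
    have E := (diff_near_eq (g := fun s : K[i] => s ^+ k.+1 * psi s) rt _ dl).2.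
    have E1 := diffM1 dX (dpsi t tr).
    have E2 := diffX1 k t.
    apply: (etrans (esym El)); apply: (etrans (esym (E _ 1))).
      move=> s; rewrite nrm_cabs ltrBrDr => st; apply: wE; apply: le_lt_trans st.
      by have := cabsD (s - t) t; rewrite subrK.
    apply: (etrans E1).
    have key (a b c d : K[i]) : d = c -> a * b + psi t * d = a * b + psi t * c.
      by move=> ->.
    apply: (etrans (key _ _ _ _ E2)).
    by rewrite /psi1 exprS; ring.
  - rewrite /psi1 mul0r addr0 mulf_neq0 ?pnatr_eq0 //.
    by apply/eqP.
have [rho1 [M [r10 M0 dw wM]]] := holo_near_bound hw0.
have [y yq wy] := nz0 (rho1 / 4) (divr_gt0 r10 (ltr0n _ 4)).
pose e := y - q.
have tin t : cabs t <= 2 -> nrm (q + t *: e - q) < rho1.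
  move=> t2; rewrite addrKC nrmZ.
  have := ler_wpM2r (nrm_ge0 e) t2; rewrite -/e in yq; lra.
have [||k [g [dg wg g0]]] := @zero_order K (fun t => w0 (q + t *: e)) 2 M (ltr0n _ 2)
  (fun t t2 => (diff_line (dw _ (tin t t2))).1).
- by move=> t /tin /wM.
- move=> /(_ 1); rewrite cabs1 scale1r subrKC ltr1n => /(_ isT) E.
  by rewrite E eqxx in wy.
apply: (claim e k w0 hw0 van0 2 g) => // t t2; first exact/dg/ltW.
Qed.

(** On each line of direction [e] that is close to the one through [x], Hurwitz
    yields a zero of [J]. Over the segment of direction [v] these zeros form the
    graph of a function [tau], which is Lipschitz because [w] vanishes at them;
    the differential of [f] vanishes along the graph, so [f] is constant on it. *)
Lemma flat_curve n m (f : 'rV[K[i]]_n -> 'rV[K[i]]_m)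
    (J w : 'rV[K[i]]_n -> K[i]) (x e v : 'rV[K[i]]_n) :
  holo_near J x -> J x = 0 -> holo_near w x -> 'd w x e != 0 -> holo_near f x ->
  (exists2 d : K, 0 < d & forall y, nrm (y - x) < d -> J y = 0 ->
     w y = 0 /\ forall u, 'd f y u = 0) ->
  forall d : K, 0 < d -> exists s t, [/\ s != 0, nrm (s *: v + t *: e) < d &
    f (x + (s *: v + t *: e)) = f x].
Proof.
move=> hJ Jx hw we hf [d1 d10 HJ] d d0.
have [d2 [C [d20 C0 lip]]] := level_set_lipschitz hw we.
have [d3 d30 df] := hf.
pose D := Num.min (Num.min d d1) (Num.min d2 d3).
have D0 : 0 < D by rewrite !lt_min d0 d10 d20.
pose q := nrm e + 1; have q0 : 0 < q by rewrite ltr_wpDl ?nrm_ge0.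
pose q' := nrm v + 1; have q'0 : 0 < q' by rewrite ltr_wpDl ?nrm_ge0.
pose eps := D / 2 / q; have eps0 : 0 < eps by rewrite !divr_gt0.
have inD t : cabs t < eps -> nrm (t *: e) < D / 2.
  move=> te; rewrite nrmZ; apply: (@le_lt_trans _ _ (cabs t * q)).
    by rewrite ler_wpM2l ?cabs_ge0 // lerDl.
  by rewrite -ltr_pdivlMr.
have wx : w x = 0 by apply: (HJ x _ Jx).1; rewrite subrr nrm0.
have nzJ r : 0 < r -> exists2 t, cabs t < r & J (x + t *: e) != 0.
  move=> r0; have [|t] := transverse_nonconstant hw we (r := Num.min r eps).
    by rewrite lt_min r0.
  rewrite lt_min wx => /andP[tr te] wt; exists t => //.
  have x1 : nrm (x + t *: e - x) < d1.
    have : nrm (x + t *: e - x) < D by have := inD t te; rewrite addrKC; lra.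
    by rewrite !lt_min => /andP[/andP[]].
  by apply: contraNneq wt => /(HJ _ x1)[-> _].
have [d4 d40 hur] := hurwitz hJ Jx nzJ eps0.
pose s0 := Num.min (d4 / 2) (D / 2) / q'.
have s00 : 0 < s0 by rewrite divr_gt0 // lt_min !divr_gt0.
have s0q (s : K) : 0 <= s <= 1 -> nrm ((s0 * s)%:C *: v) <= Num.min (d4 / 2) (D / 2).
  move=> /andP[s1 s2]; have F0 : 0 <= s0 * s by rewrite mulr_ge0 // ltW.
  have F1 : s0 * s <= s0 by rewrite ler_piMr // ltW.
  have F2 : nrm v <= q' by rewrite lerDl.
  have F3 : Num.min (d4 / 2) (D / 2) = s0 * q' by rewrite divfK // gt_eqF.
  by rewrite F3 nrmZ cabs_real ger0_norm //; exact: ler_pM F0 (nrm_ge0 v) F1 F2.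
have s0v (s : K) : 0 <= s <= 1 -> nrm ((s0 * s)%:C *: v) < d4.
  move=> /s0q; rewrite le_min => /andP[h _]; lra.
have s0v2 (s : K) : 0 <= s <= 1 -> nrm ((s0 * s)%:C *: v) <= D / 2.
  by move=> /s0q; rewrite le_min => /andP[].
have /choice[tau Htau] (s : K) : exists t, 0 <= s <= 1 ->
    cabs t < eps /\ J (x + (s0 * s)%:C *: v + t *: e) = 0.
  have [s01|] := boolP (0 <= s <= 1); last by exists 0.
  have [|t te Jt] := hur (x + (s0 * s)%:C *: v).
    by rewrite addrKC; exact: s0v.
  by exists t.
pose p s := x + (s0 * s)%:C *: v + tau s *: e.
have pD s : 0 <= s <= 1 -> nrm (p s - x) < D.
  move=> s01; have -> : p s - x = (s0 * s)%:C *: v + tau s *: e.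
    by rewrite /p -[x + _ + _]addrA [x + _]addrC addrK.
  have := inD _ (Htau s s01).1; have := s0v2 s s01.
  by have := nrmD ((s0 * s)%:C *: v) (tau s *: e); lra.
have p1 s (s01 : 0 <= s <= 1) : nrm (p s - x) < d1.
  by have := pD s s01; rewrite !lt_min => /andP[/andP[]].
have p2 s (s01 : 0 <= s <= 1) : nrm (p s - x) < d2.
  by have := pD s s01; rewrite !lt_min => /andP[_ /andP[]].
have p3 s (s01 : 0 <= s <= 1) : nrm (p s - x) < d3.
  by have := pD s s01; rewrite !lt_min => /andP[_ /andP[]].
have flat s (s01 : 0 <= s <= 1) := HJ _ (p1 s s01) (Htau s s01).2.
have pB s s' : p s' - p s = (s0 * (s' - s))%:C *: v + (tau s' - tau s) *: e.
  have key (a a' b b' : 'rV[K[i]]_n) : x + a' + b' - (x + a + b) = (a' - a) + (b' - b).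
    by rewrite -[x + a' + b']addrA -[x + a + b]addrA opprD addrACA subrr add0r opprD addrACA.
  by rewrite /p key mulrBr rmorphB !scalerBl.
have tauL s s' : 0 <= s <= 1 -> 0 <= s' <= 1 ->
    cabs (tau s' - tau s) <= C * nrm ((s0 * (s' - s))%:C *: v).
  move=> s1 s2; apply: (lip (p s) (p s')) => //; try exact: p2.
  by rewrite (flat s s1).1 (flat s' s2).1.
pose B := s0 * nrm v * (1 + C * nrm e) + 1.
have B0 : 0 < B.
  have B1 := mulr_ge0 (mulr_ge0 (ltW s00) (nrm_ge0 v))
    (addr_ge0 ler01 (mulr_ge0 (ltW C0) (nrm_ge0 e))).
  by apply: (le_lt_trans B1); rewrite ltrDl ltr01.
have pL s s' : 0 <= s <= 1 -> 0 <= s' <= 1 -> nrm (p s' - p s) <= B * `|s' - s|.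
  move=> s1 s2; rewrite pB (le_trans (nrmD _ _)) // !nrmZ.
  have := ler_wpM2r (nrm_ge0 e) (tauL s s' s1 s2).
  rewrite nrmZ cabs_real normrM (gtr0_norm s00) => H.
  apply: (@le_trans _ _ (s0 * `|s' - s| * nrm v + C * (s0 * `|s' - s| * nrm v) * nrm e)).
    by rewrite lerD2l.
  rewrite /B mulrDl mul1r -[leLHS]addr0 lerD //.
  by apply: eq_leW; ring.
have i0 : 0 <= (0 : K) <= 1 by rewrite lexx ler01.
have i1 : 0 <= (1 : K) <= 1 by rewrite lexx ler01.
have fE : f (p 1) = f (p 0).
  apply/rowP => j.
  apply: (@constant_of_zero_speed K (fun s => f (p s) 0 j)) => s e' s01 e'0.
  have dfp := df _ (p3 s s01).
  have [d5 d50 Hd] := diff_est dfp (divr_gt0 e'0 B0).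
  exists (d5 / B); first by rewrite divr_gt0.
  move=> s' s'01; rewrite ltr_pdivlMr // mulrC => ss.
  have pl := pL s s' s01 s'01.
  have := Hd (p s' - p s) (le_lt_trans pl ss).
  rewrite subrKC (flat s s01).2 subr0 => H.
  have := cabs_coord_le (f (p s') - f (p s)) j; rewrite !mxE => /le_trans; apply.
  apply: (le_trans H); rewrite mulrAC ler_pdivrMr //.
  by rewrite -mulrA ler_pM2l // mulrC.
have tau0 : tau 0 = 0.
  have xx : nrm (x - x) < d2 by rewrite subrr nrm0.
  have E : p 0 - x = 0 + tau 0 *: e.
    by rewrite /p mulr0 scale0r addr0 addrAC subrr.
  have := lip x (p 0) 0 (tau 0) xx (p2 0 i0) (etrans wx (esym (flat 0 i0).1)) E.
  rewrite nrm0 mulr0 => H.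
  by apply/eqP; rewrite -cabs_eq0 eq_le cabs_ge0 andbT.
have p0 : p 0 = x by rewrite /p mulr0 scale0r addr0 tau0 scale0r addr0.
have E1 : x + ((s0 * 1)%:C *: v + tau 1 *: e) = p 1 by rewrite addrA.
exists (s0 * 1)%:C, (tau 1); split.
- by rewrite mulr1 -cabs_gt0 cabs_real gtr0_norm.
- have := pD 1 i1; rewrite -E1 addrKC !lt_min.
  by move=> /andP[/andP[]].
- by rewrite E1 fE p0.
Qed.

End Transversal.

Section Osgood.
Context {K : realType}.
Implicit Types (n : nat).

Definition injective_near n (f : 'rV[K[i]]_n -> 'rV[K[i]]_n) x :=
  exists2 d : K, 0 < d & forall y z, nrm (y - x) < d -> nrm (z - x) < d ->
    f y = f z -> y = z.

(** Inclusion of a coordinate hyperplane. *)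
Definition insert0 n (j : 'I_n.+1) (y : 'rV[K[i]]_n) : 'rV[K[i]]_n.+1 :=
  \row_l oapp (y 0) 0 (unlift j l).

Lemma insert0_linear n (j : 'I_n.+1) : linear (insert0 j).
Proof.
move=> a u v; apply/rowP => l; rewrite !mxE.
by case: unliftP => [k _|_] /=; rewrite ?mxE // mulr0 addr0.
Qed.

Lemma insert0B n (j : 'I_n.+1) u v : insert0 j (u - v) = insert0 j u - insert0 j v.
Proof.
by rewrite -scaleN1r addrC insert0_linear scaleN1r addrC.
Qed.

Lemma nrm_insert0 n (j : 'I_n.+1) y : nrm (insert0 j y) <= 1 * nrm y.
Proof.
rewrite mul1r; apply: nrm_row_le => [|l]; first exact: nrm_ge0.
rewrite mxE; case: unliftP => [k _|_] /=; first exact: cabs_coord_le.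
by rewrite cabs0 nrm_ge0.
Qed.

Lemma insert0_col' n (j : 'I_n.+1) (e : 'rV[K[i]]_n.+1) :
  e = insert0 j (col' j e) + e 0 j *: delta_mx 0 j.
Proof.
apply/rowP => l; rewrite !mxE; case: unliftP => [k ->|->] /=.
  by rewrite mxE [lift j k == j]eq_sym (negPf (neq_lift _ _)) ?andbF mulr0 addr0.
by rewrite add0r !eqxx mulr1.
Qed.

Lemma nrm_col' n (j : 'I_n.+1) (w : 'rV[K[i]]_n.+1) : nrm (col' j w) <= 1 * nrm w.
Proof.
rewrite mul1r; apply: nrm_row_le => [|k]; first exact: nrm_ge0.
by rewrite mxE cabs_coord_le.
Qed.

Lemma col'_linear n (j : 'I_n.+1) : linear (@col' K[i] 1 n.+1 j).
Proof. by move=> a u v; apply/rowP => k; rewrite !mxE. Qed.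

Lemma neq0_of_close (a b : K[i]) : cabs (a - b) < cabs b -> a != 0.
Proof. by move=> ab; apply: contraTneq ab => ->; rewrite sub0r cabsN ltxx. Qed.

(** Where the differential of [f] is not zero, one component of [f] can be used
    as a coordinate: on its level hypersurface, a graph, the remaining
    components define an injective holomorphic map in one variable less. *)
Lemma osgood_step n :
  (forall (h : 'rV[K[i]]_n -> 'rV[K[i]]_n) x, holo_near h x -> injective_near h x ->
    forall e, 'd h x e = 0 -> e = 0) ->
  forall (f : 'rV[K[i]]_n.+1 -> 'rV[K[i]]_n.+1) q, holo_near f q -> injective_near f q ->
    (exists u, 'd f q u != 0) -> forall e, 'd f q e = 0 -> e = 0.
Proof.
move=> IH f q hf [d1 d10 inj] [u0 fu0] e fe.
have dfq := holo_near_differentiable hf.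
have [i0 fi] : exists i, 'd f q u0 0 i != 0.
  apply: contrapT => H; case/negP: fu0; apply/eqP/rowP => i; rewrite mxE.
  by apply/eqP; apply: contrapT => /negP Hi; apply: H; exists i.
pose w z := f z 0 i0.
have hw : holo_near w q := holo_near_coord i0 hf.
have wd z (dz : differentiable f z) h : 'd w z h = 'd f z h 0 i0 := (diff_coord i0 dz).2 h.
have [j wj] : exists j, 'd w q (delta_mx 0 j) != 0.
  apply: contrapT => H; case/negP: fi; rewrite -wd // lin_row; apply/eqP.
  apply: big1 => j _; have -> : 'd w q (delta_mx 0 j) = 0; last by rewrite mulr0.
  by apply/eqP; apply: contrapT => /negP Hj; apply: H; exists j.
pose v : 'rV[K[i]]_n.+1 := delta_mx 0 j.
have [d2 [C [d20 C0 lip]]] := level_set_lipschitz hw wj.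
have [d3 d30 df] := hf.
have dwv := differentiable_diff v hw.
have wvp : 0 < cabs ('d w q v) by rewrite cabs_gt0.
have [d4 d40 wvc] := continuous_est (differentiable_continuous dwv) wvp.
have [d5 d50 dw] := hw.
pose D := Num.min (Num.min d1 d2) (Num.min d3 (Num.min d4 d5)).
have D0 : 0 < D by rewrite !lt_min d10 d20 d30 d40.
have wv0 p : nrm (p - q) < d4 -> 'd w p v != 0.
  by move=> /wvc; exact: neq0_of_close.
pose qv := nrm v + 1; have qv0 : 0 < qv by rewrite ltr_wpDl ?nrm_ge0.
pose eps := D / 2 / qv; have eps0 : 0 < eps by rewrite !divr_gt0.
have inD t : cabs t < eps -> nrm (t *: v) < D / 2.
  move=> te; rewrite nrmZ; apply: (@le_lt_trans _ _ (cabs t * qv)).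
    by rewrite ler_wpM2l ?cabs_ge0 // lerDl.
  by rewrite -ltr_pdivlMr.
have hu : holo_near (fun z => w z - w q) q.
  by exists d5 => [|y yq]; [exact: d50
    | exact: (differentiableB (dw y yq) (differentiable_cst (w q) y))].
have nzu r : 0 < r -> exists2 t, cabs t < r & w (q + t *: v) - w q != 0.
  by move=> /(transverse_nonconstant hw wj)[t tr wt]; exists t; rewrite ?subr_eq0.
have [d6 d60 hur] := hurwitz hu (subrr (w q)) nzu eps0.
pose dl := Num.min d6 (D / 2); have dl0 : 0 < dl by rewrite lt_min d60 divr_gt0.
(* the graph of [phi] is the level set of [w] through [q] *)
have /choice[phi Hphi] (y : 'rV[K[i]]_n) : exists t, nrm y < dl ->
    cabs t < eps /\ w (q + insert0 j y + t *: v) = w q.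
  have [ydl|] := boolP (nrm y < dl); last by exists 0.
  have [|t te wt] := hur (q + insert0 j y).
    rewrite addrKC (le_lt_trans (nrm_insert0 j y)) // mul1r.
    by move: ydl; rewrite lt_min => /andP[].
  by exists t => _; split=> //; apply/eqP; rewrite -subr_eq0 wt.
pose p y := q + insert0 j y + phi y *: v.
have pD y : nrm y < dl -> nrm (p y - q) < D.
  move=> ydl; rewrite /p -[q + _ + _]addrA [q + _]addrC addrK.
  have := inD _ (Hphi y ydl).1; have := nrmD (insert0 j y) (phi y *: v).
  have := nrm_insert0 j y; move: ydl; rewrite lt_min mul1r => /andP[_]; lra.
have pd y : nrm y < dl -> [/\ nrm (p y - q) < d1, nrm (p y - q) < d2,
    nrm (p y - q) < d3, nrm (p y - q) < d4 & nrm (p y - q) < d5].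
  by move=> /pD; rewrite !lt_min => /andP[/andP[a b] /andP[c /andP[d g]]].
have wp y : nrm y < dl -> w (p y) = w q by move=> /Hphi[].
have pB y z : p z - p y = insert0 j (z - y) + (phi z - phi y) *: v.
  have key (a a' b b' : 'rV[K[i]]_n.+1) : q + a' + b' - (q + a + b) = (a' - a) + (b' - b).
    by rewrite -[q + a' + b']addrA -[q + a + b]addrA opprD addrACA subrr add0r opprD addrACA.
  by rewrite /p key insert0B scalerBl.
have phiL y z : nrm y < dl -> nrm z < dl -> cabs (phi z - phi y) <= C * nrm (z - y).
  move=> yd zd; have [_ p2 _ _ _] := pd y yd; have [_ p2' _ _ _] := pd z zd.
  apply: (le_trans (lip _ _ _ _ p2 p2' (etrans (wp y yd) (esym (wp z zd))) (pB y z))).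
  by rewrite ler_wpM2l ?(ltW C0) // -[nrm (z - y)]mul1r nrm_insert0.
have z0 : nrm (0 : 'rV[K[i]]_n) < dl by rewrite nrm0.
have i00 : insert0 j 0 = 0 :> 'rV[K[i]]_n.+1.
  by rewrite -(subrr (0 : 'rV[K[i]]_n)) insert0B subrr.
have phi0 : phi 0 = 0.
  have xx : nrm (q - q) < d2 by rewrite subrr nrm0.
  have [_ p2 _ _ _] := pd 0 z0.
  have E : p 0 - q = 0 + phi 0 *: v by rewrite /p i00 addr0 addrAC subrr.
  have := lip q (p 0) 0 (phi 0) xx p2 (esym (wp 0 z0)) E.
  by rewrite nrm0 mulr0 => H; apply/eqP; rewrite -cabs_eq0 eq_le cabs_ge0 andbT.
have p0 : p 0 = q by rewrite /p i00 phi0 scale0r !addr0.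
have [B [B0 BE]] : exists B : K, 0 < B /\ B = 1 + C * qv.
  by exists (1 + C * qv); split=> //; rewrite addr_gt0 // mulr_gt0.
pose L y k := - 'd w (p y) (insert0 j k) / 'd w (p y) v.
have dphi y : nrm y < dl -> differentiable phi y /\ forall k, 'd phi y k = L y k.
  move=> yd; have [_ _ _ p4 p5] := pd y yd.
  have dwp := dw _ p5; have c0 := wv0 _ p4.
  have [b b0 Hb] := nrm_diff_bound dwp.
  apply: (@diff_introL K _ _ phi y (L y) (b / cabs ('d w (p y) v))).
  - move=> a k k'; rewrite /L insert0_linear (linearD ('d w (p y))) linZ.
    by rewrite -[_ *: _]/(a * _); ring.
  - move=> k; rewrite nrm_cabs /L cabsM cabsN cabsV mulrAC ler_pM2r ?invr_gt0 ?cabs_gt0 //.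
    apply: (le_trans (Hb _)); rewrite ler_pM2l // -[nrm k]mul1r; exact: nrm_insert0.
  move=> e' e'0; have e''0 : 0 < e' * cabs ('d w (p y) v) / B.
    by apply: divr_gt0 B0; apply: mulr_gt0 e'0 _; rewrite cabs_gt0.
  have [d7 d70 Hd] := diff_est dwp e''0.
  exists (Num.min (dl - nrm y) (d7 / B)); first by rewrite lt_min subr_gt0 yd divr_gt0.
  move=> k; rewrite lt_min => /andP[k1 k2].
  have ykd : nrm (y + k) < dl by rewrite (le_lt_trans (nrmD _ _)) // -ltrBrDl.
  have kE : y + k - y = k by rewrite addrKC.
  have H1 := phiL y (y + k) yd ykd; rewrite kE in H1.
  have H2 := pB y (y + k); rewrite kE in H2.
  have nB : nrm (p (y + k) - p y) <= B * nrm k.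
    rewrite H2 (le_trans (nrmD _ _)) // nrmZ BE mulrDl mul1r lerD //.
      by rewrite -[leRHS]mul1r nrm_insert0.
    rewrite [C * qv * _]mulrAC; apply: ler_pM; rewrite ?cabs_ge0 ?nrm_ge0 //.
    by rewrite lerDl.
  have := Hd (p (y + k) - p y); rewrite (le_lt_trans nB) => [/(_ isT)|]; last first.
    by rewrite mulrC -ltr_pdivlMr.
  rewrite subrKC (wp _ ykd) (wp _ yd) subrr sub0r nrm_cabs cabsN H2.
  rewrite (linearD ('d w (p y))) linZ => H3.
  have -> : phi (y + k) - phi y - L y k =
      ('d w (p y) (insert0 j k) + (phi (y + k) - phi y) * 'd w (p y) v) / 'd w (p y) v.
    rewrite /L; move: ('d w (p y) v) ('d w (p y) _) c0 => c0 c1 c0n.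
    by field.
  rewrite nrm_cabs cabsM cabsV ler_pdivrMr ?cabs_gt0 //; apply: (le_trans H3).
  rewrite -H2; apply: (@le_trans _ _ (e' * cabs ('d w (p y) v) / B * (B * nrm k))).
    by rewrite ler_wpM2l // ltW.
  apply: eq_leW; field; rewrite gt_eqF //.
have di y := diff_linear y (@insert0_linear n j) (@nrm_insert0 n j).
have dp y : nrm y < dl -> differentiable p y /\
    forall k, 'd p y k = insert0 j k + L y k *: v.
  move=> yd; have [dph Eph] := dphi y yd.
  have [bp bp0 Hbp] := nrm_diff_bound dph.
  apply: (@diff_introL K _ _ p y _ (1 + bp * nrm v)).
  - move=> a k k'; rewrite insert0_linear -!Eph linearD linZ.
    by rewrite scalerDl scalerDr -scalerA addrACA.
  - move=> k; rewrite -Eph (le_trans (nrmD _ _)) // mulrDl lerD ?nrm_insert0 //.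
    by rewrite nrmZ [bp * _ * _]mulrAC; apply: ler_wpM2r (nrm_ge0 v) _ _ (Hbp k).
  move=> e' e'0; have e''0 : 0 < e' / qv by rewrite divr_gt0.
  have [d7 d70 Hd] := diff_est dph e''0.
  exists d7 => // k kd; have kE : y + k - y = k by rewrite addrKC.
  have := pB y (y + k); rewrite kE => ->.
  rewrite addrAC opprD addrA subrr add0r addrC -scalerBl nrmZ -Eph.
  have := Hd k kd; rewrite nrm_cabs => H.
  apply: (@le_trans _ _ (e' / qv * nrm k * qv)); last first.
    by apply: eq_leW; field; rewrite gt_eqF.
  by apply: ler_pM; rewrite ?cabs_ge0 ?nrm_ge0 ?lerDl.
have dc x := diff_linear x (@col'_linear n i0) (@nrm_col' n i0).
pose h y := col' i0 (f (p y)).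
have dh y : nrm y < dl -> differentiable h y /\
    forall k, 'd h y k = col' i0 ('d f (p y) (insert0 j k + L y k *: v)).
  move=> yd; have [dpy Ep] := dp y yd; have [_ _ p3 _ _] := pd y yd.
  have [dfp Efp] := diff_compE dpy (df _ p3).
  have [dcc Ec] := diff_compE dfp (dc (f (p y))).1.
  by split=> [|k]; [exact: dcc | rewrite Ec (dc _).2 Efp Ep].
have hh : holo_near h 0.
  by exists dl => // y; rewrite subr0 => /dh[].
have hinj : injective_near h 0.
  exists dl => // y z; rewrite !subr0 => yd zd hyz.
  have [p1 _ _ _ _] := pd y yd; have [p1' _ _ _ _] := pd z zd.
  have fyz : f (p y) = f (p z).
    rewrite [LHS](insert0_col' i0) [RHS](insert0_col' i0) -/(h y) -/(h z) hyz.
    by rewrite (etrans (wp y yd) (esym (wp z zd)) : f (p y) 0 i0 = f (p z) 0 i0).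
  have pyz := inj _ _ p1 p1' fyz; apply/rowP => k.
  have := congr1 (fun x : 'rV[K[i]]_n.+1 => x 0 (lift j k)) pyz.
  rewrite /p !mxE !liftK /= [lift j k == j]eq_sym (negPf (neq_lift _ _)) ?andbF !mulr0 !addr0.
  by move/addrI.
have eE := insert0_col' j e; rewrite -/v in eE.
have cq : 'd w q v != 0 by rewrite -cabs_gt0.
have ej : e 0 j = L 0 (col' j e).
  have : 'd w q e = 0 by rewrite wd // fe mxE.
  rewrite /L p0 {1}eE (linearD ('d w q)) linZ => /eqP.
  rewrite addr_eq0 => /eqP ->.
  by move: (e 0 j) ('d w q v) cq => a b b0; field.
have k0 : col' j e = 0.
  apply: (IH h 0 hh hinj); have [_ ->] := dh 0 z0.
  by rewrite p0 -ej -eE fe; apply/rowP => k; rewrite !mxE.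
have := ej; rewrite k0 /L i00 linear0 oppr0 mul0r => e0.
by rewrite eE k0 i00 e0 scale0r addr0.
Qed.

End Osgood.

Section OsgoodTheorem.
Context {K : realType}.
Implicit Types (n : nat).

Lemma delta_neq0 n (i : 'I_n) : delta_mx 0 i != 0 :> 'rV[K[i]]_n.
Proof.
apply/eqP => /(congr1 (fun x : 'rV[K[i]]_n => x 0 i)) /eqP.
by rewrite !mxE !eqxx oner_eq0.
Qed.

Lemma injective_near_nbhd n (f : 'rV[K[i]]_n -> 'rV[K[i]]_n) x : injective_near f x ->
  exists2 d : K, 0 < d & forall y, nrm (y - x) < d -> injective_near f y.
Proof.
move=> [d d0 inj]; exists d => [//|y yx]; exists (d - nrm (y - x)); first by rewrite subr_gt0.
have sub z : nrm (z - y) < d - nrm (y - x) -> nrm (z - x) < d.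
  by rewrite ltrBrDr; apply: le_lt_trans; rewrite -(subrKA y) nrmD.
by move=> z z' /sub zx /sub z'x; exact: inj.
Qed.

(** Otherwise the differential of [f] would vanish near [q] and [f] would be
    constant there. *)
Lemma entry_not_locally0 n (f : 'rV[K[i]]_n.+1 -> 'rV[K[i]]_n.+1) q :
  holo_near f q -> injective_near f q ->
  exists i j, forall d : K, 0 < d -> exists2 y, nrm (y - q) < d &
    'd (fun z => f z 0 j) y (delta_mx 0 i) != 0.
Proof.
move=> [d1 d10 df] [d2 d20 inj]; apply: contrapT => H.
have /choice[d Hd] (ij : 'I_n.+1 * 'I_n.+1) : exists d : K, 0 < d /\
    forall y, nrm (y - q) < d -> 'd (fun z => f z 0 ij.2) y (delta_mx 0 ij.1) = 0.
  apply: contrapT => N; apply: H; exists ij.1, ij.2 => d d0.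
  apply: contrapT => N'; apply: N; exists d; split=> // y yq.
  by apply/eqP; apply: contrapT => /negP y0; apply: N'; exists y.
have [e e0 ed] := finite_min (fun ij => (Hd ij).1).
pose r := Num.min e (Num.min d1 d2) / 2.
have m0 : 0 < Num.min e (Num.min d1 d2) by rewrite !lt_min e0 d10.
have r0 : 0 < r by rewrite divr_gt0.
have : r < Num.min e (Num.min d1 d2) by rewrite half_lt.
rewrite !lt_min => /and3P[re r1 r2].
pose dl : 'rV[K[i]]_n.+1 := delta_mx 0 0.
have flat y h : nrm (y - q) <= r -> 'd f y h = 0.
  move=> yr; apply/rowP => j.
  have dfy : differentiable f y by apply: df; exact: le_lt_trans r1.
  rewrite -(diff_coord j dfy).2 lin_row mxE; apply: big1 => i _.
  have -> : 'd (fun z => f z 0 j) y (delta_mx 0 i) = 0; last by rewrite mulr0.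
  by apply: (Hd (i, j)).2; apply: le_lt_trans yr (lt_le_trans re (ed _)).
have rb (s : K) : 0 <= s <= 1 -> nrm (q + s%:C *: (r%:C *: dl) - q) <= r.
  case/andP=> s0 s1; rewrite addrKC !nrmZ !cabs_real ger0_norm // gtr0_norm //.
  apply: (@le_trans _ _ (1 * (r * 1))); last by rewrite mul1r mulr1.
  apply: ler_pM => //; first exact: mulr_ge0 (ltW r0) (nrm_ge0 _).
  by rewrite ler_pM2l // nrm_delta.
have E : f (q + r%:C *: dl) = f q.
  apply/rowP => j; apply: (@constant_on_segment K _ (fun z => f z 0 j)) => b /rb br.
  have [dj Ej] := diff_coord j (df _ (le_lt_trans br r1)).
  by split; rewrite ?Ej ?(flat _ _ br) ?mxE.
have qr : nrm (q + r%:C *: dl - q) < d2.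
  by have := rb 1; rewrite scale1r lexx ler01 => /(_ isT) /le_lt_trans; apply.
have := inj _ _ qr _ E; rewrite subrr nrm0 => /(_ d20) /eqP.
rewrite -subr_eq0 addrKC scaler_eq0 (negPf (delta_neq0 _)) orbF.
by rewrite -cabs_eq0 cabs_real normr_eq0 gt_eqF.
Qed.

(** In dimension one this is [injective_diff1]. In higher dimension the Jacobian
    determinant vanishes at [q], and by [step] so does the whole differential
    wherever the determinant does. Some entry of the differential is not locally
    zero but vanishes on the zero set of the determinant; [transversal_function]
    and [flat_curve] then produce two points with the same image. *)
Lemma osgood_flat n (f : 'rV[K[i]]_n.+1 -> 'rV[K[i]]_n.+1) q :
  (forall y, holo_near f y -> injective_near f y -> (exists u, 'd f y u != 0) ->
    forall e, 'd f y e = 0 -> e = 0) ->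
  holo_near f q -> injective_near f q -> ~ (forall u, 'd f q u = 0).
Proof.
move=> step hf jf flatq.
have [d1 d10 hn] := holo_near_nbhd hf; have [d2 d20 jn] := injective_near_nbhd jf.
have crit y : nrm (y - q) < Num.min d1 d2 -> jacobian_det f y = 0 -> forall u, 'd f y u = 0.
  rewrite lt_min => /andP[y1 y2] Jy u.
  have [e e0 fe] := (jacobian_det_eq0 (holo_near_differentiable (hn y y1))).1 Jy.
  apply/eqP; apply: contrapT => /negP fu; case/negP: e0; apply/eqP.
  by apply: (step y (hn y y1) (jn y y2) _ e fe); exists u.
have D0 : 0 < Num.min d1 d2 by rewrite lt_min d10.
have Jq : jacobian_det f q = 0.
  apply/(jacobian_det_eq0 (holo_near_differentiable hf)).
  by exists (delta_mx 0 0); [exact: delta_neq0 | exact: flatq].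
case: n => [|n] in f q step hf jf flatq hn jn crit Jq *.
  pose dl : 'rV[K[i]]_1 := delta_mx 0 0.
  pose phi t := f (q + t *: dl) 0 0.
  have [d3 d30 df] := hf; have [d4 d40 inj] := jf.
  have tb t : nrm (q + t *: dl - q) <= cabs t.
    by rewrite addrKC nrmZ ler_piMr ?cabs_ge0 ?nrm_delta.
  have dphi t (td : cabs t < d3) := diff_coord 0 (diff_line (df _ (le_lt_trans (tb t) td))).1.
  have hphi : holo_near phi 0.
    by exists d3 => [//|t]; rewrite subr0 => td; exact: (dphi t td).1.
  have c0 : cabs (0 : K[i]) < d3 by rewrite cabs0.
  have := injective_diff1 hphi; rewrite (dphi 0 c0).2.
  have [_ ->] := diff_line (df _ (le_lt_trans (tb 0) c0)).
  rewrite scale0r addr0 flatq mxE eqxx => H; suff: false by [].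
  apply: H; exists d4 => // s t sd td st.
  have E : f (q + s *: dl) = f (q + t *: dl) by apply/rowP => k; rewrite (ord1 k).
  have := inj _ _ (le_lt_trans (tb s) sd) (le_lt_trans (tb t) td) E.
  move=> /addrI /(congr1 (fun x : 'rV[K[i]]_1 => x 0 0)).
  by rewrite !mxE !eqxx !mulr1.
have [i [j nz]] := entry_not_locally0 hf jf.
pose Z : set 'rV[K[i]]_n.+2 := [set y | jacobian_det f y = 0].
have hfj := holo_near_coord j hf.
have hw0 := holo_near_diff (delta_mx 0 i) hfj.
have vw0 : vanishes_near Z (fun y => 'd (fun z => f z 0 j) y (delta_mx 0 i)) q.
  exists (Num.min d1 d2) => // y yD Jy.
  have y1 : nrm (y - q) < d1 by move: yD; rewrite lt_min => /andP[].
  by rewrite (diff_coord j (holo_near_differentiable (hn y y1))).2 crit // mxE.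
have [x [w [e [Jx xq hw [d5 d50 vw] we]]]] := transversal_function D0 Jq hw0 vw0 nz.
have /andP[x1 x2] : (nrm (x - q) < d1) && (nrm (x - q) < d2) by rewrite -lt_min.
have hfx := hn x x1; have [d6 d60 inj] := jn x x2.
have hJ := holo_near_jacobian_det hfx.
have e0 : e != 0 by apply: contraNneq we => ->; rewrite linear0.
(* in dimension at least two some coordinate direction is independent of [e] *)
have [k ek] : exists k, forall c, e != c *: delta_mx 0 k.
  have [e1|e1] := eqVneq (e 0 ord_max) 0; last first.
    exists 0 => c; apply: contraNneq e1 => ->.
    by rewrite !mxE /= mulr0.
  exists ord_max => c; apply: contraNneq e0 => eE.
  have : c = 0 by move: e1; rewrite eE !mxE !eqxx mulr1.
  by move=> c0; rewrite eE c0 scale0r.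
have [|s [t [s0 st fst]]] := @flat_curve K _ _ f (jacobian_det f) w x e (delta_mx 0 k)
    hJ Jx hw we hfx _ d6 d60.
  have Dx : 0 < Num.min d1 d2 - nrm (x - q) by rewrite subr_gt0.
  exists (Num.min d5 (Num.min d1 d2 - nrm (x - q))); first by rewrite lt_min d50.
  move=> y; rewrite lt_min => /andP[y5 yD] Jy; split; first exact: vw.
  apply: crit => //; apply: le_lt_trans (_ : nrm (y - x) + nrm (x - q) < _).
    by rewrite -(subrKA x) nrmD.
  by rewrite -ltrBrDr.
have xx : nrm (x - x) < d6 by rewrite subrr nrm0.
have xst : nrm (x + (s *: delta_mx 0 k + t *: e) - x) < d6 by rewrite addrKC.
have /eqP := inj _ _ xst xx fst; rewrite -subr_eq0 addrKC => /eqP ste.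
have t0 : t != 0.
  apply/eqP => t0; move: ste; rewrite t0 scale0r addr0 => /eqP.
  by rewrite scaler_eq0 (negPf s0) (negPf (delta_neq0 _)).
have := ek (- (s / t)); rewrite scaleNr => /eqP; apply.
apply: (scalerI t0); rewrite scalerN scalerA [t * _]mulrC divfK //.
by apply/eqP; rewrite -addr_eq0 addrC ste.
Qed.

Lemma osgood n (f : 'rV[K[i]]_n -> 'rV[K[i]]_n) q :
  holo_near f q -> injective_near f q -> forall e, 'd f q e = 0 -> e = 0.
Proof.
elim: n f q => [|n IH] f q hf jf e fe; first by apply/rowP => -[].
have step := osgood_step IH.
apply: (step f q hf jf _ e fe); apply: contrapT => nex.
apply: (osgood_flat (fun y => step f y) hf jf) => u.
by apply/eqP; apply: contrapT => /negP fu; apply: nex; exists u.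
Qed.

End OsgoodTheorem.

(** * The inverse function theorem *)

Section InverseFunction.
Context {K : realType}.
Implicit Types (n : nat).

Lemma strict_est_row n m (f : 'rV[K[i]]_n -> 'rV[K[i]]_m) x (e : K) :
  holo_near f x -> 0 < e ->
  exists2 d : K, 0 < d & forall y z, nrm (y - x) < d -> nrm (z - x) < d ->
    nrm (f y - f z - 'd f x (y - z)) <= e * nrm (y - z).
Proof.
move=> hf e0.
have /choice[d Hd] (j : 'I_m) : exists d : K, 0 < d /\ forall y z,
    nrm (y - x) < d -> nrm (z - x) < d ->
    cabs ((f y - f z - 'd f x (y - z)) 0 j) <= e * nrm (y - z).
  have [d d0 Hd] := strict_est (holo_near_coord j hf) e0.
  exists d; split=> // y z yd zd; have := Hd y z yd zd.
  by rewrite (diff_coord j (holo_near_differentiable hf)).2 !mxE.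
have [d' d'0 dd] := finite_min (fun j => (Hd j).1).
exists d' => // y z yd zd; apply: nrm_row_le.
  by rewrite mulr_ge0 ?nrm_ge0 // ltW.
by move=> j; apply: (Hd j).2; [exact: lt_le_trans yd (dd j) | exact: lt_le_trans zd (dd j)].
Qed.

Lemma inverse_differential n (f : 'rV[K[i]]_n -> 'rV[K[i]]_n) x : differentiable f x ->
  (forall e, 'd f x e = 0 -> e = 0) ->
  exists (N : 'M[K[i]]_n) (c : K), [/\ 0 < c, forall u, 'd f x (u *m N) = u,
    forall u, 'd f x u *m N = u & forall u : 'rV[K[i]]_n, nrm (u *m N) <= c * nrm u].
Proof.
move=> df inj; pose A : 'M[K[i]]_n := \matrix_(i, j) 'd (fun z => f z 0 j) x (delta_mx 0 i).
have EA e : e *m A = 'd f x e.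
  apply/rowP => j; rewrite -(diff_coord j df).2 lin_row mxE.
  by apply: eq_bigr => i _; rewrite mxE.
have Au : A \in unitmx.
  rewrite unitmxE unitfE; apply/det0P => -[v v0 vA].
  by case/negP: v0; apply/eqP/inj; rewrite -EA.
pose b := \sum_i \sum_j cabs (invmx A i j).
have b0 : 0 <= b by rewrite sumr_ge0 // => i _; rewrite sumr_ge0 // => j _; exact: cabs_ge0.
have Nb i j : cabs (invmx A i j) <= b.
  rewrite /b (bigD1 i) //= (bigD1 j) //= -addrA lerDl addr_ge0 ?sumr_ge0 // => k _.
    exact: cabs_ge0.
  by rewrite sumr_ge0 // => l _; exact: cabs_ge0.
exists (invmx A), (n%:R * b + 1); split.
- by rewrite ltr_wpDl // mulr_ge0.
- by move=> u; rewrite -EA mulmxKV.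
- by move=> u; rewrite -EA mulmxK.
move=> u; apply: nrm_row_le.
  by rewrite mulr_ge0 ?nrm_ge0 // addr_ge0 // mulr_ge0.
move=> j; rewrite mxE.
have := @cabs_sum_le K 'I_n (fun i => u 0 i * invmx A i j) (b * nrm u).
rewrite card_ord => /(_ _)/le_trans; apply; first by move=> i; rewrite cabsM mulrC ler_pM ?cabs_ge0 ?cabs_coord_le.
by rewrite mulrA mulrDl lerDl mul1r nrm_ge0.
Qed.

(** Newton's iteration with the differential frozen at [q]: by strict
    differentiability each step halves the defect [w - f x]. *)
Lemma open_image n (f : 'rV[K[i]]_n -> 'rV[K[i]]_n) q : holo_near f q ->
  (forall e, 'd f q e = 0 -> e = 0) ->
  forall eps : K, 0 < eps -> exists2 d : K, 0 < d & forall w, nrm (w - f q) < d ->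
    exists2 x, nrm (x - q) < eps & f x = w.
Proof.
move=> hf inj eps eps0; have dfq := holo_near_differentiable hf.
have [N [c [c0 fN Nf Nc]]] := inverse_differential dfq inj.
have e0 : 0 < (2 * c)^-1 by rewrite invr_gt0 mulr_gt0.
have [d1 d10 str] := strict_est_row hf e0; have [d2 d20 df] := hf.
pose D := Num.min eps (Num.min d1 d2); have D0 : 0 < D by rewrite !lt_min eps0 d10.
exists (D / 8 / c); first by rewrite !divr_gt0.
move=> w wq; pose a := c * nrm (w - f q).
have a0 : 0 <= a by rewrite mulr_ge0 ?nrm_ge0 // ltW.
have aD : 4 * a < D.
  by move: wq; rewrite ltr_pdivlMr // mulrC -/a; lra.
pose fix x k := if k is l.+1 then x l + (w - f (x l)) *m N else q.
have p0 := @exp2V_gt0 K.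
have half := @exp2VS K.
have step k : x k.+1 - x k = (w - f (x k)) *m N by rewrite /= addrKC.
have dlt k : nrm (w - f (x k)) <= a / c * (2 ^+ k)^-1 ->
    nrm (x k.+1 - x k) <= a * (2 ^+ k)^-1.
  move=> H; rewrite step; apply: (le_trans (Nc _)).
  apply: (le_trans (ler_wpM2l (ltW c0) H)); apply: eq_leW; field; rewrite gt_eqF //=.
  by rewrite gt_eqF // exprn_gt0.
have main k : nrm (w - f (x k)) <= a / c * (2 ^+ k)^-1 /\
    nrm (x k - q) <= 2 * a * (1 - (2 ^+ k)^-1).
  elim: k => [|k [IH1 IH2]].
    split; last by rewrite /= subrr nrm0 expr0 invr1 subrr mulr0.
    by rewrite expr0 invr1 mulr1 /= /a mulrC mulKf // gt_eqF.
  have D1 := dlt k IH1.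
  have IH3 : nrm (x k.+1 - q) <= 2 * a * (1 - (2 ^+ k.+1)^-1).
    have := nrmD (x k.+1 - x k) (x k - q); rewrite subrKA half.
    by move: (x k.+1 - q) D1 => z D1; lra.
  split; last exact: IH3.
  have kd m z : nrm z <= 2 * a * (1 - (2 ^+ m)^-1) -> nrm z < d1.
    move=> H; have : nrm z < D.
      have : 0 <= a * (2 ^+ m)^-1 by rewrite mulr_ge0 // ltW.
      lra.
    by rewrite !lt_min => /and3P[].
  have := str (x k.+1) (x k) (kd _ _ _ IH3) (kd _ _ _ IH2).
  rewrite {1}step fN => H.
  have -> : w - f (x k.+1) = - (f (x k.+1) - f (x k) - (w - f (x k))).
    by rewrite !opprB addrA subrK.
  rewrite nrmN; apply: (le_trans H).
  apply: (@le_trans _ _ ((2 * c)^-1 * (a * (2 ^+ k)^-1))).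
    by rewrite ler_wpM2l // ltW.
  apply: eq_leW; rewrite half; field; rewrite gt_eqF //=.
  by rewrite gt_eqF // exprn_gt0.
have tail k m : nrm (x (k + m)%N - x k) <= 2 * a * ((2 ^+ k)^-1 - (2 ^+ (k + m))^-1).
  elim: m => [|m IH]; first by rewrite addn0 !subrr nrm0 mulr0.
  rewrite addnS; have := nrmD (x (k + m).+1 - x (k + m)%N) (x (k + m)%N - x k).
  rewrite subrKA half; have [/dlt H _] := main (k + m)%N.
  by move: (x (k + m).+1 - x k) H => z H; lra.
have cau k m : nrm (x k - x m) <= 2 * a * (2 ^+ k)^-1 + 2 * a * (2 ^+ m)^-1.
  wlog km : k m / (k <= m)%N => [W|].
    have [|/ltnW] := leqP k m; first exact: W.
    by move=> /W H; rewrite nrm_distC (le_trans H) // addrC.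
  have := tail k (m - k)%N; rewrite subnKC // nrm_distC mulrBr.
  have := mulr_ge0 (mulr_ge0 (ler0n _ 2) a0) (ltW (p0 m)).
  lra.
have /choice[l Hl] (j : 'I_n) : exists l, forall k : nat, True ->
    cabs (x k 0 j - l) <= 2 * (2 * a * (2 ^+ k)^-1).
  apply: (@common_center K nat [set: nat] (fun k => x k 0 j)); first by exists 0.
  move=> k m _ _; apply: le_trans (cau k m); have := cabs_coord_le (x k - x m) j.
  by rewrite !mxE.
pose z : 'rV[K[i]]_n := \row_j l j.
have xz k : nrm (x k - z) <= 4 * a * (2 ^+ k)^-1.
  apply: nrm_row_le => [|j]; first exact: mulr_ge0 (mulr_ge0 (ler0n _ 4) a0) (ltW (p0 k)).
  have := Hl j k I; rewrite !mxE; lra.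
have zD : nrm (z - q) < D.
  by have := xz 0; rewrite nrm_distC /= expr0 invr1 mulr1; lra.
move: (zD); rewrite !lt_min => /and3P[zeps z1 z2].
exists z => //; apply/eqP; rewrite -subr_eq0 -nrm_eq0 eq_le nrm_ge0 andbT.
apply/ler_addgt0Pr => e e00; rewrite add0r.
have [d3 d30 Hd] := continuous_est (differentiable_continuous (df z z2)) (divr_gt0 e00 (ltr0n _ 2)).
have [k kd] := exists_pow2_gt (4 * a / d3 + a / c / (e / 2)).
have k0 : 0 < 2 ^+ k :> K by rewrite exprn_gt0.
have A1 := divr_ge0 (mulr_ge0 (ler0n _ 4) a0) (ltW d30).
have A2 := divr_ge0 (divr_ge0 a0 (ltW c0)) (ltW (divr_gt0 e00 (ltr0n _ 2))).
have B1 : 4 * a * (2 ^+ k)^-1 < d3.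
  by rewrite ltr_pdivrMr // [d3 * _]mulrC -ltr_pdivrMr //; lra.
have B2 : a / c * (2 ^+ k)^-1 <= e / 2.
  by rewrite ler_pdivrMr // [e / 2 * _]mulrC -ler_pdivrMr ?divr_gt0 //; lra.
have C1 := Hd (x k) (le_lt_trans (xz k) B1).
have [C2 _] := main k.
have := nrmB (f (x k) - w) (f (x k) - f z); rewrite opprB addrC addrA subrK.
rewrite [nrm (f (x k) - w)]nrm_distC; lra.
Qed.

(** Openness and injectivity of [f] make [u] continuous; then the invertible
    differential makes its increments comparable to those of the parameter. *)
Lemma differentiable_preimage_line n (f : 'rV[K[i]]_n -> 'rV[K[i]]_n)
    (X : set 'rV[K[i]]_n) (u : K[i] -> 'rV[K[i]]_n) e t0 :
  (exists2 d : K, 0 < d & forall y, nrm (y - u t0) < d -> X y) ->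
  holo_near f (u t0) -> (forall h, 'd f (u t0) h = 0 -> h = 0) ->
  (forall y z, X y -> X z -> f y = f z -> y = z) ->
  (exists2 d : K, 0 < d & forall t, cabs (t - t0) < d -> X (u t) /\ f (u t) = t *: e) ->
  differentiable u t0.
Proof.
move=> [dX dX0 HX] hf inj injX [d1 d10 Hu].
have dfq := holo_near_differentiable hf.
have [N [c [c0 fN Nf Nc]]] := inverse_differential dfq inj.
have [_ fu0] : X (u t0) /\ f (u t0) = t0 *: e by apply: Hu; rewrite subrr cabs0.
pose q := nrm e + 1; have q0 : 0 < q by rewrite ltr_wpDl ?nrm_ge0.
have cont eps : 0 < eps -> exists2 d : K, 0 < d & forall t, cabs (t - t0) < d ->
    nrm (u t - u t0) < eps.
  move=> eps0; have m0 : 0 < Num.min eps dX by rewrite lt_min eps0.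
  have [d d0 Hd] := open_image hf inj m0.
  exists (Num.min d1 (d / q)); first by rewrite lt_min d10 divr_gt0.
  move=> t; rewrite lt_min => /andP[t1 t2]; have [Xt ft] := Hu t t1.
  have [|x xu fx] := Hd (t *: e).
    rewrite fu0 -scalerBl nrmZ; apply: (@le_lt_trans _ _ (cabs (t - t0) * q)).
      by rewrite ler_wpM2l ?cabs_ge0 // lerDl.
    by rewrite -ltr_pdivlMr.
  move: xu; rewrite lt_min => /andP[xe xX].
  by rewrite (injX (u t) x Xt (HX x xX)) // ft fx.
have lin : linear (fun h : K[i] => h *: (e *m N)).
  by move=> a b b'; rewrite scalerDl scalerA.
apply: (diff_introL lin (c := nrm (e *m N)) _ _).1.
  by move=> h; rewrite nrmZ mulrC.
move=> e' e'0.
(* the remainder of [f] is absorbed once the increment of [u] is known to be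
   of the order of the increment of the parameter *)
pose B := 2 * c * q; have B0 : 0 < B by rewrite !mulr_gt0.
pose eta := Num.min (2 * c)^-1 (e' / (c * B)).
have c20 : 0 < 2 * c by rewrite mulr_gt0.
have cB : 0 < c * B by rewrite mulr_gt0.
have eta0 : 0 < eta by rewrite lt_min invr_gt0 c20 divr_gt0.
have eta1 : c * eta <= 2^-1.
  have : eta <= (2 * c)^-1 by rewrite ge_min lexx.
  by move=> /(ler_wpM2l (ltW c0)) /le_trans; apply; apply: eq_leW; field; rewrite gt_eqF.
have eta2 : c * eta * B <= e'.
  have : eta <= e' / (c * B) by rewrite ge_min lexx orbT.
  by rewrite ler_pdivlMr // => H; rewrite [c * eta]mulrC -mulrA.
have [d2 d20 Hd2] := diff_est dfq eta0.
have [d3 d30 Hd3] := cont _ d20.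
exists (Num.min d1 d3); first by rewrite lt_min d10.
move=> h; rewrite lt_min nrm_cabs => /andP[h1 h3].
have hE : t0 + h - t0 = h by rewrite addrKC.
have [Xt ft] : X (u (t0 + h)) /\ f (u (t0 + h)) = (t0 + h) *: e.
  by apply: Hu; rewrite hE.
have ud : nrm (u (t0 + h) - u t0) < d2 by apply: Hd3; rewrite hE.
have := Hd2 _ ud; rewrite subrKC ft fu0 -scalerBl hE.
set D := u (t0 + h) - u t0 => H.
have rem : nrm (D - h *: (e *m N)) <= c * eta * nrm D.
  have -> : D - h *: (e *m N) = - ((h *: e - 'd f (u t0) D) *m N).
    by rewrite mulmxBl Nf opprB scalemxAl.
  by rewrite nrmN (le_trans (Nc _)) // -mulrA ler_wpM2l // ltW.
have De : nrm (h *: (e *m N)) <= c * q * cabs h.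
  rewrite nrmZ mulrC ler_wpM2r ?cabs_ge0 // (le_trans (Nc _)) //.
  by rewrite ler_wpM2l ?(ltW c0) // lerDl.
have DB : nrm D <= B * cabs h.
  have := nrmD (D - h *: (e *m N)) (h *: (e *m N)); rewrite subrK => H2.
  have := ler_wpM2r (nrm_ge0 D) eta1; rewrite /B; lra.
apply: (le_trans rem); apply: (@le_trans _ _ (c * eta * (B * cabs h))).
  by rewrite ler_wpM2l // mulr_ge0 ?ltW.
by rewrite mulrA ler_wpM2r ?cabs_ge0.
Qed.

End InverseFunction.

(** * The Schwarz-Pick lemma with removable singularities *)

Section Hyperbolic.
Context {K : realType}.
Implicit Types (x y : K).

Lemma tanhE x : tanh x = 1 - 2 / (expR x ^+ 2 + 1).
Proof.
have u0 := expR_gt0 x; rewrite /tanh expRN.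
have ? : expR x ^+ 2 + 1 != 0 by rewrite gt_eqF // ltr_wpDl // sqr_ge0.
have ? : expR x + (expR x)^-1 != 0 by rewrite gt_eqF // addr_gt0 // invr_gt0.
by field; rewrite !gt_eqF // ltr_wpDl // sqr_ge0.
Qed.

Lemma tanh_le x y : x <= y -> tanh x <= tanh y.
Proof.
have u0 z : 0 < expR z ^+ 2 + 1 by rewrite ltr_wpDl // sqr_ge0.
move=> xy; rewrite !tanhE lerD2l lerN2 ler_pM2l // lef_pV2 ?posrE // lerD2r.
by rewrite lerXn2r ?nnegrE ?(ltW (expR_gt0 _)) // ler_expR.
Qed.

Lemma tanh_artanh x : -1 < x -> x < 1 -> tanh (artanh x) = x.
Proof.
move=> x1 x2; have y0 : 0 < (1 + x) / (1 - x) by rewrite divr_gt0; lra.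
have E : expR (artanh x) ^+ 2 = (1 + x) / (1 - x).
  rewrite expr2 -expRD /artanh -mulrDl (_ : 2^-1 + 2^-1 = 1); last by field.
  by rewrite mul1r lnK.
by rewrite tanhE E; field; apply/andP; split; lra.
Qed.

Lemma artanh_le x y : -1 < x -> x <= y -> y < 1 -> artanh x <= artanh y.
Proof.
move=> x1 xy y1; rewrite /artanh ler_pM2l ?invr_gt0 // ler_ln ?posrE ?divr_gt0 //; try lra.
have x2 : 0 < 1 - x by lra.
have y2 : 0 < 1 - y by lra.
by rewrite ler_pdivrMr // mulrAC ler_pdivlMr //; nra.
Qed.

Lemma lt_of_artanh_lt x y : x < 1 -> -1 < y -> artanh x < artanh y -> x < y.
Proof.
move=> x1 y1; rewrite !ltNge => /negP H; apply/negP => yx; apply: H.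
exact: artanh_le.
Qed.

Lemma artanh_lt x y : -1 < x -> x < 1 -> x < tanh y -> artanh x < y.
Proof.
move=> x1 x2; rewrite !ltNge => /negP H; apply/negP => yx; apply: H.
by rewrite -(tanh_artanh x1 x2) tanh_le.
Qed.

End Hyperbolic.

Section SchwarzPick.
Context {K : realType}.

(** The automorphism of the disk that sends [z] to 0; its modulus is the
    hyperbolic tangent of the Caratheodory distance of the disk. *)
Definition mobius (z t : K[i]) : K[i] := (t - z) / (1 - z^* * t).

Lemma mobius_den_neq0 (z t : K[i]) : cabs z < 1 -> cabs t <= 1 -> 1 - z^* * t != 0.
Proof.
move=> z1 t1; rewrite -cabs_gt0; have := cabs_dist 1 (z^* * t).
rewrite cabs1 cabsM cabs_conj; have := ler_wpM2l (cabs_ge0 z) t1; lra.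
Qed.

Lemma mobius_key (z t : K[i]) : cabs (1 - z^* * t) ^+ 2 - cabs (t - z) ^+ 2 =
  (1 - cabs z ^+ 2) * (1 - cabs t ^+ 2).
Proof. by case: z => a b; case: t => c d; rewrite !cabs_sqr /=; ring. Qed.

Lemma cabs_mobius_sqr (z t : K[i]) : cabs z < 1 -> cabs t <= 1 ->
  cabs (mobius z t) ^+ 2 =
    1 - (1 - cabs z ^+ 2) * (1 - cabs t ^+ 2) / cabs (1 - z^* * t) ^+ 2.
Proof.
move=> z1 t1; rewrite -mobius_key /mobius cabsM cabsV.
have : cabs (1 - z^* * t) != 0 by rewrite cabs_eq0 mobius_den_neq0.
by move: (cabs (1 - _)) (cabs (t - z)) => a b a0; field.
Qed.

Lemma sqr_lt1 (x : K) : 0 <= x -> x < 1 -> 0 < 1 - x ^+ 2.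
Proof. by move=> x0 x1; rewrite subr_gt0 expr_lt1. Qed.

Lemma cabs_mobius_lt1 (z t : K[i]) : cabs z < 1 -> cabs t < 1 -> cabs (mobius z t) < 1.
Proof.
move=> z1 t1; rewrite -(@expr_lt1 _ 2) ?cabs_ge0 // cabs_mobius_sqr ?(ltW t1) //.
rewrite gtrDl oppr_lt0; apply: divr_gt0.
  by apply: mulr_gt0; apply: sqr_lt1; rewrite ?cabs_ge0.
by rewrite exprn_gt0 // cabs_gt0 mobius_den_neq0 // ltW.
Qed.

Lemma cabs_mobiusC (z t : K[i]) : cabs (mobius z t) = cabs (mobius t z).
Proof.
rewrite /mobius !cabsM !cabsV cabs_distC; congr (_ / _).
by rewrite -cabs_conj rmorphB rmorph1 rmorphM /= conjcK mulrC.
Qed.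

Lemma differentiable_mobius (z t : K[i]) : cabs z < 1 -> cabs t <= 1 ->
  differentiable (mobius z) t.
Proof.
move=> z1 t1; apply: differentiableM; first exact: differentiable_subC.
apply: differentiableV; last exact: mobius_den_neq0.
apply: differentiableB; first exact: differentiable_cst.
by apply: differentiableM; [exact: differentiable_cst | exact: ex_diff].
Qed.

(** The quotient [q] of [G] by [mobius z] has removable singularities at [z] and on
    [S]. On a circle of radius [rho] close to 1, [mobius z] is at
    least [beta], which tends to 1 with [rho], so the maximum principle bounds
    [q] by 1. *)
Lemma schwarz_pick (G : K[i] -> K[i]) (S : seq K[i]) (rho0 : K) z a :
  rho0 < 1 -> (forall s, s \in S -> cabs s <= rho0) ->
  (forall t, cabs t < 1 -> t \notin S -> differentiable G t) ->
  (forall t, cabs t < 1 -> t \notin S -> cabs (G t) <= 1) ->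
  cabs z < 1 -> z \notin S -> G z = 0 -> cabs a < 1 -> a \notin S ->
  cabs (G a) <= cabs (mobius z a).
Proof.
move=> r01 Sr dG G1 z1 zS Gz a1 aS.
have [->|az] := eqVneq a z; first by rewrite Gz cabs0 cabs_ge0.
pose kap := (1 - cabs z) ^- 2; have kap0 : 0 < kap by rewrite invr_gt0 exprn_gt0 // subr_gt0.
suff H rho : cabs a < rho -> cabs z < rho -> rho0 < rho -> rho < 1 ->
    0 < 1 - kap * (1 - rho ^+ 2) ->
    cabs (G a) * (1 - kap * (1 - rho ^+ 2)) <= cabs (mobius z a).
  apply/ler_addgt0Pr => e e0.
  pose m := Num.max (Num.max (cabs a) (cabs z)) (Num.max rho0 (1 - Num.min e 1 / (4 * kap))).
  have me0 : 0 < Num.min e 1 by rewrite lt_min e0 ltr01.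
  have k4 : 0 < 4 * kap by rewrite mulr_gt0.
  have q0 : 0 < Num.min e 1 / (4 * kap) by rewrite divr_gt0.
  have m1 : m < 1 by rewrite !gt_max a1 z1 r01 /= gtrBl.
  pose rho := (m + 1) / 2; have mr : m < rho by rewrite /rho; lra.
  have r1 : rho < 1 by rewrite /rho; lra.
  move: (mr); rewrite {1}/m !gt_max => /andP[/andP[ra rz] /andP[rr rk]].
  have km : kap * (1 - rho ^+ 2) <= Num.min e 1 / 2.
    have h1 : 1 - rho ^+ 2 <= 2 * (Num.min e 1 / (4 * kap)).
      have : 0 <= rho by rewrite (le_trans (cabs_ge0 a)) // ltW.
      move: (Num.min e 1 / _) rk => y rk r0; nra.
    apply: (le_trans (ler_wpM2l (ltW kap0) h1)); apply: eq_leW; field.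
    by rewrite gt_eqF.
  have mn1 : Num.min e 1 <= 1 by rewrite ge_min lexx orbT.
  have mne : Num.min e 1 <= e by rewrite ge_min lexx.
  have := H rho ra rz rr r1; have : 0 < 1 - kap * (1 - rho ^+ 2) by lra.
  move=> pos /(_ pos) H1.
  have := ler_wpM2r (ltW (lt_le_trans me0 mn1 : 0 < 1 :> K)) (G1 a a1 aS).
  have h2 : cabs (G a) * (kap * (1 - rho ^+ 2)) <= 1 * (Num.min e 1 / 2).
    apply: ler_pM; rewrite ?cabs_ge0 ?G1 //.
    by rewrite mulr_ge0 ?(ltW kap0) // subr_ge0 expr_le1 ?(ltW r1) // (le_trans (cabs_ge0 a)) // ltW.
  move: H1 h2; rewrite mulrBr mulr1; lra.
move=> ra rz rr r1; set beta := 1 - _ => b0.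
have r0 : 0 < rho := le_lt_trans (cabs_ge0 a) ra.
have [|B HB] := @slope_bounded K G S rho 1 z _ (ltW rz) zS (dG z z1 zS).
  by move=> t tr tS; apply: G1 => //; exact: le_lt_trans tr r1.
pose q t := (G t - G z) / (t - z) * (1 - z^* * t).
have den2 t : cabs t <= rho -> cabs (1 - z^* * t) <= 2.
  move=> tr; rewrite (le_trans (cabsB _ _)) // cabs1 cabsM cabs_conj.
  have : cabs z * cabs t <= 1 * 1.
    by apply: ler_pM; rewrite ?cabs_ge0 ?(ltW z1) // (le_trans tr) // ltW.
  lra.
have qa : cabs (q a) <= beta^-1.
  apply: (@max_principle_except K q (z :: S) rho _ (B * 2) r0).
  - by move=> s; rewrite inE => /predU1P[->//|/Sr sr]; exact: le_lt_trans rr.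
  - move=> t tr; rewrite inE negb_or => /andP[tz tS].
    apply: differentiableM.
      by apply: differentiable_slope => //; apply: dG => //; exact: le_lt_trans r1.
    apply: differentiableB; first exact: differentiable_cst.
    by apply: differentiableM; [exact: differentiable_cst | exact: ex_diff].
  - move=> t tr tS; rewrite cabsM; apply: ler_pM; rewrite ?cabs_ge0 ?den2 //.
    exact: HB.
  - move=> t tr; have tr' : cabs t <= rho by rewrite tr.
    have t1 : cabs t < 1 by rewrite tr.
    have tS : t \notin S by apply/negP => /Sr; rewrite tr leNgt rr.
    have tz : t != z by apply: contraTneq rz => <-; rewrite tr ltxx.
    have mob0 : mobius z t != 0.
      by rewrite /mobius mulf_neq0 ?subr_eq0 ?invr_neq0 // mobius_den_neq0 // ltW.
    have -> : q t = G t / mobius z t.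
      rewrite /q /mobius Gz; have := mobius_den_neq0 z1 (ltW t1).
      by move=> d0; field; rewrite d0 /= subr_eq0.
    have mb : beta <= cabs (mobius z t).
      have m1 := cabs_mobius_lt1 z1 t1.
      apply: (@le_trans _ _ (cabs (mobius z t) ^+ 2)); last first.
        by rewrite expr2 ler_piMl ?cabs_ge0 // ltW.
      rewrite cabs_mobius_sqr ?(ltW t1) // tr /beta lerD2l lerN2.
      have d1 : 1 - cabs z <= cabs (1 - z^* * t).
        have := cabs_dist 1 (z^* * t); rewrite cabs1 cabsM cabs_conj.
        have := ler_wpM2l (cabs_ge0 z) (ltW t1); lra.
      have z10 : 0 < 1 - cabs z by rewrite subr_gt0.
      have dp : 0 < cabs (1 - z^* * t) := lt_le_trans z10 d1.
      have A0 := ltW (sqr_lt1 (cabs_ge0 z) z1); have B0 := ltW (sqr_lt1 (ltW r0) r1).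
      have A1 : 1 - cabs z ^+ 2 <= 1 by rewrite gerBl sqr_ge0.
      have I0 : 0 <= cabs (1 - z^* * t) ^- 2 by rewrite invr_ge0 exprn_ge0 // ltW.
      have I1 : cabs (1 - z^* * t) ^- 2 <= kap.
        by rewrite /kap lef_pV2 ?posrE ?exprn_gt0 // lerXn2r ?nnegrE ?(ltW z10) ?(ltW dp).
      have := ler_pM (mulr_ge0 A0 B0) I0 (ler_wpM2r B0 A1) I1.
      by rewrite mul1r [_ * kap]mulrC.
    rewrite cabsM cabsV -[leRHS]mul1r; apply: ler_pM; rewrite ?cabs_ge0 ?invr_ge0 ?cabs_ge0 //.
      exact: G1.
    by rewrite lef_pV2 ?posrE ?cabs_gt0.
  - exact: ltW.
  - by rewrite inE negb_or az.
have d0 := mobius_den_neq0 z1 (ltW a1).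
have E : G a = q a * mobius z a.
  by rewrite /q /mobius Gz; field; rewrite d0 /= subr_eq0.
rewrite E cabsM mulrAC ler_piMl ?cabs_ge0 //.
by rewrite -ler_pdivlMr // mul1r.
Qed.

(** Riemann's theorem with a rate, so that limits of finitely many components
    can be taken together. *)
Lemma punctured_limit (G : K[i] -> K[i]) a (r M : K) : 0 < r ->
  (forall t, cabs (t - a) <= r -> t != a -> differentiable G t) ->
  (forall t, cabs (t - a) <= r -> t != a -> cabs (G t) <= M) ->
  exists c (L : K), 0 <= L /\
    forall t, cabs (t - a) <= r / 2 -> t != a -> cabs (G t - c) <= L * cabs (t - a).
Proof.
move=> r0 dG GM; pose F t := G (a + t).
have nin (t : K[i]) : (t \notin [:: 0]) = (t != 0) by rewrite inE.
have ain t : a + t - a = t by rewrite addrKC.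
have an t : t != 0 -> a + t != a by rewrite -(subr_eq0 (a + t)) ain.
have r2 : 0 < r / 2 by rewrite divr_gt0.
have LF (s t : K[i]) : cabs s <= r / 2 -> cabs t <= r / 2 -> s != 0 -> t != 0 ->
    cabs (F s - F t) <= 4 * M / r * cabs (s - t).
  rewrite -!nin; apply: (@lipschitz_est K F [:: 0] r M r0).
  - by move=> s'; rewrite inE => /eqP ->; rewrite cabs0.
  - move=> u ur; rewrite nin => u0.
    apply: (@differentiable_comp _ _ _ _ (fun u => a + u) G).
      by apply: differentiableD; [exact: differentiable_cst | exact: ex_diff].
    by apply: dG; [rewrite ain | exact: an].
  - by move=> u ur; rewrite nin => u0; apply: GM; [rewrite ain | exact: an].
have [c Hc] := lipschitz_limit r2 LF.
exists c, `|2 * (4 * M / r)|; split=> // t tr ta.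
have := Hc (t - a) tr; rewrite subr_eq0 ta /F subrKC => /(_ isT) /le_trans; apply.
by rewrite ler_wpM2r ?cabs_ge0 // ler_norm.
Qed.

(** The maximum principle, quantitatively: near an isolated singularity the
    values of a holomorphic map into the disk stay away from the circle. With
    [w] the value at the point [h] halfway to the circle of radius [r],
    Schwarz-Pick gives [cabs (mobius w y) <= 4 / 5] for the values [y] at the
    points of the smaller disk. *)
Lemma punctured_strict (G : K[i] -> K[i]) a (r : K) : 0 < r ->
  (forall t, cabs (t - a) <= r -> t != a -> differentiable G t) ->
  (forall t, cabs (t - a) <= r -> t != a -> cabs (G t) < 1) ->
  exists2 M : K, M < 1 &
    forall t, cabs (t - a) <= r / 2 -> t != a -> cabs (G t) <= M.
Proof.
move=> r0 dG G1; have r00 : r%:C != 0 by rewrite -cabs_eq0 cabs_pos // gt_eqF.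
pose F (s : K[i]) := G (a + r%:C * s).
have ain s : a + r%:C * s - a = r%:C * s by rewrite addrKC.
have dist s : cabs s <= 1 -> cabs (a + r%:C * s - a) <= r.
  by move=> s1; rewrite ain cabsM cabs_pos // ler_piMr // ltW.
have an s : s != 0 -> a + r%:C * s != a.
  by move=> s0; rewrite -(subr_eq0 (a + _)) ain mulf_neq0.
have F1 s : cabs s <= 1 -> s != 0 -> cabs (F s) < 1.
  by move=> s1 s0; apply: G1; [exact: dist | exact: an].
have dF s : cabs s <= 1 -> s != 0 -> differentiable F s.
  move=> s1 s0; apply: (@differentiable_comp _ _ _ _ (fun s => a + r%:C * s) G).
    apply: differentiableD; first exact: differentiable_cst.
    by apply: differentiableM; [exact: differentiable_cst | exact: ex_diff].
  by apply: dG; [exact: dist | exact: an].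
pose h : K[i] := (2^-1)%:C.
have ch : cabs h = 2^-1 by rewrite cabs_pos // invr_gt0.
have h1 : cabs h < 1 by rewrite ch; lra.
have h0 : h != 0 by rewrite -cabs_eq0 ch; lra.
have w1 := F1 h (ltW h1) h0; set w := F h in w1.
pose eta := 9 / 50 * (1 - cabs w).
have eta0 : 0 < eta by rewrite /eta; lra.
exists (1 - eta / 2) => [|t tr ta]; first by lra.
pose s := (t - a) / r%:C.
have ts : t = a + r%:C * s by rewrite /s mulrC divfK // subrKC.
have s0 : s != 0 by rewrite mulf_neq0 ?invr_neq0 // subr_eq0.
have s2 : cabs s <= 2^-1.
  by rewrite /s cabsM cabsV cabs_pos // ler_pdivrMr // mulrC.
have s1 : cabs s < 1 by lra.
have nin (x : K[i]) : (x \notin [:: 0]) = (x != 0) by rewrite inE.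
have H : cabs (mobius w (F s)) <= cabs (mobius h s).
  have s1h : cabs s < 1 by lra.
  have sS (x : K[i]) : x \in [:: 0] -> cabs x <= 0 by rewrite inE => /eqP ->; rewrite cabs0.
  have hS : h \notin [:: 0] by rewrite nin.
  have sS' : s \notin [:: 0] by rewrite nin.
  have wh : mobius w (F h) = 0 by rewrite /mobius -/w subrr mul0r.
  have dU (x : K[i]) : cabs x < 1 -> x \notin [:: 0] -> differentiable (fun x => mobius w (F x)) x.
    move=> x1; rewrite nin => x0.
    apply: (@differentiable_comp _ _ _ _ F (mobius w)); first exact: dF (ltW x1) x0.
    by apply: (differentiable_mobius w1); apply/ltW; exact: F1 (ltW x1) x0.
  have U1 (x : K[i]) : cabs x < 1 -> x \notin [:: 0] -> cabs (mobius w (F x)) <= 1.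
    move=> x1; rewrite nin => x0; apply/ltW; apply: (cabs_mobius_lt1 w1).
    exact: F1 (ltW x1) x0.
  exact: (schwarz_pick ltr01 sS dU U1 h1 hS wh s1h sS').
have y1 := F1 s (ltW s1) s0.
have -> : G t = F s by rewrite /F -ts.
move: (F s) y1 H => y y1 H.
have : cabs (mobius w y) ^+ 2 <= cabs (mobius h s) ^+ 2.
  by rewrite lerXn2r ?nnegrE ?cabs_ge0.
rewrite !cabs_mobius_sqr ?(ltW y1) ?(ltW s1) // lerD2l lerN2 ch.
have dw : 1 - cabs w <= cabs (1 - w^* * y).
  have := cabs_dist 1 (w^* * y); rewrite cabs1 cabsM cabs_conj.
  have := ler_wpM2l (cabs_ge0 w) (ltW y1); lra.
have dh : cabs (1 - h^* * s) <= 5 / 4.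
  have := cabsB 1 (h^* * s); rewrite cabs1 cabsM cabs_conj ch; lra.
have dh0 : 0 < cabs (1 - h^* * s) by rewrite cabs_gt0 mobius_den_neq0 // ltW.
move: (cabs (1 - w^* * y)) (cabs (1 - h^* * s)) dw dh dh0 => p q dw dh dh0.
have p0 : 0 < p by lra.
rewrite ler_pdivrMr ?exprn_gt0 // mulrAC ler_pdivlMr ?exprn_gt0 //.
move: (cabs_ge0 w) (cabs_ge0 y) (cabs_ge0 s) w1 y1 s2 dw; rewrite /eta.
move: (cabs w) (cabs y) (cabs s) => W Y S W0 Y0 S0 W1 Y1 S2 dw E.
have e1 : 9 / 16 * p ^+ 2 <= (1 - 2^-1 ^+ 2) * (1 - S ^+ 2) * p ^+ 2.
  by apply: ler_wpM2r; rewrite ?sqr_ge0 //; nra.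
have e2 : q ^+ 2 <= 25 / 16 by nra.
have e3 : 0 <= (1 - W ^+ 2) * (1 - Y ^+ 2) by apply: mulr_ge0; apply/ltW/sqr_lt1.
have e4 := ler_wpM2l e3 e2.
have e5 : (1 - W) ^+ 2 <= p ^+ 2 by apply: lerXn2r; rewrite ?nnegrE //; lra.
have e6 : 9 / 25 * (1 - W) ^+ 2 <= (1 - W ^+ 2) * (1 - Y ^+ 2) by lra.
have e7 : 9 / 25 * (1 - W) <= (1 + W) * (1 - Y ^+ 2).
  have W10 : 0 < 1 - W by lra.
  rewrite -(ler_pM2r W10); move: e6; rewrite !expr2; lra.
have e8 : 1 - Y ^+ 2 <= 2 * (1 - Y) by nra.
have e9 : 0 <= 1 - Y ^+ 2 by apply/ltW/sqr_lt1.
nra.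
Qed.

Lemma punctured_point (a : K[i]) (d r : K) : 0 < d -> 0 < r ->
  exists2 t, cabs (t - a) < d & t != a /\ cabs (t - a) <= r.
Proof.
move=> d0 r0; pose u := Num.min (d / 2) r.
have u0 : 0 < u by rewrite lt_min r0 divr_gt0.
exists (a + u%:C); rewrite -?(subr_eq0 (a + _)) addrKC.
  by rewrite cabs_pos // gt_min half_lt.
by rewrite -cabs_eq0 cabs_pos // gt_eqF // ge_min lexx orbT.
Qed.

Lemma punctured_limit_row n (u : K[i] -> 'rV[K[i]]_n) a (r M : K) : 0 < r ->
  (forall j t, cabs (t - a) <= r -> t != a ->
    differentiable (fun t : K[i] => u t 0 j) t) ->
  (forall j t, cabs (t - a) <= r -> t != a -> cabs (u t 0 j) <= M) ->
  exists w, exists2 L : K, 0 < L & forall t : K[i], cabs (t - a) <= r / 2 -> t != a ->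
    nrm (u t - w) <= L * cabs (t - a).
Proof.
move=> r0 du uM.
have /choice[c Hc] j : exists c, exists L : K, 0 <= L /\
    forall t, cabs (t - a) <= r / 2 -> t != a -> cabs (u t 0 j - c) <= L * cabs (t - a).
  exact: (punctured_limit r0 (du j) (uM j)).
have /choice[L HL] := Hc.
exists (\row_j c j), (1 + \sum_j L j).
  by rewrite ltr_wpDr // sumr_ge0 // => k _; have [] := HL k.
move=> t tr ta; have sum0 : 0 <= \sum_j L j by rewrite sumr_ge0 // => k _; have [] := HL k.
apply: nrm_row_le => [|j]; first by rewrite mulr_ge0 ?cabs_ge0 // addr_ge0.
rewrite !mxE; have [_ /(_ t tr ta) H] := HL j; apply: (le_trans H).
rewrite ler_wpM2r ?cabs_ge0 // (bigD1 j) //= addrCA lerDl addr_ge0 // sumr_ge0 // => k _.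
by have [] := HL k.
Qed.

End SchwarzPick.

(** * Polydisks, slices and the two invariants *)

Section Slices.
Context {K : realType} (n : nat) (hn : (2 <= n)%N).

Definition axis : 'rV[K[i]]_n := delta_mx 0 (ord_first hn).

Lemma axis_first t : (t *: axis) 0 (ord_first hn) = t.
Proof. by rewrite !mxE !eqxx mulr1. Qed.

Lemma axis_other t j : j != ord_first hn -> (t *: axis) 0 j = 0.
Proof. by move=> /negPf j1; rewrite !mxE j1 andbF mulr0. Qed.

Lemma first_axisE (z : 'rV[K[i]]_n) : first_axis hn z ->
  z = z 0 (ord_first hn) *: axis.
Proof.
move=> z0; apply/rowP => j; have [->|j1] := eqVneq j (ord_first hn).
  by rewrite axis_first.
by rewrite axis_other // z0.
Qed.

Lemma nrm_axis (t : K[i]) : nrm (t *: axis) <= cabs t.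
Proof. by rewrite nrmZ ler_piMr ?cabs_ge0 ?nrm_delta. Qed.

Lemma polydisk_axis (r : K) t : 0 < r -> polydisk r (t *: axis) <-> cabs t < r.
Proof.
move=> r0; split=> [/(_ (ord_first hn))|tr j]; first by rewrite axis_first.
have [->|j1] := eqVneq j (ord_first hn); first by rewrite axis_first.
by rewrite axis_other // cabs0.
Qed.

Lemma polydisk_open m (r : K) (x : 'rV[K[i]]_m) : polydisk r x ->
  exists2 d : K, 0 < d & forall y, nrm (y - x) < d -> polydisk r y.
Proof.
move=> xr; have [|d d0 Hd] := @finite_min K 'I_m (fun j => r - cabs (x 0 j)).
  by move=> j; rewrite subr_gt0.
exists d => // y yd j; have := cabs_coord_le (y - x) j; rewrite !mxE => H.
have := Hd j; have := cabsD (y 0 j - x 0 j) (x 0 j); rewrite subrK; lra.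
Qed.

Lemma frontier_polydisk_axis (r : K) (z : 'rV[K[i]]_n) : 0 < r ->
  (frontier (polydisk r) `&` first_axis hn) z <->
  exists2 t, cabs t = r & z = t *: axis.
Proof.
move=> r0; split=> [[[cz iz] az]|[t tr ->]].
  exists (z 0 (ord_first hn)); last exact: first_axisE.
  have zE := first_axisE az; apply/eqP; rewrite eq_le; apply/andP; split.
    apply/ler_addgt0Pr => e e0.
    have [y [yr]] := cz [set y | nrm (y - z) < e] ((nrm_nbhs z _).2 (ex_intro2 _ _ e e0 (fun y h => h))).
    have := yr (ord_first hn); have := cabs_coord_le (y - z) (ord_first hn); rewrite !mxE /=.
    have := cabs_dist (z 0 (ord_first hn)) (y 0 (ord_first hn)).
    rewrite [cabs (z _ _ - _)]cabs_distC; lra.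
  rewrite leNgt; apply/negP => zr; apply: iz; apply/nrm_nbhs.
  by apply: polydisk_open; rewrite zE; apply/polydisk_axis.
have tC (s : K) : 0 < s -> cabs (s%:C * t) = s * r by move=> s0; rewrite cabsM cabs_pos // tr.
split; last by move=> j j1; rewrite axis_other.
have near (e s : K) : 0 < e -> `|s - 1| < e / (r + 1) -> 0 < s ->
    nrm ((s%:C * t) *: axis - t *: axis) < e.
  move=> e0 se s0; rewrite -scalerBl (le_lt_trans (nrm_axis _)) //.
  have -> : s%:C * t - t = (s - 1)%:C * t by rewrite rmorphB rmorph1 mulrBl mul1r.
  rewrite cabsM cabs_real tr; apply: (@le_lt_trans _ _ (`|s - 1| * (r + 1))).
    by rewrite ler_wpM2l // lerDl.
  by rewrite -ltr_pdivlMr // addr_gt0.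
have r1 : 0 < r + 1 by rewrite addr_gt0.
split.
  move=> B /nrm_nbhs[e e0 HB]; pose c := Num.min (e / (r + 1)) 1 / 2.
  have mn0 : 0 < Num.min (e / (r + 1)) 1 by rewrite lt_min ltr01 divr_gt0.
  have c0 : 0 < c by rewrite divr_gt0.
  have ce : c < Num.min (e / (r + 1)) 1 by rewrite half_lt.
  move: ce; rewrite lt_min => /andP[ce c1].
  have s0 : 0 < 1 - c by rewrite subr_gt0.
  exists (((1 - c)%:C * t) *: axis); split.
    apply/polydisk_axis => //; rewrite tC //.
    by rewrite mulrBl mul1r gtrBl mulr_gt0.
  apply: HB; apply: near => //.
  by rewrite addrKC normrN gtr0_norm.
move=> /nrm_nbhs[e e0 HB]; pose c := e / (r + 1) / 2.
have er : 0 < e / (r + 1) by rewrite divr_gt0.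
have c0 : 0 < c by rewrite divr_gt0.
have ce : c < e / (r + 1) by rewrite half_lt.
have s0 : 0 < 1 + c by rewrite addr_gt0.
have : polydisk r (((1 + c)%:C * t) *: axis).
  by apply: HB; apply: near => //; rewrite addrKC gtr0_norm.
move=> /(polydisk_axis _ r0); rewrite tC // mulrDl mul1r gtrDl => /lt_trans/(_ (mulr_gt0 c0 r0)).
by rewrite ltxx.
Qed.

End Slices.

Section Domain.
Context {K : realType} (n : nat) (hn : (2 <= n)%N) (m : nat) (a : 'I_m -> K[i]) (R : K).
Context (R1 : R < 1) (aR : forall i, cabs (a i) = R).

Let D : set 'rV[K[i]]_n := polydisk 1 `\` \bigcup_i hyperplane (ord_first hn) (a i).

Let e1 : 'rV[K[i]]_n := axis hn.

Lemma domainP x : D x <-> polydisk 1 x /\ x 0 (ord_first hn) \notin codom a.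
Proof.
split=> [[x1 xA]|[x1 xa]]; split=> //.
  by apply/negP => /codomP[i xi]; apply: xA; exists i.
by move=> [i _ xi]; case/negP: xa; rewrite xi codom_f.
Qed.

Lemma domain_axis t : cabs t < 1 -> t \notin codom a -> D (t *: e1).
Proof.
by move=> t1 ta; apply/domainP; rewrite axis_first; split=> //; apply/polydisk_axis.
Qed.

Lemma domain_open x : D x -> exists2 d : K, 0 < d & forall y, nrm (y - x) < d -> D y.
Proof.
move=> /domainP[x1 xa]; have [d1 d10 H1] := polydisk_open x1.
have [|d2 d20 H2] := @finite_min K 'I_m (fun i => cabs (x 0 (ord_first hn) - a i)).
  move=> i; rewrite cabs_gt0 subr_eq0; apply: contraNneq xa => ->; exact: codom_f.
exists (Num.min d1 d2); first by rewrite lt_min d10.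
move=> y; rewrite lt_min => /andP[/H1 y1 y2]; apply/domainP; split=> //.
apply/negP => /codomP[i yi]; have := cabs_coord_le (y - x) (ord_first hn).
by rewrite !mxE yi cabs_distC leNgt (lt_le_trans y2).
Qed.

Lemma domain_isolated i : exists r : K, [/\ 0 < r, r < 1 - R &
  forall t, cabs (t - a i) <= r -> t != a i -> cabs t < 1 /\ t \notin codom a].
Proof.
have [|d d0 Hd] := @finite_min K 'I_m
    (fun k => if a k == a i then 1 else cabs (a k - a i)).
  by move=> k; case: eqP => // /eqP aki; rewrite cabs_gt0 subr_eq0.
exists (Num.min d (1 - R) / 2).
have R10 : 0 < 1 - R by rewrite subr_gt0.
have mn0 : 0 < Num.min d (1 - R) by rewrite lt_min d0.
have : Num.min d (1 - R) / 2 < Num.min d (1 - R) by rewrite half_lt.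
rewrite lt_min => /andP[rd rR]; split=> //; first by rewrite divr_gt0.
move=> t tr ta; split.
  by have := cabsD (t - a i) (a i); rewrite subrK aR; lra.
apply/negP => /codomP[k tk]; have := Hd k; rewrite -tk (negPf ta).
by rewrite leNgt (le_lt_trans tr).
Qed.

Lemma holo_slice (W : normedModType K[i]) (f : 'rV[K[i]]_n -> W) t :
  (forall x, D x -> differentiable f x) -> cabs t < 1 -> t \notin codom a ->
  differentiable (fun s : K[i] => f (s *: e1)) t.
Proof.
move=> df t1 ta; have dft := df _ (domain_axis t1 ta).
have [ds _] := @diff_line K _ W f 0 e1 t (eq_ind_r (fun z => differentiable f z) dft (add0r _)).
by apply: (diff_near_eq ltr01 _ ds).1 => s _; rewrite add0r.
Qed.

(** Bounded holomorphic functions do not see the removed hyperplanes. *)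
Lemma slice_schwarz_pick (g : 'rV[K[i]]_n -> K[i]) z t :
  (forall x, D x -> differentiable g x) -> (forall x, D x -> cabs (g x) <= 1) ->
  cabs z < 1 -> z \notin codom a -> g (z *: e1) = 0 ->
  cabs t < 1 -> t \notin codom a -> cabs (g (t *: e1)) <= cabs (mobius z t).
Proof.
move=> dg g1 z1 za gz t1 ta.
apply: (@schwarz_pick K (fun s : K[i] => g (s *: e1)) (codom a) R z t) => //.
- by move=> s /codomP[i ->]; rewrite aR.
- by move=> s s1 sa; exact: holo_slice.
- by move=> s s1 sa; apply: g1; exact: domain_axis.
Qed.

Lemma mobius_continuous_est z (b : K[i]) e : cabs z < 1 -> cabs b < 1 -> 0 < e ->
  exists2 d : K, 0 < d & forall t, cabs (t - b) < d ->
    cabs (mobius z t) < cabs (mobius z b) + e.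
Proof.
move=> z1 b1 e0; have dm := differentiable_mobius z1 (ltW b1).
have [d d0 Hd] := continuous_est (differentiable_continuous dm) e0.
exists d => // t td; have := Hd t td; rewrite nrm_cabs.
have := cabs_dist (mobius z t) (mobius z b); lra.
Qed.

Lemma holo_near_open m' k (f : 'rV[K[i]]_m' -> 'rV[K[i]]_k) (X : set 'rV[K[i]]_m') x :
  (forall x, X x -> exists2 d : K, 0 < d & forall y, nrm (y - x) < d -> X y) ->
  (forall x, X x -> differentiable f x) -> X x -> holo_near f x.
Proof. by move=> Xo df Xx; have [d d0 Hd] := Xo x Xx; exists d => // y /Hd; exact: df. Qed.

(** Along the first axis the components of a competing map [f] have, by Riemann
    and Schwarz-Pick, a limit of modulus at most [cabs (mobius z (a i))] at the
    puncture [a i]. If this limit were a value of [f], openness would contradict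
    injectivity. *)
Lemma squeezing_le z i : cabs z < 1 -> z \notin codom a ->
  (squeezing D (z *: e1) <= (cabs (mobius z (a i)))%:E)%E.
Proof.
move=> z1 za; apply: ge_ereal_sup => _ [s [s0 [f [[df fD] finj fz fs]]] <-].
rewrite lee_fin leNgt; apply/negP => ms.
have b1 : cabs (a i) < 1 by rewrite aR.
have [r [r0 rR iso]] := domain_isolated i.
pose G j t := f (t *: e1) 0 j.
have GB j x : D x -> cabs (f x 0 j) < 1 by move=> /fD /(_ j).
have dfj j x : D x -> differentiable (fun x => f x 0 j) x.
  by move=> Dx; exact: (diff_coord j (df x Dx)).1.
have dG j t : cabs (t - a i) <= r -> t != a i -> differentiable (G j) t.
  by move=> tr ta; have [t1 tS] := iso t tr ta; exact: (holo_slice (dfj j)).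
have G1 j t : cabs (t - a i) <= r -> t != a i -> cabs (G j t) <= 1.
  by move=> tr ta; have [t1 tS] := iso t tr ta; apply/ltW/GB/domain_axis.
have [w [Lm Lm0 lim]] : exists w, exists2 L : K, 0 < L &
    forall t : K[i], cabs (t - a i) <= r / 2 -> t != a i ->
      nrm (f (t *: e1) - w) <= L * cabs (t - a i).
  exact: (punctured_limit_row (u := fun t => f (t *: e1)) r0 dG G1).
have pt (d : K) := punctured_point (a i) (r := r / 2) ^~ (divr_gt0 r0 (ltr0n _ 2)) : 0 < d -> _.
have wc j : cabs (w 0 j) <= cabs (mobius z (a i)).
  apply/ler_addgt0Pr => e e0.
  have e2 : 0 < e / 2 by rewrite divr_gt0.
  have [d d0 Hd] := mobius_continuous_est z1 b1 e2.
  have m0 : 0 < Num.min d (e / 2 / Lm) by rewrite lt_min d0 divr_gt0.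
  have [t] := pt _ m0; rewrite lt_min => /andP[td te] [ta tr].
  have tr' : cabs (t - a i) <= r by lra.
  have [t1 tS] := iso t tr' ta.
  have h1 := slice_schwarz_pick (dfj j) (fun x Dx => ltW (GB j x Dx)) z1 za
    (etrans (congr1 (fun x : 'rV[K[i]]_n => x 0 j) fz) (mxE _ _ _ _)) t1 tS.
  have h2 := Hd t td.
  have h3 := le_trans (cabs_coord_le (f (t *: e1) - w) j) (lim t tr ta).
  have h4 : Lm * cabs (t - a i) <= e / 2 by rewrite mulrC -ler_pdivlMr // ltW.
  move: h3; rewrite !mxE => h3.
  have h5 := cabs_dist (w 0 j) (f (t *: e1) 0 j); rewrite cabs_distC in h5.
  lra.
have [q Dq fq] : (f @` D) w.
  by apply: fs => j; exact: le_lt_trans (wc j) ms.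
pose p := a i *: e1.
(* [q] is not the missing point, so a neighbourhood of [q] and the points of the
   axis near the puncture are disjoint, yet [f] takes a common value on them *)
have pq : q != p.
  by apply/eqP => qp; move: Dq => /domainP[_]; rewrite qp axis_first codom_f.
have qp0 : 0 < nrm (q - p) by rewrite nrm_gt0 subr_eq0.
have hfq : holo_near f q by apply: (holo_near_open domain_open df Dq).
have [dq dq0 Hq] := domain_open Dq.
have finj' x y : D x -> D y -> f x = f y -> x = y.
  by move=> Dx Dy; apply: finj; rewrite inE.
have jfq : injective_near f q by exists dq => // x y /Hq Dx /Hq Dy; exact: finj'.
have eps0 : 0 < Num.min dq (nrm (q - p) / 2) by rewrite lt_min dq0 divr_gt0.
have [d d0 Hd] := open_image hfq (osgood hfq jfq) eps0.
have m0 : 0 < Num.min (d / Lm) (nrm (q - p) / 2) by rewrite lt_min !divr_gt0.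
have [t] := pt _ m0; rewrite lt_min => /andP[td te] [ta tr].
have tr' : cabs (t - a i) <= r by lra.
have [t1 tS] := iso t tr' ta.
have [|x] := Hd (f (t *: e1)).
  rewrite fq (le_lt_trans (lim t tr ta)) // mulrC -ltr_pdivlMr //.
rewrite lt_min => /andP[/Hq Dx xq] fx.
have xE := finj' _ _ Dx (domain_axis t1 tS) fx.
have : nrm (x - p) <= cabs (t - a i) by rewrite xE -scalerBl nrm_axis.
have := nrmB (x - q) (x - p); rewrite opprB addrC subrKA nrm_distC; lra.
Qed.

Lemma caratheodory_axis_le z t : cabs z < 1 -> z \notin codom a ->
  cabs t < 1 -> t \notin codom a ->
  (caratheodory D (z *: e1) (t *: e1) <= (artanh (cabs (mobius z t)))%:E)%E.
Proof.
move=> z1 za t1 ta; apply: ge_ereal_sup => _ [l [g [[dg gD] gz gt]] <-].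
rewrite lee_fin -gt; apply: artanh_le; last exact: cabs_mobius_lt1.
  by rewrite (lt_le_trans _ (cabs_ge0 _)) // oppr_lt0.
by apply: slice_schwarz_pick => // x Dx; apply/ltW/gD.
Qed.

(** The inverse [u] of a competing map [f] is holomorphic on a punctured disk
    of the first axis, hence has a limit, still inside the open polydisk, at the
    puncture [a i]; its image under [f] would be the missing point. *)
Lemma fridman_le z i : cabs z < 1 -> z \notin codom a ->
  (fridman D (z *: e1) <= (cabs (mobius z (a i)))%:E)%E.
Proof.
move=> z1 za; apply: ge_ereal_sup => _ [s [s0 [f [[df fD] finj fB]]] <-].
rewrite lee_fin leNgt; apply/negP => ms.
have b1 : cabs (a i) < 1 by rewrite aR.
have [r [r0 rR iso]] := domain_isolated i.
have e0 : 0 < tanh s - cabs (mobius z (a i)) by rewrite subr_gt0.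
have [d d0 Hd] := mobius_continuous_est z1 b1 e0.
have [r' [r'0 r'r r'd]] : exists r' : K, [/\ 0 < r', r' <= r & r' < d].
  exists (Num.min r (d / 2)); split.
  - by rewrite lt_min r0 divr_gt0.
  - by rewrite ge_min lexx.
  - by rewrite gt_min orbC half_lt.
have inB t : cabs (t - a i) <= r' -> t != a i -> caratheodory_ball D (z *: e1) s (t *: e1).
  move=> tr ta; have [t1 tS] := iso t (le_trans tr r'r) ta.
  split; first exact: domain_axis.
  apply: (le_lt_trans (caratheodory_axis_le z1 za t1 tS)); rewrite lte_fin.
  apply: artanh_lt; first by rewrite (lt_le_trans _ (cabs_ge0 _)) // oppr_lt0.
    exact: cabs_mobius_lt1.
  by have := Hd t (le_lt_trans tr r'd); rewrite subrKC.
have /choice[u Hu] t : exists x, cabs (t - a i) <= r' -> t != a i ->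
    polydisk 1 x /\ f x = t *: e1.
  have [/andP[tr ta]|nt] := boolP ((cabs (t - a i) <= r') && (t != a i)).
    by have [x x1 fx] := fB _ (inB t tr ta); exists x.
  by exists 0 => tr ta; case/negP: nt; rewrite tr ta.
have finj' x y : polydisk 1 x -> polydisk 1 y -> f x = f y -> x = y.
  by move=> Dx Dy; apply: finj; rewrite inE.
have hf x : polydisk 1 x -> holo_near f x.
  by move=> x1; apply: (holo_near_open _ df x1) => y; exact: polydisk_open.
have du t : cabs (t - a i) < r' -> t != a i -> differentiable u t.
  move=> tr ta; have [ut fut] := Hu t (ltW tr) ta.
  have [dq dq0 Hq] := polydisk_open ut.
  have jf : injective_near f (u t) by exists dq => // x y /Hq Dx /Hq Dy; exact: finj'.
  apply: (@differentiable_preimage_line K n f (polydisk 1) u e1 t) => //.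
  - by exists dq.
  - exact: hf.
  - exact: osgood (hf _ ut) jf.
  - have ta0 : 0 < cabs (t - a i) by rewrite cabs_gt0 subr_eq0.
    exists (Num.min (r' - cabs (t - a i)) (cabs (t - a i))).
      by rewrite lt_min subr_gt0 tr.
    move=> t'; rewrite lt_min => /andP[h1 h2]; apply: Hu.
      have := cabsD (t' - t) (t - a i); rewrite subrKA; lra.
    by apply: contraTneq h2 => ->; rewrite cabs_distC ltxx.
have r'2 : 0 < r' / 2 by rewrite divr_gt0.
have r'2r : r' / 2 < r' by rewrite half_lt.
have duj j t : cabs (t - a i) <= r' / 2 -> t != a i -> differentiable (fun t : K[i] => u t 0 j) t.
  by move=> tr ta; apply: (diff_coord j (du t _ ta)).1; exact: le_lt_trans r'2r.
have u1 j t : cabs (t - a i) <= r' / 2 -> t != a i -> cabs (u t 0 j) < 1.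
  by move=> tr ta; have [|/(_ j) H _] := Hu t _ ta; first exact/ltW/(le_lt_trans tr).
have [w [Lm Lm0 lim]] : exists w, exists2 L : K, 0 < L &
    forall t : K[i], cabs (t - a i) <= r' / 2 / 2 -> t != a i ->
      nrm (u t - w) <= L * cabs (t - a i).
  apply: (punctured_limit_row (M := 1) r'2 duj) => j t tr ta; exact/ltW/u1.
have pt (d' : K) := punctured_point (a i) (r := r' / 2 / 2) ^~ (divr_gt0 r'2 (ltr0n _ 2)) : 0 < d' -> _.
have w1 : polydisk 1 w.
  move=> j; have [M M1 HM] := punctured_strict r'2 (duj j) (u1 j).
  suff : cabs (w 0 j) <= M by move=> /le_lt_trans; exact.
  apply/ler_addgt0Pr => e e'0; have [t] := pt _ (divr_gt0 e'0 Lm0).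
  rewrite ltr_pdivlMr // => te [ta tr]; have := HM t tr ta.
  have := cabs_coord_le (u t - w) j; have := lim t tr ta; rewrite !mxE.
  have := cabs_dist (w 0 j) (u t 0 j); rewrite cabs_distC; lra.
have fw : f w = a i *: e1.
  apply/eqP; rewrite -subr_eq0 -nrm_eq0 eq_le nrm_ge0 andbT.
  apply/ler_addgt0Pr => e e'0; rewrite add0r.
  have e2 : 0 < e / 2 by rewrite divr_gt0.
  have [d' d'0 Hd'] := continuous_est (differentiable_continuous (df w w1)) e2.
  have m0 : 0 < Num.min (d' / Lm) (e / 2) by rewrite lt_min e2 divr_gt0.
  have [t] := pt _ m0; rewrite lt_min => /andP[td te] [ta tr].
  have tr' : cabs (t - a i) <= r' by lra.
  have [_ fut] := Hu t tr' ta.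
  have := Hd' (u t); rewrite (le_lt_trans (lim t tr ta)); last by rewrite mulrC -ltr_pdivlMr.
  rewrite fut => /(_ isT) H.
  have := nrmB (t *: e1 - f w) (t *: e1 - a i *: e1).
  rewrite opprB addrC subrKA nrm_distC -scalerBl.
  have := nrm_axis hn (t - a i); rewrite -/e1; lra.
by move: (fD w w1) => /domainP[_]; rewrite fw axis_first codom_f.
Qed.

End Domain.

(** * Circle means *)

Section CircleMean.
Context {K : realType}.

(** Monotonicity without measurability: the integral of a nonnegative function
    is a supremum over simple functions below it. *)
Lemma ge0_integral_mono d (T : measurableType d) (mu : {measure set T -> \bar K})
    (A : set T) (f g : T -> \bar K) :
  (forall x, A x -> (0 <= f x <= g x)%E) ->
  (\int[mu]_(x in A) f x <= \int[mu]_(x in A) g x)%E.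
Proof.
move=> fg; rewrite !(integral_mkcond A).
have f0 x : (0 <= (f \_ A) x)%E.
  by apply: erestrict_ge0 => y /fg /andP[].
have g0 x : (0 <= (g \_ A) x)%E.
  by apply: erestrict_ge0 => y /fg /andP[/le_trans]; apply.
rewrite !ge0_integralTE //; apply: le_ereal_sup => _ [h hf <-].
exists h => // x; apply: (le_trans (hf x)).
by apply: lee_restrict => y /fg /andP[].
Qed.

Lemma circle_mean_le (g : K[i] -> \bar K) (c : K[i]) (rho M : K) : 0 <= M ->
  (forall t, t \in `[0, 2 * pi] -> (g (c + rho%:C * (cos t +i* sin t))%R <= M%:E)%E) ->
  (circle_mean g c rho <= M%:E)%E.
Proof.
move=> M0 gM; have pi2 : 0 < 2 * pi :> K by rewrite mulr_gt0 // pi_gt0.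
have H : (\int[lebesgue_measure]_(t in `[0%R, (2 * pi)%R])
     g (c + rho%:C * (cos t +i* sin t))%R <= (2 * pi)%:E * M%:E)%E.
  rewrite integralE; apply: (@le_trans _ _ (\int[lebesgue_measure]_(t in `[0%R, (2 * pi)%R]) M%:E)%E).
    apply: (@le_trans _ _ (\int[lebesgue_measure]_(t in `[0%R, (2 * pi)%R])
       ((fun t => g (c + rho%:C * (cos t +i* sin t))%R)^\+ t))%E).
      by rewrite geeDl // oppe_le0; exact: integral_ge0.
    apply: ge0_integral_mono => t tI; rewrite funepos_ge0 /=.
    by rewrite funeposE ge_max gM // lee_fin.
  rewrite integral_cst //= lebesgue_measure_itv /= lte_fin pi2 muleC.
  by rewrite -EFinB subr0.
rewrite /circle_mean; apply: (le_trans (lee_wpmul2l _ H)).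
  by rewrite lee_fin invr_ge0 ltW.
by rewrite muleA -!EFinM mulVf ?gt_eqF // mul1r.
Qed.

(** The sum [F] of the positive parts is continuous and positive, hence has a
    positive minimum on the segment, and one of the [m] summands carries its
    share of it. *)
Lemma uniform_positive m (f : 'I_m -> K -> K) (a b : K) : a <= b ->
  (forall i, continuous (f i)) ->
  (forall t, t \in `[a, b] -> exists i, 0 < f i t) ->
  exists2 k : K, 0 < k & forall t, t \in `[a, b] -> exists i, k <= f i t.
Proof.
move=> ab cf fp; pose F t := \sum_i Num.max (f i t) 0.
have cF : continuous F.
  move=> t; rewrite /F; elim: (index_enum _) => [|i s IH].
    rewrite (_ : (fun _ => _) = cst 0); first exact: cst_continuous.
    by apply/funext => x; rewrite big_nil.
  rewrite (_ : (fun _ => _) = (fun t => Num.max (f i t) 0) \+ (fun t => \sum_(i <- s) Num.max (f i t) 0)).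
    apply: continuousD; last exact: IH.
    apply: (@continuous_max _ _ (f i) (cst 0)); first exact: cf.
    exact: cst_continuous.
  by apply/funext => x; rewrite big_cons.
have [c cab minF] := EVT_min ab (continuous_subspaceT cF).
have Fge0 i t : 0 <= Num.max (f i t) 0 by rewrite le_max lexx orbT.
have Fc : 0 < F c.
  have [i fi] := fp c cab; rewrite /F (bigD1 i) //= ltr_pwDl ?sumr_ge0 //.
  by rewrite lt_max fi.
have m0 : 0 < m.+1%:R :> K by rewrite ltr0n.
exists (F c / m.+1%:R); first exact: divr_gt0.
move=> t tab; apply/not_existsP => no; have := minF t tab; apply/negP.
rewrite -ltNge; apply: (@le_lt_trans _ _ (\sum_(i < m) F c / m.+1%:R)).
  apply: ler_sum => i _; rewrite ge_max (ltW (divr_gt0 Fc m0)) andbT.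
  by rewrite leNgt; apply/negP => /ltW; exact: no.
rewrite sumr_const card_ord -[_ *+ m]mulr_natr -mulrA gtr_pMr //.
by rewrite mulrC ltr_pdivrMr // mul1r ltr_nat.
Qed.

End CircleMean.

(** * Failure of the sub-mean value inequality *)

Section Bounds.
Context {K : realType} (n : nat).

Lemma squeezing_ge (D : set 'rV[K[i]]_n) (R : K) : 0 < R -> D `<=` polydisk 1 ->
  polydisk R `<=` D -> (R%:E <= squeezing D 0)%E.
Proof.
move=> R0 D1 RD; apply: ereal_sup_ubound; exists R => //; split=> //.
exists id; split=> //.
by move=> x /RD Dx; exists x.
Qed.

Lemma artanh_le_caratheodory (D : set 'rV[K[i]]_n) z w (g : 'rV[K[i]]_n -> K[i]) :
  holo D unit_disk g -> g z = 0 ->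
  ((artanh (cabs (g w)))%:E <= caratheodory D z w)%E.
Proof.
by move=> hg gz; apply: ereal_sup_ubound; exists (g w) => //; exists g.
Qed.

(** The competing embedding is the homothety of ratio [R]; the coordinates, as
    test functions, keep the Caratheodory ball inside the polydisk of radius [R]. *)
Lemma fridman_ge (D : set 'rV[K[i]]_n) (R : K) : 0 < R -> R < 1 ->
  D `<=` polydisk 1 -> polydisk R `<=` D -> (R%:E <= fridman D 0)%E.
Proof.
move=> R0 R1 D1 RD; have Rm1 : -1 < R by lra.
apply: ereal_sup_ubound; exists (artanh R); last by rewrite tanh_artanh.
have RC : cabs R%:C = R :> K by rewrite cabs_real gtr0_norm.
have RC0 : R%:C != 0 :> K[i] by rewrite -cabs_eq0 RC gt_eqF.
split.
  by rewrite /artanh mulr_gt0 ?invr_gt0 // ln_gt0 // ltr_pdivlMr; lra.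
exists (fun w => R%:C *: w); split.
- split=> [w _|w w1]; first exact: differentiableZ.
  apply: RD => j; rewrite !mxE cabsM RC gtr_pMr //; exact: w1.
- move=> x y _ _ /(congr1 (fun w => R%:C^-1 *: w)).
  by rewrite !scalerA mulVf // !scale1r.
move=> w [Dw cw]; exists (R%:C^-1 *: w); last by rewrite scalerA mulfV // scale1r.
move=> j; rewrite !mxE cabsM cabsV RC mulrC ltr_pdivrMr // mul1r.
apply: (lt_of_artanh_lt (D1 w Dw j) Rm1); rewrite -lte_fin.
apply: le_lt_trans cw.
apply: (@artanh_le_caratheodory _ _ _ (fun w : 'rV[K[i]]_n => w 0 j)).
  split=> z Dz; last exact: D1.
  by apply: (diff_coord j _).1; exact: ex_diff.
by rewrite mxE.
Qed.

Lemma tanh_le_etanh (x : K) (e : \bar K) : (x%:E <= e)%E -> tanh x <= etanh e.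
Proof.
case: e => [y||] //=; first by rewrite lee_fin; exact: tanh_le.
by rewrite tanhE gerBl divr_ge0 // addr_ge0 // sqr_ge0.
Qed.

(** A coordinate followed by a disk automorphism is a test function. *)
Lemma mobius_le_caratheodory (z w : 'rV[K[i]]_n) j : polydisk 1 z -> polydisk 1 w ->
  cabs (mobius (z 0 j) (w 0 j)) <= etanh (caratheodory (polydisk 1) z w).
Proof.
move=> z1 w1; have m1 := cabs_mobius_lt1 (z1 j) (w1 j).
rewrite -{1}(@tanh_artanh _ (cabs (mobius (z 0 j) (w 0 j)))) //; last first.
  by rewrite (lt_le_trans _ (cabs_ge0 _)) // oppr_lt0.
apply: tanh_le_etanh.
apply: (@artanh_le_caratheodory _ _ _ (fun x : 'rV[K[i]]_n => mobius (z 0 j) (x 0 j))).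
  split=> x x1; last exact: cabs_mobius_lt1.
  apply: (@differentiable_comp _ _ _ _ (fun x : 'rV[K[i]]_n => x 0 j) (mobius (z 0 j))).
    by apply: (diff_coord j _).1; exact: ex_diff.
  by apply: differentiable_mobius => //; apply/ltW/x1.
by rewrite /mobius subrr mul0r.
Qed.

End Bounds.

Section Circle.
Context {K : realType} (r R : K) (m : nat) (a : 'I_m -> K[i]).
Implicit Type t : K.

Let zeta t : K[i] := r%:C * (cos t +i* sin t).

Lemma cabs_circle t : 0 <= r -> cabs (r%:C * (cos t +i* sin t)) = r.
Proof.
move=> r0; rewrite cabsM cabs_real ger0_norm //.
have : cabs (cos t +i* sin t) ^+ 2 == 1 by rewrite cabs_sqr /= cos2Dsin2.
by rewrite sqrp_eq1 ?cabs_ge0 // => /eqP ->; rewrite mulr1.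
Qed.

(** On a circle the hyperbolic distance to a given point is a continuous
    function of the angle, so compactness makes the covering uniform. *)
Lemma uniform_cover : 0 < r -> r < R -> R < 1 -> (forall i, cabs (a i) = R) ->
  (forall x, cabs x = r -> exists i, cabs (mobius x (a i)) < R) ->
  exists M : K, [/\ 0 <= M, M < R & forall t, t \in `[0, 2 * pi] ->
    exists i, cabs (mobius (r%:C * (cos t +i* sin t)) (a i)) <= M].
Proof.
move=> r0 rR R1 aR cov; have R0 : 0 < R by lra.
(* [R ^+ 2 - cabs (mobius _ (a i)) ^+ 2] without its denominator, expanded so that
   continuity in [t] is evident *)
pose f i t := R ^+ 2 * (1 + r ^+ 2 * R ^+ 2) - R ^+ 2 - r ^+ 2 +
  (2 * r * (1 - R ^+ 2) * Re (a i) * cos t + 2 * r * (1 - R ^+ 2) * Im (a i) * sin t).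
have fE i t : f i t =
    R ^+ 2 * cabs (1 - (zeta t)^* * a i) ^+ 2 - cabs (a i - zeta t) ^+ 2.
  have := cabs_sqr (a i); rewrite aR /f /zeta; case: (a i) => x y /= E.
  rewrite !cabs_sqr /=; move: (cos t) (sin t) (cos2Dsin2 t) => c s cs.
  have r2 : r ^+ 2 = r ^+ 2 * (c ^+ 2 + s ^+ 2) by rewrite cs mulr1.
  by rewrite E r2; ring.
have z1 t : cabs (zeta t) < 1 by rewrite cabs_circle; lra.
have a1 i : cabs (a i) <= 1 by rewrite aR ltW.
have d0 i t : 0 < cabs (1 - (zeta t)^* * a i).
  by rewrite cabs_gt0 mobius_den_neq0.
have mE i t : cabs (mobius (zeta t) (a i)) ^+ 2 =
    R ^+ 2 - f i t / cabs (1 - (zeta t)^* * a i) ^+ 2.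
  rewrite fE /mobius cabsM cabsV; have := lt0r_neq0 (d0 i t).
  by move: (cabs (1 - _)) (cabs (_ - zeta t)) => p q p0; field.
have [|||k k0 Hk] := @uniform_positive K m f 0 (2 * pi).
- by rewrite mulr_ge0 // pi_ge0.
- move=> i t; rewrite /f; apply: cvgD; first exact: cvg_cst.
  apply: cvgD; apply: cvgM; try exact: cvg_cst.
    exact: continuous_cos.
  exact: continuous_sin.
- move=> t _; have [|i mi] := cov (zeta t); first by rewrite cabs_circle // ltW.
  exists i; have : cabs (mobius (zeta t) (a i)) ^+ 2 < R ^+ 2.
    by rewrite ltrXn2r ?cabs_ge0.
  by rewrite mE gtrDl oppr_lt0 pmulr_lgt0 // invr_gt0 exprn_gt0.
(* the denominator is at most 2 in modulus, whence the 4 *)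
exists (Num.sqrt (R ^+ 2 - k / 4)); split; first exact: sqrtr_ge0.
  rewrite -[ltRHS](@gtr0_norm _ R) // -sqrtr_sqr ltr_sqrt ?exprn_gt0 //; lra.
move=> t /Hk[i ki]; exists i.
rewrite -[leLHS](@ger0_norm _ _ (cabs_ge0 _)) -sqrtr_sqr ler_wsqrtr // -/(zeta t) mE.
rewrite lerD2l lerN2; apply: ler_pM; rewrite ?invr_ge0 ?(ltW k0) //.
rewrite lef_pV2 ?posrE ?exprn_gt0 //.
have : cabs (1 - (zeta t)^* * a i) <= 2.
  rewrite (le_trans (cabsB _ _)) // cabs1 cabsM cabs_conj.
  have := ler_pM (cabs_ge0 _) (cabs_ge0 _) (ltW (z1 t)) (a1 i); lra.
move: (ltW (d0 i t)); nra.
Qed.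

End Circle.

Section MeanValue.
Context {K : realType} (n : nat) (hn : (2 <= n)%N) (m : nat) (a : 'I_m -> K[i]) (r R : K).

Lemma not_plurisubharmonic (u : 'rV[K[i]]_n -> \bar K) :
  0 < r -> r < R -> R < 1 -> (forall i, cabs (a i) = R) ->
  (forall x, cabs x = r -> exists i, cabs (mobius x (a i)) < R) ->
  (R%:E <= u 0%R)%E ->
  (forall x i, cabs x < 1 -> x \notin codom a ->
    (u (x *: axis hn)%R <= (cabs (mobius x (a i)))%:E)%E) ->
  ~ plurisubharmonic (polydisk 1 `\` \bigcup_i hyperplane (ord_first hn) (a i)) u.
Proof.
move=> r0 rR R1 aR cov u0 ub [_ _ /(_ 0 (axis hn))[_ _ /(_ 0 r r0) mv]].
have na x : cabs x <= r -> x \notin codom a.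
  by move=> xr; apply/negP => /codomP[i xi]; move: xr; rewrite xi aR; lra.
have [M [M0 MR HM]] := uniform_cover r0 rR R1 aR cov.
have : (R%:E <= M%:E)%E.
  apply: (le_trans u0); move: mv; rewrite scale0r addr0 => mv.
  apply: (le_trans (mv _)); last first.
    apply: circle_mean_le => // t /HM[i Hi]; rewrite !add0r.
    apply: (@le_trans _ _ _ _ _ (ub _ i _ _)); last by rewrite lee_fin.
      by rewrite cabs_circle ?(ltW r0); lra.
    by apply: na; rewrite cabs_circle // ltW.
  move=> x /=; rewrite subr0 add0r => xr; apply: domain_axis; last exact: na.
  lra.
by rewrite lee_fin leNgt MR.
Qed.

End MeanValue.

Theorem theorem4p6 (K : realType) (n : nat) (hn : (2 <= n)%N)
    (r R : K) (hr : 0 < r) (hrR : r < R) (hR : R < 1)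
    (delta : K) (hdelta : 0 < delta)
    (hball : forall z : 'rV[K[i]]_n,
      (frontier (polydisk r) `&` first_axis hn) z ->
      let p := (R / r)%:C *: z in
      eball z delta `<=` polydisk 1 /\
      forall w, eball z delta w ->
        etanh (caratheodory (polydisk 1) p w) < R)
    (m : nat) (z : 'I_m -> 'rV[K[i]]_n)
    (hz : forall i, (frontier (polydisk r) `&` first_axis hn) (z i))
    (hcover : frontier (polydisk r) `&` first_axis hn `<=`
      \bigcup_i eball (z i) delta) :
  let p i := (R / r)%:C *: z i in
  let H i := hyperplane (ord_first hn) (p i 0 (ord_first hn)) in
  let A := \bigcup_i H i in
  let D := polydisk 1 `\` A in
  ~ plurisubharmonic D (squeezing D) /\ ~ plurisubharmonic D (fridman D).
Proof.
move=> p H A D; pose a i := p i 0 (ord_first hn).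
have R0 : 0 < R := lt_trans hr hrR.
have za i : exists2 t, cabs t = r & z i = t *: axis hn.
  exact: (frontier_polydisk_axis hn _ hr).1 (hz i).
have pE i : p i = a i *: axis hn.
  by have [t _ zi] := za i; rewrite /a /p zi scalerA axis_first.
have aR i : cabs (a i) = R.
  have [t tr zi] := za i; rewrite /a /p zi scalerA axis_first cabsM cabs_real tr.
  by rewrite gtr0_norm ?divr_gt0 // divfK // gt_eqF.
have cov x : cabs x = r -> exists i, cabs (mobius x (a i)) < R.
  move=> xr; have fx : (frontier (polydisk r) `&` first_axis hn) (x *: axis hn).
    by apply/frontier_polydisk_axis => //; exists x.
  have [i _ xi] := hcover _ fx; exists i; have [b1 /(_ _ xi) cw] := hball _ (hz i).
  rewrite cabs_mobiusC -[x in mobius _ x](axis_first hn x).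
  apply: le_lt_trans cw; apply: mobius_le_caratheodory; last exact: b1.
  by rewrite -/(p i) pE; apply/polydisk_axis => //; rewrite aR.
have D1 : D `<=` polydisk 1 by move=> x [].
have RD : polydisk R `<=` D.
  move=> x xR; apply/domainP; split=> [j|]; first exact: lt_trans (xR j) hR.
  by apply/negP => /codomP[i xi]; have := xR (ord_first hn); rewrite xi aR ltxx.
split; apply: (not_plurisubharmonic hr hrR hR aR cov).
- exact: squeezing_ge.
- by move=> x i x1 xa; apply: (squeezing_le hn hR aR).
- exact: fridman_ge.
- by move=> x i x1 xa; apply: (fridman_le hn hR aR).
Qed.
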